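(* Let $(Z_n)$ be a BPREI as in the context such that $\mathbf E\log M_0=0$ and $0<\mathrm{Var}(\log M_0)<\infty$; $\mathrm{Var}(\xi_{0,1}\mid\mathcal E_0)/M_0^2\le\overline C$ a.s. for some constant $\overline C<\infty$; and $\eta_n\ge1$ a.s. for every $n\ge1$. Then for every $s>0$ there is a finite constant $C_s$ such that, for every initial law $\nu$ on $\{0,1,2,\dots\}$, the following hold. (i) If $\mathbf E\,e^{\theta(\log M_0)_+}<\infty$ for some $\theta>0$, then $$\mathbf E_\nu[Z_m^{-s};Z_m>0,L_m\ge0]\le C_s(1\vee m)^{-3/2}[1+\log(m+1)]^4,\qquad m\ge0.$$ (ii) If $\mathbf E[(\log M_0)_+^q]<\infty$ for some $q>12$, then $$\mathbf E_\nu[Z_m^{-s};Z_m>0,L_m\ge0]\le C_s(1\vee m)^{-1-\delta_q},\qquad\delta_q:=\frac{q-12}{2(q+4)}>0,\qquad m\ge0.$$ Moreover, denoting by $\overline a_m(s)$ the right-hand side in (i) or in (ii), in each case $\sum_{m\ge0}\overline a_m(s)<\infty$ and $$\frac1{d_n^-}\sum_{k=0}^{\lfloor n/2\rfloor}d_k^-\,\overline a_{n-k}(s)\longrightarrow0\qquad(n\to\infty).$$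
   Context: Notation: $x_+=\max(x,0)$, $a\vee b=\max(a,b)$, $\mathbf E[Y;B]=\mathbf E[Y\mathbf 1_B]$; $\mathbf E_\nu$ refers to initial law $\nu$. BPREI (branching process in an i.i.d. random environment with immigration). $\mathcal E_n=(Q_n,G_n)$, $n\ge0$, are i.i.d. marks, where $Q_n$ (reproduction law) and $G_n$ (immigration law) are random probability measures on $\{0,1,2,\dots\}$, possibly dependent on each other. Conditional on the environment, $Z_{n+1}=\sum_{i=1}^{Z_n}\xi_{n,i}+\eta_{n+1}$, where all the variables $\xi_{n,i},\eta_{n+1}$ are independent, $\xi_{n,i}\sim Q_n$, $\eta_{n+1}\sim G_n$; $Z_0$ is independent of everything else. $M_n$ is the mean of $Q_n$, in $(0,\infty)$ a.s. Environmental walk: $S_0:=0$, $S_n:=\sum_{j=0}^{n-1}\log M_j$, $L_n:=\min_{0\le j\le n}S_j$, $d_n^-:=\mathbf P(\max_{1\le j\le n}S_j<0)$ (with $d_0^-=1$). *)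

(* Defs.v *)
From HB Require Import structures.
From mathcomp Require Import all_boot all_order all_algebra.
From mathcomp Require Import all_classical all_reals all_analysis.
From mathcomp Require Import measurable_realfun.
Import Order.TTheory GRing.Theory Num.Theory.
Import numFieldNormedType.Exports.
Set Implicit Arguments.
Unset Strict Implicit.
Unset Printing Implicit Defensive.
Local Open Scope classical_set_scope.
Local Open Scope ring_scope.

Definition sigma_of (T I : Type) d' (T' : measurableType d')
    (X : I -> T -> T') : set (set T) :=
  <<s \bigcup_i preimage_set_system setT (X i) measurable >>.

Definition mutually_independent d (T : measurableType d) (R : realType)
    (P : probability T R) (I : choiceType) d' (T' : measurableType d')
    (X : I -> T -> T') : Prop :=
  forall (s : seq I) (A : I -> set T'),
    uniq s -> (forall i, measurable (A i)) ->
    P (\bigcap_(i in [set` s]) (X i @^-1` A i))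
    = (\prod_(i <- s) P (X i @^-1` A i))%E.

Definition identically_distributed d (T : measurableType d) (R : realType)
    (P : probability T R) (I : Type) d' (T' : measurableType d')
    (X : I -> T -> T') : Prop :=
  forall (i j : I) (A : set T'), measurable A ->
    P (X i @^-1` A) = P (X j @^-1` A).

(* [f] is a version of the conditional probability of [A] given the
   sigma-algebra [F] *)
Definition is_cond_prob d (T : measurableType d) (R : realType)
    (P : probability T R) (F : set (set T)) (A : set T) (f : T -> \bar R) :
    Prop :=
  preimage_set_system setT f measurable `<=` F /\
  forall B, F B -> P (A `&` B) = (\int[P]_(w in B) f w)%E.

(* Mean and variance of a law on nat: expectation and variance of the
   identity map; both may be infinite. *)
Definition law_mean (R : realType) (q : probability nat R) : \bar R :=
  ('E_q[fun k : nat => k%:R])%E.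

Definition law_var (R : realType) (q : probability nat R) : \bar R :=
  ('V_q[fun k : nat => k%:R])%E.

(* A branching process in an i.i.d. random environment with immigration.
   [bpQ n] and [bpG n] are the random reproduction and immigration laws of
   generation [n]; [pprobability nat R] is the space of probability measures on
   nat with the sigma-algebra generated by the evaluations.
   The offspring numbers of generation [n] are [bpxi n i] with [i] counted
   from 0.  The immigration [bpeta n.+1] has conditional law [bpG n];
   [bpeta 0] plays no role. *)
Record bprei (R : realType) := BPREI {
  bp_disp : measure_display;
  bp_space : measurableType bp_disp;
  bpP : probability bp_space R;
  bpQ : nat -> {RV bpP >-> pprobability nat R};
  bpG : nat -> {RV bpP >-> pprobability nat R};
  bpxi : nat -> nat -> {RV bpP >-> nat};
  bpeta : nat -> {RV bpP >-> nat};
  bpZ0 : {RV bpP >-> nat};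
  bpmark := (fun n w => (bpQ n w, bpG n w))
    : nat -> bp_space -> (pprobability nat R * pprobability nat R)%type;
  bp_mark_indep : mutually_independent bpP bpmark;
  bp_mark_ident : identically_distributed bpP bpmark;
  bp_mean_pos : forall n,
    {ae bpP, forall w, (0 < law_mean (bpQ n w) < +oo)%E};
  (* Given the environment, all the bpxi n i and bpeta n.+1 are independent,
     with laws bpQ n and bpG n.  Since A and A' may be setT at some indices,
     the square blocks n, i < N cover all finite subfamilies. *)
  bp_cond_law : forall (N : nat) (A : nat -> nat -> set nat)
      (A' : nat -> set nat),
    is_cond_prob bpP (sigma_of bpmark)
      [set w | forall n, (n < N)%N ->
         A' n (bpeta n.+1 w) /\ forall i, (i < N)%N -> A n i (bpxi n i w)]
      (fun w => \prod_(n < N)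
         ((bpG n w : probability nat R) (A' n) *
          \prod_(i < N) (bpQ n w : probability nat R) (A n i)))%E;
  bp_init_indep : forall (A : set nat) (B : set bp_space),
    <<s sigma_of bpmark `|`
        (sigma_of (fun ni : nat * nat => bpxi ni.1 ni.2 : bp_space -> nat) `|`
         sigma_of (fun n => bpeta n.+1 : bp_space -> nat)) >> B ->
    bpP (bpZ0 @^-1` A `&` B) = (bpP (bpZ0 @^-1` A) * bpP B)%E
}.
Arguments bpmark {R} b n w : rename.

Section Process.
Context (R : realType) (X : bprei R).
Local Notation P := (bpP X).

Fixpoint bpZ (n : nat) (w : bp_space X) : nat :=
  if n is n'.+1 then
    (\sum_(i < bpZ n' w) bpxi X n' i w + bpeta X n'.+1 w)%N
  else bpZ0 X w.

Definition bpM (n : nat) (w : bp_space X) : R := fine (law_mean (bpQ X n w)).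

Definition logM (n : nat) (w : bp_space X) : R := ln (bpM n w).

Definition walk (n : nat) (w : bp_space X) : R :=
  \sum_(0 <= j < n) logM j w.

(* The default value is walk 0 w = 0, itself one of the terms. *)
Definition walk_min (n : nat) (w : bp_space X) : R :=
  \big[Num.min/walk 0 w]_(0 <= j < n.+1) walk j w.

(* The maximum over the empty range is -oo, whence dminus 0 = 1. *)
Definition dminus (n : nat) : R :=
  fine (P [set w | (\big[maxe/-oo]_(1 <= j < n.+1) (walk j w)%:E < 0)%E]).

Definition has_init_law (nu : probability nat R) : Prop :=
  forall A : set nat, P (bpZ0 X @^-1` A) = nu A.

(* E[Z_m^{-s}; Z_m > 0, L_m >= 0] *)
Definition neg_moment (s : R) (m : nat) : \bar R :=
  'E_P[fun w => ((bpZ m w)%:R `^ (- s) *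
          \1_[set w | (0 < bpZ m w)%N /\ 0 <= walk_min m w] w)%R]%E.

End Process.
Arguments bpZ {R} X n w.
Arguments bpM {R} X n w.
Arguments logM {R} X n w.
Arguments walk {R} X n w.
Arguments walk_min {R} X n w.

(* The mark law determines the joint law of environment, offspring numbers and
   immigration, so that the laws P_nu of the process [X] started from nu are
   realised by the processes with the same mark law as [X] and initial law
   nu. *)
Definition same_mark_law (R : realType) (X Y : bprei R) : Prop :=
  forall A : set (pprobability nat R * pprobability nat R)%type,
    measurable A -> bpP Y (bpmark Y 0 @^-1` A) = bpP X (bpmark X 0 @^-1` A).

Definition rate_exp (R : realType) (C : R) (m : nat) : R :=
  C * (maxn 1 m)%:R `^ (- (3 / 2)) * (1 + ln (m.+1)%:R) ^+ 4.

Definition delta (R : realType) (q : R) : R := (q - 12) / (2 * (q + 4)).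

Definition rate_poly (R : realType) (C q : R) (m : nat) : R :=
  C * (maxn 1 m)%:R `^ (- 1 - delta q).

(* Main.v *)
(* Given the environment, Z dominates the process started from 0 with exactly one
   immigrant per generation, whose generating function is an iterated product.
   Since f_n(1 - t) <= 1 - 1 / (1 / (M_n t) + kappa) for the generating function
   f_n of the n-th reproduction law, on the event that S_m > x and that no step
   of the walk exceeds h this product at u = 1 - exp(-y) is at most
   exp(1 - (x - y) / c) with c of order 1 + h.  As u ^ Z_m is bounded below when
   Z_m <= exp(y), choosing y of order log m and x of order (1 + h) log m bounds
   E[Z_m^-s; Z_m > 0, L_m >= 0], up to m^-2, by the probabilities of
   - staying nonnegative and ending below x, of order (1 + x)^2 m^(-3/2): the
     first third of the walk, the last third read backwards and the bridge
     between them contribute m^(-1/2) each;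
   - staying nonnegative with a step above h, of order sqrt m * P(log M_0 > h).
   The levels h = (2 / theta) log(m + 1) and h = m^(2 / (q + 4)) give (i) and (ii).
   The bounds m^(-1/2) come from a submartingale of the reflected walk (staying
   on one side of a level) and from a concentration inequality (ending in a
   given interval); together with the decomposition at the minimum they show
   that d_n^- is of order n^(-1/2), whence the last limit. *)
Require Import Defs.
From HB Require Import structures.
From mathcomp Require Import all_boot all_order all_algebra.
From mathcomp Require Import all_classical all_reals all_analysis.
From mathcomp Require Import measurable_realfun.
From mathcomp Require Import zify ring lra.
Import Order.TTheory GRing.Theory Num.Theory.
Import numFieldNormedType.Exports.
Set Implicit Arguments.
Unset Strict Implicit.
Unset Printing Implicit Defensive.
Local Open Scope classical_set_scope.
Local Open Scope ring_scope.

(** * Laws of independent samples *)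

(** The walk enters only through its step law: its estimates are proved on finite powers of that law
    and carried to every process with the same marks, so the constants do not depend on the initial
    law. The comparison process is bounded environment by environment, and the obstacle there is a
    large upward step. Going back from time m, a quantity A grows from a multiple of exp(-S_m) by
    kappa times the successive exp(-S_i), and each factor gains the relative increment of A, which
    controls the increment of log A only up to a factor of order 1 + h if no step exceeds h. Hence
    the order (1 + h) log m of x, and a bound ((1 + h) log m)^2 m^(-3/2) to be weighed against sqrt
    m P(log M_0 > h). A logarithmic h gives the fourth power of the logarithm. For h = m^eps the
    logarithm is bounded by a multiple of m^eps too; balancing 4 eps - 3/2 with 1/2 - q eps gives
    eps = 2 / (q + 4), and the exponent is below -1 exactly when q > 12. *)

Lemma integral_prob_cst d (T : measurableType d) (R : realType) (P : probability T R)
  (z : \bar R) : (\int[P]_x z = z)%E.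
Proof.
rewrite (integral_cst _ measurableT) -[RHS]mule1; congr (_ * _)%E.
exact: probability_setT.
Qed.

Section power_measure.
Context d (T : measurableType d) (R : realType) (mu : probability T R).

Definition cons_pair n (p : T * n.-tuple T) : n.+1.-tuple T := [tuple of p.1 :: p.2].

Lemma measurable_cons_pair n : measurable_fun [set: T * n.-tuple T] (@cons_pair n).
Proof. exact: measurable_cons. Qed.

HB.instance Definition _ n := isMeasurableFun.Build _ _ _ _
  (@cons_pair n) (@measurable_cons_pair n).

Fixpoint power_measure n : probability (n.-tuple T) R :=
  match n return probability (n.-tuple T) R with
  | 0 => \d_[tuple]
  | n'.+1 => distribution (mu \x power_measure n')%E (@cons_pair n')
  end.

(** Integrands live on sequences and are measurable on each length ([seq_measurable]), so that
    prepending, concatenating and reversing need no casts between tuple types. *)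
Definition Epow n (F : seq T -> \bar R) : \bar R := (\int[power_measure n]_t F t)%E.

Definition seq_measurable d' (T' : measurableType d') (F : seq T -> T') :=
  forall n, measurable_fun [set: n.-tuple T] (fun t => F t).

Lemma Epow0 F : Epow 0 F = F [::].
Proof.
rewrite /Epow /= integral_dirac ?diracT ?mul1e//=.
move=> mD Y mY; rewrite setTI.
have [FY|FY] := pselect (Y (F [::])).
  rewrite (_ : _ @^-1` _ = setT)//; apply/seteqP; split=> // t _ /=.
  by rewrite (tuple0 t).
rewrite (_ : _ @^-1` _ = set0)//; apply/seteqP; split=> // t /=.
by rewrite (tuple0 t).
Qed.

Lemma seq_measurable_cons d' (T' : measurableType d') (F : seq T -> T') x :
  seq_measurable F -> seq_measurable (fun t => F (x :: t)).
Proof.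
move=> mF n; apply: (@measurableT_comp _ _ _ _ _ _
  (fun t : n.+1.-tuple T => F t) _ (fun t : n.-tuple T => [tuple of x :: t])) => //; first exact: mF.
by apply: (@measurable_cons _ _ _ _ (fun _ : n.-tuple T => x) n (fun t => t)) => //; exact: measurable_id.
Qed.

Lemma measurable_cons2 d' (T' : measurableType d') n (F : seq T -> T') : seq_measurable F ->
  measurable_fun [set: T * n.-tuple T] (fun p => F (p.1 :: p.2)).
Proof.
move=> mF; apply: (@measurableT_comp _ _ _ _ _ _
  (fun t : n.+1.-tuple T => F t) _ (@cons_pair n)) => //; exact: mF.
Qed.

Lemma EpowS n F : seq_measurable F -> (forall t, 0 <= F t)%E ->
  Epow n.+1 F = (\int[mu]_x Epow n (fun t => F (x :: t)))%E.
Proof.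
move=> mF F0; rewrite /Epow /= ge0_integral_distribution//; last exact: mF.
by rewrite (fubini_tonelli1 (fun p : T * n.-tuple T => F (p.1 :: p.2)))//; exact: measurable_cons2.
Qed.

Lemma measurable_Epow_cons n F : seq_measurable F -> (forall t, 0 <= F t)%E ->
  measurable_fun [set: T] (fun x => Epow n (fun t => F (x :: t))).
Proof.
move=> mF F0.
apply: (measurable_fun_fubini_tonelli_F (fun p : T * n.-tuple T => F (p.1 :: p.2))) => //.
exact: measurable_cons2.
Qed.

Lemma Epow_ge0 n F : (forall t, 0 <= F t)%E -> (0 <= Epow n F)%E.
Proof. by move=> F0; apply: integral_ge0. Qed.

Lemma eq_Epow n F G : (forall t, size t = n -> F t = G t) -> Epow n F = Epow n G.
Proof. by move=> FG; apply: eq_integral => t _; apply: FG; rewrite size_tuple. Qed.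

Lemma le_Epow n F G : seq_measurable F -> seq_measurable G ->
  (forall t, 0 <= F t)%E -> (forall t, size t = n -> F t <= G t)%E ->
  (Epow n F <= Epow n G)%E.
Proof.
move=> mF mG F0 FG; apply: ge0_le_integral => //; [exact: mF|exact: mG|].
by move=> t _; apply: FG; rewrite size_tuple.
Qed.

Lemma EpowD n F G : seq_measurable F -> seq_measurable G ->
  (forall t, 0 <= F t)%E -> (forall t, 0 <= G t)%E ->
  Epow n (fun t => F t + G t)%E = (Epow n F + Epow n G)%E.
Proof. by move=> mF mG F0 G0; rewrite /Epow ge0_integralD//; [exact: mF|exact: mG]. Qed.

Lemma EpowZl n F k : seq_measurable F -> (forall t, 0 <= F t)%E -> (0 <= k)%E ->
  Epow n (fun t => k * F t)%E = (k * Epow n F)%E.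
Proof. by move=> mF F0 k0; rewrite /Epow ge0_integralZl//; exact: mF. Qed.

Lemma Epow_cst n (k : \bar R) : Epow n (fun=> k) = k.
Proof. exact: integral_prob_cst. Qed.

Lemma measurable_cat_pair n k :
  measurable_fun [set: n.-tuple T * k.-tuple T] (fun p => [tuple of p.1 ++ p.2]).
Proof.
apply/measurable_fun_tnthP => i; case: (split_ordP i) => j ->.
- rewrite (_ : _ \o _ = (fun t : n.-tuple T => tnth t j) \o fst).
    by apply: measurableT_comp => //; exact: measurable_tnth.
  by apply/funext => p /=; rewrite tnth_lshift.
- rewrite (_ : _ \o _ = (fun t : k.-tuple T => tnth t j) \o snd).
    by apply: measurableT_comp => //; exact: measurable_tnth.
  by apply/funext => p /=; rewrite tnth_rshift.
Qed.

Lemma measurable_cat2 d' (T' : measurableType d') n k (F : seq T -> T') :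
  seq_measurable F ->
  measurable_fun [set: n.-tuple T * k.-tuple T] (fun p => F (p.1 ++ p.2)).
Proof.
move=> mF; apply: (@measurableT_comp _ _ _ _ _ _ (fun t : (n + k).-tuple T => F t) _
  (fun p : n.-tuple T * k.-tuple T => [tuple of p.1 ++ p.2])).
  exact: mF.
exact: measurable_cat_pair.
Qed.

Lemma seq_measurable_catl d' (T' : measurableType d') (F : seq T -> T') s :
  seq_measurable F -> seq_measurable (fun t => F (s ++ t)).
Proof.
elim: s F => [//|x s ih] F mF.
by apply: (ih (fun t => F (x :: t))); exact: seq_measurable_cons.
Qed.

Lemma seq_measurable_Epow_cat k F : seq_measurable F -> (forall t, 0 <= F t)%E ->
  seq_measurable (fun s => Epow k (fun t => F (s ++ t))).
Proof.
move=> mF F0 n.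
apply: (measurable_fun_fubini_tonelli_F
  (fun p : n.-tuple T * k.-tuple T => F (p.1 ++ p.2))) => //.
exact: measurable_cat2.
Qed.

(** The independence of two consecutive blocks of steps, used to condition on an initial block of
    any length. *)
Lemma Epow_cat n k F : seq_measurable F -> (forall t, 0 <= F t)%E ->
  Epow (n + k) F = Epow n (fun s => Epow k (fun t => F (s ++ t))).
Proof.
elim: n F => [|n ih] F mF F0; first by rewrite add0n Epow0.
rewrite addSn EpowS// EpowS//; last 2 first.
- exact: seq_measurable_Epow_cat.
- by move=> t; exact: Epow_ge0.
apply: eq_integral => x _.
by rewrite (ih (fun t => F (x :: t)))//; exact: seq_measurable_cons.
Qed.

Lemma measurable_rcons_pair n d' (T' : measurableType d') (F : seq T -> T') :
  seq_measurable F ->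
  measurable_fun [set: n.-tuple T * T] (fun p => F (rcons p.1 p.2)).
Proof.
move=> mF; under eq_fun do rewrite -cats1.
apply: (@measurableT_comp _ _ _ _ _ _ (fun p : n.-tuple T * 1.-tuple T => F (p.1 ++ p.2)) _
  (fun p : n.-tuple T * T => (p.1, [tuple of [:: p.2]]))).
  exact: measurable_cat2.
apply: measurable_fun_pair => //=.
exact: (@measurable_cons _ _ _ _ (@snd (n.-tuple T) T) 0 (fun=> [tuple])).
Qed.

Lemma seq_measurable_rcons d' (T' : measurableType d') (F : seq T -> T') x :
  seq_measurable F -> seq_measurable (fun t => F (rcons t x)).
Proof.
move=> mF n; apply: (@measurableT_comp _ _ _ _ _ _
  (fun p : n.-tuple T * T => F (rcons p.1 p.2)) _ (fun t : n.-tuple T => (t, x))).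
  exact: measurable_rcons_pair.
exact: pair2_measurable.
Qed.

Lemma Epow_rcons n F : seq_measurable F -> (forall t, 0 <= F t)%E ->
  Epow n.+1 F = (\int[mu]_x Epow n (fun t => F (rcons t x)))%E.
Proof.
move=> mF F0; rewrite -addn1 Epow_cat// /Epow.
rewrite -(fubini_tonelli (fun p : n.-tuple T * T => F (rcons p.1 p.2)))//; last first.
  exact: measurable_rcons_pair.
apply: eq_integral => t _.
rewrite -[LHS]/(Epow 1 (fun s => F (t ++ s))) EpowS//.
  by apply: eq_integral => x _; rewrite Epow0 cats1.
exact: seq_measurable_catl.
Qed.

Lemma seq_measurable_rev d' (T' : measurableType d') (F : seq T -> T') :
  seq_measurable F -> seq_measurable (fun t => F (rev t)).
Proof.
move=> mF n; apply: (@measurableT_comp _ _ _ _ _ _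
  (fun t : n.-tuple T => F t) _ (fun t : n.-tuple T => [tuple of rev t])).
  exact: mF.
apply: (measurable_fun_tnthP _).2 => i.
rewrite (_ : _ \o _ = (fun t : n.-tuple T => tnth t (rev_ord i))).
  exact: measurable_tnth.
apply/funext => t /=; rewrite (tnth_nth (tnth t i)) /= nth_rev ?size_tuple//.
exact/esym/tnth_nth.
Qed.

(** Singling out the first coordinate ([EpowS]) or the last one ([Epow_rcons]) gives the same
    integral, by Fubini. This is the duality of the walk under time reversal. *)
Lemma Epow_rev n F : seq_measurable F -> (forall t, 0 <= F t)%E ->
  Epow n (fun t => F (rev t)) = Epow n F.
Proof.
elim: n F => [|n ih] F mF F0; first by rewrite !Epow0.
rewrite EpowS//; last exact: seq_measurable_rev.
rewrite Epow_rcons//; apply: eq_integral => x _.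
rewrite -(ih (fun t => F (rcons t x)))//; last exact: seq_measurable_rcons.
by apply: eq_Epow => t _; rewrite rev_cons.
Qed.

Lemma power_measure_box n (A : nat -> set T) : (forall i, measurable (A i)) ->
  power_measure n [set t | forall i : 'I_n, A i (tnth t i)] =
  (\prod_(i < n) mu (A i))%E.
Proof.
elim: n A => [|n ih] A mA.
  rewrite big_ord0 (_ : [set _ | _] = setT) ?probability_setT//.
  by apply/seteqP; split => // t _ [].
rewrite big_ord_recl /= -(ih (fun i => A i.+1))//.
rewrite -product_measure1E//; last first.
  rewrite (_ : [set _ | _] = \bigcap_(i in [set: 'I_n]) ((@tnth n T ^~ i) @^-1` A i.+1)).
    apply: fin_bigcap_measurable => // i _; rewrite -[X in measurable X]setTI.
    exact: measurable_tnth.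
  by apply/seteqP; split => t /= h i; [move=> _; exact: h|exact: h].
rewrite /distribution /pushforward; congr (_ _).
apply/seteqP; split => [[x t]|[x t]] /=.
- move=> h; split; first by have := h ord0; rewrite tnth0.
  by move=> i; have := h (lift ord0 i); rewrite tnthS.
- move=> [h0 h] i; case: (unliftP ord0 i) => [j|] ->; last by rewrite tnth0.
  by rewrite tnthS; exact: h.
Qed.

(** The boxes form a pi-system that generates the product sigma-algebra, so the product formula on
    boxes determines the law of the first [n] variables. *)
Lemma law_power_measure d' (T' : measurableType d') (P : probability T' R)
    (X : nat -> T' -> T) n :
  (forall i, measurable_fun setT (X i)) ->
  (forall A : nat -> set T, (forall i, measurable (A i)) ->
     P [set w | forall i : 'I_n, A i (X i w)] = (\prod_(i < n) mu (A i))%E) ->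
  forall F, seq_measurable F -> (forall t, 0 <= F t)%E ->
  (\int[P]_w F (mkseq (X ^~ w) n) = Epow n F)%E.
Proof.
move=> mX indepX F mF F0.
pose V w := [tuple X i w | i < n].
have mV : measurable_fun setT V.
  apply/measurable_fun_tnthP => i; rewrite (_ : _ \o _ = X i)//.
  by apply/funext => w /=; rewrite tnth_mktuple.
pose V' : {mfun T' >-> n.-tuple T} := mfun_Sub (mem_set mV).
transitivity (\int[distribution P V']_t F t)%E.
  rewrite ge0_integral_distribution//; last exact: mF.
  apply: eq_integral => w _ /=; rewrite /mkseq -val_enum_ord -map_comp.
  by congr F.
pose G := [set B : set (n.-tuple T) | exists2 A : nat -> set T,
   (forall i, measurable (A i)) & B = [set t | forall i : 'I_n, A i (tnth t i)]].
apply: eq_measure_integral => B mB _.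
have GT : G setT.
  by exists (fun=> setT) => //; apply/seteqP; split.
have mG : G `<=` measurable.
  move=> _ [A mA ->].
  rewrite (_ : [set _ | _] = \bigcap_(i in [set: 'I_n]) ((@tnth n T ^~ i) @^-1` A i)).
    apply: fin_bigcap_measurable => // i _; rewrite -[X in measurable X]setTI.
    exact: measurable_tnth.
  by apply/seteqP; split => t /= h i; [move=> _; exact: h|exact: h].
apply: (@measure_unique _ _ _ G (fun=> setT)) => //.
- apply/seteqP; split; last first.
    by apply: smallest_sub => //; exact: sigma_algebra_measurable.
  apply: smallest_sub; first exact: smallest_sigma_algebra.
  rewrite -bigcup_seq => _ [i _ [A mA <-]]; apply: sub_sigma_algebra.
  exists (fun j : nat => if j == i :> nat then A else setT).
    by move=> j; case: ifP.
  rewrite setTI; apply/seteqP; split => t /=.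
    by move=> ? j; case: eqP => // /val_inj ->.
  by move=> /(_ i); rewrite eqxx.
- move=> _ _ [A mA ->] [A' mA' ->]; exists (fun i => A i `&` A' i).
    by move=> i; exact: measurableI.
  by apply/seteqP; split => t /= => [[h h'] i //|h]; split => i; have [] := h i.
- exact: bigcup_const.
- move=> _ [A mA ->]; apply: (eq_trans _ (esym (power_measure_box n mA))).
  rewrite -indepX//; congr (P _).
  apply/seteqP; split => w /= h i; have := h i; by rewrite tnth_mktuple.
- move=> k; rewrite [X in (X < _)%E](_ : _ = 1%E) ?ltry//.
  exact: (probability_setT (distribution P V')).
Qed.

End power_measure.

(** * Partial sums and one-sided conditions *)

Section walk_sums.
Context (R : realType).
Implicit Types (t : seq R).

Definition psum t k : R := \sum_(0 <= i < k) t`_i.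

Lemma psum0 t : psum t 0 = 0.
Proof. by rewrite /psum big_geq. Qed.

Lemma psumS t k : psum t k.+1 = psum t k + t`_k.
Proof. by rewrite /psum big_nat_recr. Qed.

Lemma psum_cons y t k : psum (y :: t) k.+1 = y + psum t k.
Proof. by rewrite /psum big_nat_recl. Qed.

Lemma psum_catl s t k : (k <= size s)%N -> psum (s ++ t) k = psum s k.
Proof.
move=> ks; apply: eq_big_nat => i /andP[_ ik].
by rewrite nth_cat (leq_trans ik ks).
Qed.

Lemma psum_catr s t k : psum (s ++ t) (size s + k) = psum s (size s) + psum t k.
Proof.
elim: k => [|k ih]; first by rewrite addn0 psum0 addr0 psum_catl.
by rewrite addnS !psumS ih nth_cat ltnNge leq_addr/= addKn addrA.
Qed.

Lemma psum_rev t k : (k <= size t)%N ->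
  psum (rev t) k = psum t (size t) - psum t (size t - k).
Proof.
elim: k => [|k ih] kt; first by rewrite psum0 subn0 subrr.
by rewrite psumS ih ?(ltnW kt)// nth_rev// -(subnSK kt) psumS; ring.
Qed.

(** The sign [e] treats both barriers at once: [e = 1] bounds the walk above by [x], while [e = -1]
    with [x = 0] makes it nonnegative. *)
Definition prefix_le (e x : R) t :=
  all (fun k => e * psum t k <= x) (iota 0 (size t).+1).

Definition suffix_le (e x : R) t :=
  all (fun k => e * (psum t (size t) - psum t k) <= x) (iota 0 (size t).+1).

Lemma prefix_leP (e x : R) t :
  reflect (forall k, (k <= size t)%N -> e * psum t k <= x) (prefix_le e x t).
Proof.
apply: (iffP allP) => h k; first by move=> kt; apply: h; rewrite mem_iota.
by rewrite mem_iota => /andP[_]; rewrite add0n ltnS; exact: h.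
Qed.

Lemma suffix_leP (e x : R) t :
  reflect (forall k, (k <= size t)%N -> e * (psum t (size t) - psum t k) <= x)
          (suffix_le e x t).
Proof.
apply: (iffP allP) => h k; first by move=> kt; apply: h; rewrite mem_iota.
by rewrite mem_iota => /andP[_]; rewrite add0n ltnS; exact: h.
Qed.

Lemma prefix_le_rev (e x : R) t : prefix_le e x (rev t) = suffix_le e x t.
Proof.
apply/prefix_leP/suffix_leP; rewrite size_rev => h k kt.
  have := h (size t - k)%N (leq_subr _ _).
  by rewrite psum_rev ?leq_subr// subKn.
by rewrite psum_rev// h// leq_subr.
Qed.

Lemma prefix_le_catl (e x : R) s t : prefix_le e x (s ++ t) -> prefix_le e x s.
Proof.
move=> /prefix_leP h; apply/prefix_leP => k ks.
by rewrite -(psum_catl t ks) h// size_cat (leq_trans ks)// leq_addr.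
Qed.

(* Lindley's recursion: the walk [e * psum] started at [r], reflected at 0. *)
Definition lindley (e r : R) t := foldl (fun r x => Num.max (r + e * x) 0) r t.

Lemma lindley_ge0 e r t : 0 <= r -> 0 <= lindley e r t.
Proof.
by elim: t r => [//|y t ih] r r0 /=; apply: ih; rewrite le_max lexx orbT.
Qed.

(** With [n] the size of [t], the reflected walk is the maximum of [r + e * S_n] and of the
    increments [e * (S_n - S_k)] for [1 <= k <= n]; started at 0, the former is the increment with
    [k = 0]. *)
Lemma lindley_leE e x r t :
  (lindley e r t <= x) =
  (r + e * psum t (size t) <= x) &&
  all (fun k => e * (psum t (size t) - psum t k) <= x) (iota 1 (size t)).
Proof.
elim: t r => [|y t ih] r; first by rewrite /= psum0 mulr0 addr0 andbT.
rewrite /= ih psum_cons -[2%N]/(1 + 1)%N iotaDl all_map.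
rewrite psum_cons psum0.
rewrite (eq_all (a2 := fun k => e * (psum t (size t) - psum t k) <= x)); last first.
  by move=> k /=; rewrite add1n !psum_cons; congr (_ <= _); ring.
rewrite andbA; congr andb.
set P := psum t (size t).
have -> : y + P - (y + 0) = P by ring.
rewrite mulrDr addrA; have [h|h] := leP (r + e * y) 0.
  by apply/idP/andP => [h2|[h2 h3]]; [split|]; lra.
by apply/idP/andP => [h2|[h2 h3]]; [split|]; lra.
Qed.

Lemma lindley0_le e x t : 0 <= x -> (lindley e 0 t <= x) = suffix_le e x t.
Proof.
by move=> x0; rewrite lindley_leE add0r /suffix_le /= psum0 subr0.
Qed.

End walk_sums.

Section walk_measurable.
Context (R : realType).

Lemma seq_measurable_nth i : seq_measurable (fun t : seq R => t`_i).
Proof.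
move=> n; have [ni|ni] := ltnP i n.
  rewrite (_ : (fun _ => _) = (fun t : n.-tuple R => tnth t (Ordinal ni))).
    exact: measurable_tnth.
  by apply/funext => t; rewrite (tnth_nth 0).
rewrite (_ : (fun _ => _) = cst 0)//; apply/funext => t /=.
by rewrite nth_default// size_tuple.
Qed.

Lemma seq_measurable_psum k : seq_measurable (fun t : seq R => psum t k).
Proof.
move=> n; apply: measurable_sum => i; exact: seq_measurable_nth.
Qed.

Lemma measurable_fun_all d (T : measurableType d) (I : Type) (s : seq I)
    (p : I -> T -> bool) :
  (forall i, measurable_fun setT (p i)) ->
  measurable_fun setT (fun x => all (p ^~ x) s).
Proof.
move=> mp; elim: s => [|i s ih] /=; first exact: measurable_cst.
by apply: measurable_and.
Qed.

Lemma seq_measurable_prefix_le e x : seq_measurable (@prefix_le R e x).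
Proof.
move=> n; rewrite (_ : (fun _ => _) = (fun t : n.-tuple R =>
   all (fun k => e * psum t k <= x) (iota 0 n.+1))); last first.
  by apply/funext => t; rewrite /prefix_le size_tuple.
apply: measurable_fun_all => k; apply: measurable_fun_ler => //.
by apply: measurable_funM => //; exact: seq_measurable_psum.
Qed.

Lemma measurable_lindley n e :
  measurable_fun [set: R * n.-tuple R] (fun p => lindley e p.1 p.2).
Proof.
elim: n => [|n ih].
  by rewrite (_ : (fun _ => _) = fst)//; apply/funext => -[r t] /=; rewrite (tuple0 t).
rewrite (_ : (fun _ => _) = (fun p : R * n.-tuple R => lindley e p.1 p.2) \o
  (fun p : R * n.+1.-tuple R => (Num.max (p.1 + e * thead p.2) 0, [tuple of behead p.2]))).
  apply: measurableT_comp => //; apply: measurable_fun_pair => /=.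
    apply: measurable_maxr => //; apply: measurable_funD => //.
    apply: measurable_funM => //.
    apply: (measurableT_comp (@measurable_tnth _ _ n.+1 ord0)) => //.
  apply: (measurable_fun_tnthP _).2 => i.
  rewrite (_ : _ \o _ = (fun t : n.+1.-tuple R => tnth t (lift ord0 i)) \o snd).
    by apply: measurableT_comp => //; exact: measurable_tnth.
  apply/funext => -[r t] /=; case/tupleP: t => y t /=; rewrite tnthS.
  by congr tnth; apply/val_inj.
by apply/funext => -[r t] /=; case/tupleP: t => y t /=; rewrite theadE.
Qed.

Lemma seq_measurable_lindley e r : seq_measurable (@lindley R e r).
Proof.
move=> n; apply: (@measurableT_comp _ _ _ _ _ _
  (fun p : R * n.-tuple R => lindley e p.1 p.2) _ (fun t : n.-tuple R => (r, t))).
  exact: measurable_lindley.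
exact: pair1_measurable.
Qed.

End walk_measurable.

(** * Probability of staying on one side *)

Section occupation.
Context (R : realType) (mu : probability R R).

Implicit Types (p q : seq R -> bool).

Definition Ppow n (p : seq R -> bool) : \bar R := Epow mu n (fun t => (p t)%:R%:E).

Lemma measurable_natr_bool d (T : measurableType d) (p : T -> bool) :
  measurable_fun setT p -> measurable_fun setT (fun x => (p x)%:R%:E : \bar R).
Proof.
move=> mp; apply/measurable_EFinP.
rewrite (_ : (fun x => _) = (fun x => if p x then 1 else 0)); last first.
  by apply/funext => x; case: (p x).
by apply: measurable_fun_ifT.
Qed.

Lemma seq_measurable_natr (p : seq R -> bool) : seq_measurable p ->
  seq_measurable (fun t => (p t)%:R%:E : \bar R).
Proof. by move=> mp n; exact: (measurable_natr_bool (mp n)). Qed.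

Lemma Ppow_ge0 n p : (0 <= Ppow n p)%E.
Proof. by apply: Epow_ge0 => t; rewrite lee_fin ler0n. Qed.

Lemma le_Ppow n p q : seq_measurable p -> seq_measurable q ->
  (forall t, size t = n -> p t -> q t) -> (Ppow n p <= Ppow n q)%E.
Proof.
move=> mp mq pq; apply: le_Epow; try exact: seq_measurable_natr.
  by move=> t; rewrite lee_fin ler0n.
move=> t tn; rewrite lee_fin ler_nat; have := pq t tn.
by case: (p t) => // /(_ isT) ->.
Qed.

Lemma eq_Ppow n p q : (forall t, size t = n -> p t = q t) -> Ppow n p = Ppow n q.
Proof. by move=> pq; apply: eq_Epow => t /pq ->. Qed.

Lemma Ppow_le1 n p : seq_measurable p -> (Ppow n p <= 1)%E.
Proof.
move=> mp; rewrite -[leRHS](Epow_cst mu n).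
apply: le_Epow; [exact: seq_measurable_natr| by move=> k; exact: measurable_cst| |].
  by move=> t; rewrite lee_fin ler0n.
by move=> t _; rewrite lee_fin; case: (p t).
Qed.

Lemma Ppow_fin n p : seq_measurable p -> Ppow n p \is a fin_num.
Proof.
by move=> mp; rewrite ge0_fin_numE ?Ppow_ge0// (le_lt_trans (Ppow_le1 n mp))// ltry.
Qed.

(* Quadratic up to b, then linear: along the reflected walk this is a
   submartingale that gains a fixed amount at each visit to [0, x0], while its
   mean grows only like sqrt n. *)
Definition huber (b r : R) := if r <= b then r ^+ 2 else 2 * b * r - b ^+ 2.

Lemma huber_ge0 b r : 0 <= b -> 0 <= huber b r.
Proof. by rewrite /huber => b0; case: (leP r b) => h; nra. Qed.

Lemma huber_le b r : 0 <= b -> 0 <= r -> huber b r <= 2 * b * r.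
Proof. by rewrite /huber => b0 r0; case: (leP r b) => h; nra. Qed.

(** [huber b] is convex with derivative [2 min(r, b)], so it lies above its tangents, and these are
    nonpositive where the reflection acts. The gain [x ^ 2] is exact while [r] and [r + x] both lie
    in the quadratic part, which [x0 + K <= b] guarantees. *)
Lemma huber_step (b x0 K r x : R) : 0 <= r -> 0 <= x0 -> 0 <= K -> x0 + K <= b ->
  huber b r + 2 * Num.min r b * x + ((r <= x0) && (0 <= x <= K))%:R * x ^+ 2
  <= huber b (Num.max (r + x) 0).
Proof.
move=> r0 x00 K0 x0K; rewrite /huber.
have [rx0|rx0] := leP r x0; last first.
  rewrite mul0r addr0.
  have [rb|rb] := leP r b.
    have [rx|rx] := leP (r + x) 0; case: (leP _ b) => h; nra.
  have [rx|rx] := leP (r + x) 0; case: (leP _ b) => h; nra.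
have rb : r <= b by lra.
rewrite rb/=; case: (leP r b) rb => // rb _.
have [x_ge0|x_lt0] := leP 0 x; have [xK|xK] := leP x K; rewrite /= ?mul1r ?mul0r.
all: have [rx|rx] := leP (r + x) 0; case: (leP _ b) => h; nra.
Qed.

Lemma measurable_huber b : measurable_fun setT (huber b).
Proof.
apply: measurable_fun_ifT => //.
  exact: measurable_fun_ler.
apply: measurable_funB => //.
Qed.

Variables (e a s2 c K : R).
Hypothesis e2 : e ^+ 2 = 1.
Hypothesis int_pos : (\int[mu]_x (Num.max (e * x) 0)%:E = a%:E)%E.
Hypothesis int_neg : (\int[mu]_x (Num.max (- (e * x)) 0)%:E = a%:E)%E.
Hypothesis int_sq : (\int[mu]_x (x ^+ 2)%:E = s2%:E)%E.
Hypothesis K_ge0 : 0 <= K.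
Hypothesis int_trunc : (\int[mu]_x ((0 <= e * x <= K)%R%:R * x ^+ 2)%:E = c%:E)%E.

Let mpos : measurable_fun [set: R] (fun x => Num.max (e * x) 0).
Proof. exact: measurable_maxr. Qed.

Let mneg : measurable_fun [set: R] (fun x => Num.max (- (e * x)) 0).
Proof. by apply: measurable_maxr => //; exact: measurableT_comp. Qed.

Let mlind r : measurable_fun [set: R] (fun x => Num.max (r + e * x) 0).
Proof. by apply: measurable_maxr => //; exact: measurable_funD. Qed.

Let mtrunc : measurable_fun [set: R] (fun x => (0 <= e * x <= K)%R%:R * x ^+ 2).
Proof.
have mb : measurable_fun [set: R] (fun x : R => (0 <= e * x) && (e * x <= K)).
  by apply: measurable_and; apply: measurable_fun_ler.
apply: measurable_funM => //; apply/measurable_EFinP; exact: (measurable_natr_bool mb).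
Qed.

Let a_ge0 : 0 <= a.
Proof.
by rewrite -lee_fin -int_pos integral_ge0// => x _; rewrite lee_fin le_max lexx orbT.
Qed.

Let trunc_ge0 x : 0 <= (0 <= e * x <= K)%R%:R * x ^+ 2.
Proof. by rewrite mulr_ge0// sqr_ge0. Qed.

Let maxx0 x : (0 <= Num.max x 0 :> R).
Proof. by rewrite le_max lexx orbT. Qed.

Let pos_neg x : x = Num.max x 0 - Num.max (- x) 0 :> R.
Proof.
have [h|h] := leP x 0; have [h'|h'] := leP (- x) 0; lra.
Qed.

Lemma lindley_huber_step (b x0 r : R) : 0 <= r -> 0 <= x0 -> x0 + K <= b ->
  ((huber b r)%:E + c%:E * (r <= x0)%R%:R%:E <=
   \int[mu]_x (huber b (Num.max (r + e * x) 0))%:E)%E.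
Proof.
move=> r0 x00 x0K; have b0 : 0 <= b by have := K_ge0; lra.
set m := 2 * Num.min r b.
have m0 : 0 <= m by rewrite mulr_ge0// le_min r0.
have mh : measurable_fun [set: R] (fun x => huber b (Num.max (r + e * x) 0)).
  by apply: measurableT_comp => //; exact: measurable_huber.
(* The linear term has mean zero; adding [m * a], the integral of [m] times the negative part, to
   both sides keeps all integrands nonnegative. *)
have key : ((huber b r)%:E + c%:E * (r <= x0)%R%:R%:E + (m * a)%:E <=
   \int[mu]_x (huber b (Num.max (r + e * x) 0))%:E + (m * a)%:E)%E.
  rewrite [in leRHS]EFinM -[in leRHS]int_neg -ge0_integralZl//; last 2 first.
  - by apply/measurable_EFinP.
  - by move=> x _; rewrite lee_fin.
  rewrite -ge0_integralD//; last 4 first.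
  - by move=> x _; rewrite lee_fin huber_ge0.
  - exact/measurable_EFinP.
  - by move=> x _; rewrite -EFinM lee_fin mulr_ge0.
  - by apply: measurable_funeM; exact/measurable_EFinP.
  have -> : ((huber b r)%:E + c%:E * (r <= x0)%R%:R%:E + (m * a)%:E =
    \int[mu]_x ((huber b r)%:E + ((r <= x0)%R%:R%:E * ((0 <= e * x <= K)%R%:R * x ^+ 2)%:E
       + m%:E * (Num.max (e * x) 0)%:E)))%E.
    rewrite ge0_integralD//; last 3 first.
    - by move=> x _; rewrite lee_fin huber_ge0.
    - by move=> x _; rewrite -!EFinM -EFinD lee_fin addr_ge0// mulr_ge0.
    - by apply: emeasurable_funD; apply: measurable_funeM; exact/measurable_EFinP.
    rewrite ge0_integralD//; last 4 first.
    - by move=> x _; rewrite -!EFinM lee_fin mulr_ge0.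
    - by apply: measurable_funeM; exact/measurable_EFinP.
    - by move=> x _; rewrite -!EFinM lee_fin mulr_ge0.
    - by apply: measurable_funeM; exact/measurable_EFinP.
    rewrite !ge0_integralZl//; last 4 first.
    - exact/measurable_EFinP.
    - by move=> x _; rewrite lee_fin.
    - exact/measurable_EFinP.
    - by move=> x _; rewrite lee_fin.
    rewrite int_pos int_trunc integral_prob_cst.
    by rewrite -!EFinM -!EFinD; congr EFin; ring.
  apply: ge0_le_integral => //.
  - by move=> x _; rewrite -!EFinM -!EFinD lee_fin !addr_ge0// ?huber_ge0// mulr_ge0.
  - apply: emeasurable_funD => //.
    by apply: emeasurable_funD; apply: measurable_funeM; exact/measurable_EFinP.
  - apply: emeasurable_funD; first exact/measurable_EFinP.
    by apply: measurable_funeM; exact/measurable_EFinP.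
  - move=> x _; rewrite -!EFinM -!EFinD lee_fin.
    have := @huber_step b x0 K r (e * x) r0 x00 K_ge0 x0K.
    rewrite -/m exprMn e2 mul1r.
    rewrite -mulnb natrM mulrA.
    have : m * (e * x) = m * Num.max (e * x) 0 - m * Num.max (- (e * x)) 0.
      by rewrite -mulrBr -pos_neg.
    lra.
by move: key; rewrite leeD2rE.
Qed.

Lemma lindley_sq_step (r : R) : 0 <= r ->
  (\int[mu]_x ((Num.max (r + e * x) 0) ^+ 2)%:E <= (r ^+ 2 + s2)%:E)%E.
Proof.
move=> r0.
have mh : measurable_fun [set: R] (fun x => (Num.max (r + e * x) 0) ^+ 2).
  by apply: measurable_funX.
have key : (\int[mu]_x ((Num.max (r + e * x) 0) ^+ 2)%:E + (2 * r * a)%:E <=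
   (r ^+ 2 + s2)%:E + (2 * r * a)%:E)%E.
  rewrite [in leLHS]EFinM -[in leLHS]int_neg -ge0_integralZl//; last 3 first.
  - by apply/measurable_EFinP.
  - by move=> x _; rewrite lee_fin.
  - by rewrite lee_fin mulr_ge0.
  rewrite -ge0_integralD//; last 4 first.
  - by move=> x _; rewrite lee_fin sqr_ge0.
  - exact/measurable_EFinP.
  - by move=> x _; rewrite -EFinM lee_fin !mulr_ge0.
  - by apply: measurable_funeM; exact/measurable_EFinP.
  have -> : ((r ^+ 2 + s2)%:E + (2 * r * a)%:E =
    \int[mu]_x ((r ^+ 2)%:E + ((x ^+ 2)%:E + (2 * r)%:E * (Num.max (e * x) 0)%:E)))%E.
    rewrite ge0_integralD//; last 3 first.
    - by move=> x _; rewrite lee_fin sqr_ge0.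
    - by move=> x _; rewrite -!EFinM -EFinD lee_fin addr_ge0// ?sqr_ge0// !mulr_ge0.
    - apply: emeasurable_funD; first by apply/measurable_EFinP.
      by apply: measurable_funeM; exact/measurable_EFinP.
    rewrite ge0_integralD//; last 4 first.
    - by move=> x _; rewrite lee_fin sqr_ge0.
    - by apply/measurable_EFinP.
    - by move=> x _; rewrite -!EFinM lee_fin !mulr_ge0.
    - by apply: measurable_funeM; exact/measurable_EFinP.
    rewrite ge0_integralZl//; last 3 first.
    - exact/measurable_EFinP.
    - by move=> x _; rewrite lee_fin.
    - by rewrite lee_fin mulr_ge0.
    rewrite int_pos int_sq integral_prob_cst.
    by rewrite -!EFinM -!EFinD; congr EFin; ring.
  apply: ge0_le_integral => //.
  - by move=> x _; rewrite -!EFinM -!EFinD lee_fin addr_ge0// ?sqr_ge0// !mulr_ge0.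
  - apply: emeasurable_funD; first exact/measurable_EFinP.
    by apply: measurable_funeM; exact/measurable_EFinP.
  - apply: emeasurable_funD => //; apply: emeasurable_funD; first by apply/measurable_EFinP.
    by apply: measurable_funeM; exact/measurable_EFinP.
  - move=> x _; rewrite -!EFinM -!EFinD lee_fin.
    have h1 : (Num.max (r + e * x) 0) ^+ 2 <= (r + e * x) ^+ 2.
      by have [h|h] := leP (r + e * x) 0; rewrite ?expr0n ?sqr_ge0.
    have h2 : (e * x) ^+ 2 = x ^+ 2 by rewrite exprMn e2 mul1r.
    have h3 := pos_neg (e * x).
    have : (r + e * x) ^+ 2 = r ^+ 2 + x ^+ 2 + 2 * r * (Num.max (e * x) 0 - Num.max (- (e * x)) 0).
      by rewrite -h3 -h2; ring.
    lra.
by move: key; rewrite leeD2rE.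
Qed.

End occupation.

Section Ppow_invariance.
Context (R : realType) (mu : probability R R).

Lemma Ppow_catl_le k j (p : seq R -> bool) : seq_measurable p ->
  (forall s t, p (s ++ t) -> p s) ->
  (Ppow mu (k + j) p <= Ppow mu k p)%E.
Proof.
move=> mp hp; rewrite {1}/Ppow Epow_cat//; last exact: (seq_measurable_natr mp).
apply: le_Epow.
- apply: (@seq_measurable_Epow_cat _ _ _ mu j (fun t => ((p t)%:R)%:E)).
    exact: (seq_measurable_natr mp).
  by move=> t; rewrite lee_fin ler0n.
- exact: (seq_measurable_natr mp).
- by move=> t; apply: Epow_ge0 => u; rewrite lee_fin ler0n.
- move=> s _; have [ps|nps] := boolP (p s).
    exact: (Ppow_le1 mu j (seq_measurable_catl s mp)).
  rewrite (@eq_Epow _ _ _ mu j _ (cst 0%E)) ?Epow_cst// => t _ /=.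
  by have [/hp|//] := boolP (p (s ++ t)); rewrite (negbTE nps).
Qed.

Lemma Ppow_rev k (p : seq R -> bool) : seq_measurable p ->
  Ppow mu k (fun t => p (rev t)) = Ppow mu k p.
Proof.
move=> mp; rewrite /Ppow.
rewrite (@Epow_rev _ _ _ mu k (fun t => ((p t)%:R)%:E))//.
exact: (seq_measurable_natr mp).
Qed.

Lemma Ppow_prefix_suffix k (e0 x : R) :
  Ppow mu k (prefix_le e0 x) = Ppow mu k (suffix_le e0 x).
Proof.
rewrite -Ppow_rev; last exact: seq_measurable_prefix_le.
by apply: eq_Ppow => t _; rewrite prefix_le_rev.
Qed.

End Ppow_invariance.

Section occupation_bound.
Context (R : realType) (mu : probability R R).
Variables (e a s2 c K : R).
Hypothesis e2 : e ^+ 2 = 1.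
Hypothesis int_pos : (\int[mu]_x (Num.max (e * x) 0)%:E = a%:E)%E.
Hypothesis int_neg : (\int[mu]_x (Num.max (- (e * x)) 0)%:E = a%:E)%E.
Hypothesis int_sq : (\int[mu]_x (x ^+ 2)%:E = s2%:E)%E.
Hypothesis K_ge0 : 0 <= K.
Hypothesis int_trunc : (\int[mu]_x ((0 <= e * x <= K)%R%:R * x ^+ 2)%:E = c%:E)%E.
Hypothesis c_gt0 : 0 < c.

Let s2_ge0 : 0 <= s2.
Proof.
by rewrite -lee_fin -int_sq integral_ge0// => x _; rewrite lee_fin sqr_ge0.
Qed.

Let mlind r : measurable_fun [set: R] (fun x => Num.max (r + e * x) 0).
Proof.
by apply: measurable_maxr => //; apply: measurable_funD => //; exact: measurable_funM.
Qed.

Let mlsq r : seq_measurable (fun t => (lindley e r t ^+ 2)%:E : \bar R).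
Proof.
move=> n; apply/measurable_EFinP; apply: measurable_funX.
exact: seq_measurable_lindley.
Qed.

Let lsq_ge0 r (t : seq R) : (0 <= (lindley e r t ^+ 2)%:E)%E.
Proof. by rewrite lee_fin sqr_ge0. Qed.

Lemma Epow_lindley_sq n r : 0 <= r ->
  (Epow mu n (fun t => (lindley e r t ^+ 2)%:E) <= (r ^+ 2 + n%:R * s2)%:E)%E.
Proof.
elim: n r => [|n ih] r r0; first by rewrite Epow0/= mul0r addr0.
rewrite EpowS//.
apply: (@le_trans _ _ (\int[mu]_x ((Num.max (r + e * x) 0) ^+ 2 + n%:R * s2)%:E)%E).
  apply: ge0_le_integral => //.
  - by move=> x _; exact: Epow_ge0.
  - exact: (@measurable_Epow_cons _ _ _ mu n (fun t => (lindley e r t ^+ 2)%:E)).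
  - by apply/measurable_EFinP; apply: measurable_funD => //; exact: measurable_funX.
  - by move=> x _; apply: ih; rewrite le_max lexx orbT.
under eq_integral do rewrite EFinD.
rewrite ge0_integralD//; last 3 first.
- by move=> x _; rewrite lee_fin sqr_ge0.
- by apply/measurable_EFinP; exact: measurable_funX.
- by move=> x _; rewrite lee_fin mulr_ge0.
rewrite integral_prob_cst.
apply: (le_trans (leeD2r _ (lindley_sq_step e2 int_pos int_neg int_sq r0))).
by rewrite -EFinD lee_fin -[in leRHS]natr1; lra.
Qed.

Let mlin r : seq_measurable (fun t => (lindley e r t)%:E : \bar R).
Proof. by move=> n; apply/measurable_EFinP; exact: seq_measurable_lindley. Qed.

Lemma Epow_lindley n : (0 < n)%N ->
  (Epow mu n (fun t => (lindley e 0 t)%:E) <= ((s2 + 1) / 2 * Num.sqrt n%:R)%:E)%E.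
Proof.
move=> n0; set q := Num.sqrt n%:R.
have q0 : 0 < q by rewrite sqrtr_gt0 ltr0n.
have q2 : q ^+ 2 = n%:R by rewrite sqr_sqrtr.
(* In place of Cauchy-Schwarz: [y <= y^2 / (2 q) + q / 2], with [q = sqrt n] matching a second
   moment of order [n]. *)
apply: (@le_trans _ _ (Epow mu n (fun t => ((2 * q)^-1)%:E * (lindley e 0 t ^+ 2)%:E + (q / 2)%:E)%E)).
  apply: le_Epow => //.
  - move=> k; apply: emeasurable_funD => //; apply: measurable_funeM; exact: mlsq.
  - by move=> t; rewrite lee_fin lindley_ge0.
  - move=> t _; rewrite -EFinM -EFinD lee_fin.
    set y := lindley e 0 t.
    have : 0 <= (2 * q)^-1 * (y - q) ^+ 2 by rewrite mulr_ge0 ?sqr_ge0// invr_ge0 mulr_ge0// ltW.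
    have -> : (2 * q)^-1 * (y - q) ^+ 2 = (2 * q)^-1 * y ^+ 2 + q / 2 - y by field; lra.
    lra.
rewrite EpowD//; last 3 first.
- by move=> k; apply: measurable_funeM; exact: mlsq.
- by move=> t; rewrite mule_ge0// lee_fin invr_ge0 mulr_ge0// ltW.
- by move=> t; rewrite lee_fin divr_ge0// ltW.
rewrite Epow_cst EpowZl//; last by rewrite lee_fin invr_ge0 mulr_ge0// ltW.
apply: (@le_trans _ _ (((2 * q)^-1)%:E * (0 ^+ 2 + n%:R * s2)%:E + (q / 2)%:E)%E).
  apply: leeD2r; apply: lee_wpmul2l; last exact: Epow_lindley_sq.
  by rewrite lee_fin invr_ge0 mulr_ge0// ltW.
rewrite -EFinM -EFinD lee_fin -q2.
by rewrite le_eqVlt; apply/orP; left; apply/eqP; field; lra.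
Qed.

Let mhub b r : seq_measurable (fun t => (huber b (lindley e r t))%:E : \bar R).
Proof.
move=> n; apply/measurable_EFinP; apply: measurableT_comp; first exact: measurable_huber.
exact: seq_measurable_lindley.
Qed.

Let mlle r x0 : seq_measurable (fun t => lindley e r t <= x0).
Proof. by move=> n; apply: measurable_fun_ler => //; exact: seq_measurable_lindley. Qed.

(** The gain is made at the last step; the induction removes the first step instead, which only
    moves the start, hence the statement for every [r >= 0]. *)
Lemma Epow_huber_step n (b x0 r : R) : 0 <= r -> 0 <= x0 -> x0 + K <= b ->
  (Epow mu n (fun t => (huber b (lindley e r t))%:E) +
   c%:E * Ppow mu n (fun t => lindley e r t <= x0)%R <=
   Epow mu n.+1 (fun t => (huber b (lindley e r t))%:E))%E.
Proof.
move=> r0 x00 x0K; have b0 : 0 <= b by have := K_ge0; lra.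
have hge0 (t : seq R) s : (0 <= (huber b (lindley e s t))%:E)%E by rewrite lee_fin huber_ge0.
elim: n r r0 => [|n ih] r r0.
  rewrite EpowS// /Ppow !Epow0 /=.
  under eq_integral do rewrite Epow0/=.
  exact: (lindley_huber_step e2 int_pos int_neg K_ge0 int_trunc r0 x00 x0K).
rewrite [X in (_ <= X)%E]EpowS// [X in (X + _)%E]EpowS// /Ppow [X in (_ * X)%E]EpowS//; last first.
  exact: (seq_measurable_natr (mlle r x0)).
have mP : measurable_fun [set: R]
    (fun x => Epow mu n (fun t => ((lindley e r (x :: t) <= x0)%R%:R)%:E)).
  apply: (@measurable_Epow_cons _ _ _ mu n (fun t => ((lindley e r t <= x0)%R%:R)%:E)).
    exact: (seq_measurable_natr (mlle r x0)).
  by move=> t; rewrite lee_fin ler0n.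
have mH k : measurable_fun [set: R]
    (fun x => Epow mu k (fun t => (huber b (lindley e r (x :: t)))%:E)).
  exact: (@measurable_Epow_cons _ _ _ mu k (fun t => (huber b (lindley e r t))%:E)).
rewrite -ge0_integralZl//; last 2 first.
- by move=> x _; apply: Epow_ge0 => t; rewrite lee_fin ler0n.
- by rewrite lee_fin ltW.
rewrite -ge0_integralD//; last 3 first.
- by move=> x _; exact: Epow_ge0.
- move=> x _; apply: mule_ge0; first by rewrite lee_fin ltW.
  by apply: Epow_ge0 => t; rewrite lee_fin ler0n.
- exact: measurable_funeM.
apply: ge0_le_integral => //.
- move=> x _; apply: adde_ge0; first exact: Epow_ge0.
  apply: mule_ge0; first by rewrite lee_fin ltW.
  by apply: Epow_ge0 => t; rewrite lee_fin ler0n.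
- by apply: emeasurable_funD => //; exact: measurable_funeM.
- by move=> x _; apply: ih; rewrite le_max lexx orbT.
Qed.

(** Telescoping of the gains at the smallest cut [b = x0 + K] that [huber_step] admits; since
    [huber b] has slope at most [2 b], the bound is linear in [x0]. *)
Lemma lindley_occupation n (x0 : R) : 0 <= x0 -> (0 < n)%N ->
  (\sum_(0 <= k < n) c%:E * Ppow mu k (fun t => lindley e 0 t <= x0)%R <=
   ((x0 + K) * (s2 + 1) * Num.sqrt n%:R)%:E)%E.
Proof.
move=> x00 n0; set b := x0 + K; have b0 : 0 <= b by rewrite addr_ge0.
have hge0 (t : seq R) s : (0 <= (huber b (lindley e s t))%:E)%E by rewrite lee_fin huber_ge0.
apply: (@le_trans _ _ (Epow mu n (fun t => (huber b (lindley e 0 t))%:E))).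
  elim: n {n0} => [|n ih]; first by rewrite big_geq// Epow_ge0.
  rewrite big_nat_recr//=.
  by apply: le_trans (Epow_huber_step n (lexx 0) x00 (lexx b)); exact: leeD2r.
apply: (@le_trans _ _ (Epow mu n (fun t => (2 * b)%:E * (lindley e 0 t)%:E)%E)).
  apply: le_Epow => //.
    by move=> k; apply: measurable_funeM; exact: mlin.
  by move=> t _; rewrite -EFinM lee_fin huber_le// lindley_ge0.
rewrite EpowZl//; last 2 first.
- by move=> t; rewrite lee_fin lindley_ge0.
- by rewrite lee_fin mulr_ge0.
apply: (@le_trans _ _ ((2 * b)%:E * ((s2 + 1) / 2 * Num.sqrt n%:R)%:E)%E).
  by apply: lee_wpmul2l; [rewrite lee_fin mulr_ge0|exact: Epow_lindley].
by rewrite -EFinM lee_fin le_eqVlt; apply/orP; left; apply/eqP; field.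
Qed.

(* Reversing the walk turns the probability, nonincreasing in k, into that of
   the reflected walk being in [0, x0] at time k, so n times it is at most the
   expected number of visits. *)
Lemma prefix_le_bound n (x0 : R) : 0 <= x0 -> (0 < n)%N ->
  (Ppow mu n (prefix_le e x0) <= ((s2 + 1) / c * (x0 + K) / Num.sqrt n%:R)%:E)%E.
Proof.
move=> x00 n0; set q := Num.sqrt n%:R.
have q0 : 0 < q by rewrite sqrtr_gt0 ltr0n.
have q2 : q ^+ 2 = n%:R by rewrite sqr_sqrtr.
have := lindley_occupation x00 n0.
have pfin := Ppow_fin mu n (@seq_measurable_prefix_le R e x0).
have : ((n%:R * c)%:E * Ppow mu n (prefix_le e x0) <=
    \sum_(0 <= k < n) c%:E * Ppow mu k (fun t => lindley e 0 t <= x0)%R)%E.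
  have -> : ((n%:R * c)%:E * Ppow mu n (prefix_le e x0) =
     \sum_(0 <= k < n) c%:E * Ppow mu n (prefix_le e x0))%E.
    rewrite -(fineK pfin); under eq_bigr do rewrite -EFinM.
    rewrite sumEFin sumr_const_nat subn0 -EFinM; congr EFin.
    by rewrite -[RHS]mulr_natl mulrA.
  rewrite big_nat [leRHS]big_nat; apply: lee_sum => k /andP[_ kn]; apply: lee_wpmul2l; first by rewrite lee_fin ltW.
  rewrite -(subnKC (ltnW kn)); apply: (le_trans (Ppow_catl_le _ _ _ (@seq_measurable_prefix_le R e x0) (@prefix_le_catl R e x0))).
  rewrite Ppow_prefix_suffix le_eqVlt; apply/orP; left; apply/eqP.
  by apply: eq_Ppow => t _; rewrite lindley0_le.
move=> /le_trans h /h {h}; rewrite -(fineK pfin) -!EFinM !lee_fin -/q -q2 => h.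
have -> : (s2 + 1) / c * (x0 + K) = (x0 + K) * (s2 + 1) / c by ring.
rewrite ler_pdivlMr// ler_pdivlMr// -(ler_pM2r q0).
by apply: le_trans h; rewrite le_eqVlt; apply/orP; left; apply/eqP; ring.
Qed.

End occupation_bound.

(** * Concentration of the endpoint *)

Section concentration.
Context (R : realType) (mu : probability R R).
Variables (delta rho : R).
Hypothesis delta_gt0 : 0 < delta.
Hypothesis rho_gt0 : 0 < rho.
Hypothesis int_sep :
  (\int[mu]_x \int[mu]_y ((delta <= `|x - y|)%R%:R)%:E = rho%:E)%E.

Definition total (t : seq R) : R := psum t (size t).

Lemma total_cons y t : total (y :: t) = y + total t.
Proof. by rewrite /total psum_cons. Qed.

Lemma total_cat s t : total (s ++ t) = total s + total t.
Proof. by rewrite /total size_cat psum_catr. Qed.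

Lemma seq_measurable_total : seq_measurable total.
Proof.
move=> n; rewrite (_ : (fun _ => _) = (fun t : n.-tuple R => psum t n)).
  exact: seq_measurable_psum.
by apply/funext => t; rewrite /total size_tuple.
Qed.

Definition in_cell v : seq R -> bool := fun t => (v <= total t) && (total t < v + delta).

Lemma seq_measurable_in_cell v : seq_measurable (in_cell v).
Proof.
move=> n; apply: measurable_and.
  by apply: measurable_fun_ler => //; exact: seq_measurable_total.
by apply: measurable_fun_ltr => //; exact: seq_measurable_total.
Qed.

Definition shift x (u : seq R) : seq R := [seq v - x | v <- u].

Lemma size_shift x u : size (shift x u) = size u.
Proof. exact: size_map. Qed.

(* The total mass of the cells [v, v + delta[, v in u.  Conditioning on the first
   step shifts the cells; two shifts at distance at least delta can exchange a
   cell, so a bound V r on the mass of r cells after n steps improves after n + 1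
   steps by rho / 2 times the concavity defect 2 V (r + 1) - V (r + 2) - V r. *)
Definition cells n (u : seq R) : \bar R := (\sum_(v <- u) Ppow mu n (in_cell v))%E.

(** Cells are listed from the top down, with gaps allowed, so the head of the list is the cell that
    can be moved. *)
Definition separated (u : seq R) := pairwise (fun a b => b + delta <= a) u.

Lemma cells_ge0 n u : (0 <= cells n u)%E.
Proof. by apply: sume_ge0 => v _; exact: Ppow_ge0. Qed.

Lemma cells_cons n v u : cells n (v :: u) = (Ppow mu n (in_cell v) + cells n u)%E.
Proof. by rewrite /cells big_cons. Qed.

Lemma cells_le_size n u : (cells n u <= (size u)%:R%:E)%E.
Proof.
elim: u => [|v u ih]; first by rewrite /cells big_nil.
rewrite cells_cons /= -add1n natrD EFinD; apply: leeD => //.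
exact: (Ppow_le1 mu n (seq_measurable_in_cell v)).
Qed.

Let measurable_shift n v : measurable_fun [set: R] (fun x => Ppow mu n (in_cell (v - x))).
Proof.
rewrite (_ : (fun _ => _) = (fun x => Epow mu n (fun t => ((in_cell v (x :: t))%:R)%:E))).
  apply: (@measurable_Epow_cons _ _ _ mu n (fun t => ((in_cell v t)%:R)%:E)) => //.
  exact: (seq_measurable_natr (seq_measurable_in_cell v)).
apply/funext => x; apply: (@eq_Ppow _ mu n _ (fun t => in_cell v (x :: t))) => t _.
by rewrite /in_cell total_cons; congr andb; apply/idP/idP; lra.
Qed.

Let measurable_cells n u : measurable_fun [set: R] (fun x => cells n (shift x u)).
Proof.
by under eq_fun do rewrite /cells /shift big_map; apply: emeasurable_sum => v.
Qed.

Lemma cellsS n u : cells n.+1 u = (\int[mu]_x cells n (shift x u))%E.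
Proof.
elim: u => [|v u ih].
  by rewrite /cells big_nil; under eq_integral do rewrite big_nil; rewrite integral0.
rewrite cells_cons ih; under [in RHS]eq_integral do rewrite /= cells_cons.
rewrite ge0_integralD//; last 2 first.
- by move=> x _; exact: Ppow_ge0.
- by move=> x _; exact: cells_ge0.
congr (_ + _)%E; rewrite {1}/Ppow EpowS//; last first.
  exact: (seq_measurable_natr (seq_measurable_in_cell v)).
apply: eq_integral => x _.
apply: (@eq_Ppow _ mu n (fun t => in_cell v (x :: t))) => t _.
by rewrite /in_cell total_cons; congr andb; apply/idP/idP; lra.
Qed.

Lemma separated_shift x u : separated u -> separated (shift x u).
Proof.
rewrite /separated /shift pairwise_map; apply: sub_pairwise => a b /= h; lra.
Qed.

Lemma cells0_le1 u : separated u -> (cells 0 u <= 1)%E.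
Proof.
elim: u => [|v u ih]; first by rewrite /cells big_nil lee01.
rewrite /separated /= => /andP[/allP h su]; rewrite cells_cons /Ppow Epow0.
have [c0|nc0] := boolP (in_cell v [::]); last by rewrite add0e ih.
suff -> : cells 0 u = 0%E by rewrite adde0.
rewrite /cells big_seq big1// => w /h; rewrite /Ppow Epow0.
case/andP : c0; rewrite /in_cell /total /= psum0 => c1 c2 c3.
rewrite [X in _ && X](_ : _ = false) ?andbF//; apply/negP => c4.
suff : 0 < 0 :> R by rewrite ltxx.
lra.
Qed.

(* Moving the top cell of one shifted family to the other family. *)
Lemma separated_move x y v u : x + delta <= y -> separated (v :: u) ->
  separated (v - x :: (shift y (v :: u))) /\ separated (shift x u).
Proof.
move=> xy su; split; last first.
  by apply: separated_shift; move: su; rewrite /separated /= => /andP[].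
have := separated_shift y su; rewrite /separated => su'.
suff hall : all (fun b => b + delta <= v - x) (shift y (v :: u)).
  exact: (introT andP (conj hall su')).
apply/allP => _ /mapP[w + ->]; rewrite inE => /orP[/eqP ->|wu]; first lra.
by move: su; rewrite /separated /= => /andP[/allP /(_ _ wu)]; have := delta_gt0; lra.
Qed.

Lemma cells_pair_le n (V : nat -> R) x y v u :
  (forall w, separated w -> (cells n w <= (V (size w))%:E)%E) ->
  separated (v :: u) -> delta <= `|x - y| ->
  (cells n (shift x (v :: u)) + cells n (shift y (v :: u)) <=
   (V (size u).+2 + V (size u))%:E)%E.
Proof.
move=> hV su; wlog xy : x y / x <= y.
  move=> H h; have [/H/(_ h)//|/ltW yx] := leP x y.
  by rewrite addeC; apply: H => //; rewrite distrC.
rewrite distrC ger0_norm ?subr_ge0// => h.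
have [s1 s2] := @separated_move x y v u ltac:(lra) su.
rewrite [X in (X + _)%E](_ : _ = (Ppow mu n (in_cell (v - x)%R) + cells n (shift x u))%E); last first.
  by rewrite /= cells_cons.
rewrite -addeA [X in (_ + X)%E]addeC addeA -cells_cons EFinD; apply: leeD.
  by apply: (le_trans (hV _ s1)); rewrite /= size_shift.
by apply: (le_trans (hV _ s2)); rewrite /= size_shift.
Qed.

(** Let [r = size u]. For two independent first steps the masses of the two shifted families add up
    to at most [2 V (r + 1)], and to at most this value minus [k] when the steps are at least
    [delta] apart, which has probability [rho]. Integrating over both steps counts the mass sought
    twice, whence [rho * k / 2]. *)
Lemma cells_step n (V : nat -> R) (k : R) v u :
  (forall w, separated w -> (cells n w <= (V (size w))%:E)%E) ->
  0 <= k -> V (size u).+2 + V (size u) + k <= 2 * V (size u).+1 ->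
  separated (v :: u) ->
  (cells n.+1 (v :: u) <= (V (size u).+1 - rho * k / 2)%:E)%E.
Proof.
move=> hV k0 hk su; rewrite cellsS.
set g := fun x => cells n (shift x (v :: u)).
have g0 x : (0 <= g x)%E by exact: cells_ge0.
have mg : measurable_fun [set: R] g by exact: measurable_cells.
have ms : measurable_fun [set: R * R] (fun p : R * R => ((delta <= `|p.1 - p.2|)%R%:R)%:E : \bar R).
  apply: measurable_natr_bool; apply: measurable_fun_ler => //.
  by apply: measurableT_comp => //; exact: measurable_funB.
have ms1 x : measurable_fun [set: R] (fun y : R => ((delta <= `|x - y|)%R%:R)%:E : \bar R).
  apply: (@measurable_natr_bool _ _ _ (fun y : R => delta <= `|x - y|)).
  apply: measurable_fun_ler => //.
  by apply: measurableT_comp => //; exact: measurable_funB.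
set h := fun x => (\int[mu]_y ((delta <= `|x - y|)%R%:R)%:E)%E.
have mh : measurable_fun [set: R] h.
  exact: (measurable_fun_fubini_tonelli_F (fun p : R * R => ((delta <= `|p.1 - p.2|)%R%:R)%:E)).
have h0 x : (0 <= h x)%E by apply: integral_ge0.
set I := (\int[mu]_x g x)%E.
have I0 : (0 <= I)%E by exact: integral_ge0.
have fI : I \is a fin_num.
  rewrite ge0_fin_numE//; apply: (@le_lt_trans _ _ (\int[mu]_x (size (v :: u))%:R%:E)%E).
    apply: ge0_le_integral => // x _; apply: (le_trans (cells_le_size _ _)).
    by rewrite size_shift.
  by rewrite integral_prob_cst ltry.
have key : (I + I + k%:E * rho%:E <= (2 * V (size u).+1)%:E)%E.
  have pt x : (g x + I + k%:E * h x <= (2 * V (size u).+1)%:E)%E.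
    have -> : (g x + I + k%:E * h x = \int[mu]_y (g x + g y + k%:E * ((delta <= `|x - y|)%R%:R)%:E))%E.
      rewrite ge0_integralD//; last 4 first.
      - by move=> y _; exact: adde_ge0.
      - exact: emeasurable_funD.
      - by move=> y _; rewrite mule_ge0.
      - exact: measurable_funeM.
      by rewrite ge0_integralD// integral_prob_cst ge0_integralZl.
    rewrite -[leRHS](integral_prob_cst mu); apply: ge0_le_integral => //.
    - by move=> y _; rewrite !adde_ge0// mule_ge0.
    - by apply: emeasurable_funD; [exact: emeasurable_funD|exact: measurable_funeM].
    - move=> y _; have [xy|xy] := leP delta `|x - y|.
        rewrite mule1; apply: (@le_trans _ _ ((V (size u).+2 + V (size u))%:E + k%:E)%E).
          by apply: leeD => //; exact: cells_pair_le.
        by rewrite -EFinD lee_fin.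
      rewrite mule0 adde0 mulrDl !mul1r EFinD.
      by apply: leeD; apply: (le_trans (hV _ (separated_shift _ su))); rewrite size_shift.
  have -> : (I + I + k%:E * rho%:E = \int[mu]_x (g x + I + k%:E * h x))%E.
    rewrite ge0_integralD//; last 4 first.
    - by move=> y _; exact: adde_ge0.
    - exact: emeasurable_funD.
    - by move=> y _; rewrite mule_ge0.
    - exact: measurable_funeM.
    rewrite ge0_integralD// integral_prob_cst ge0_integralZl// -/I.
    by rewrite /h int_sep.
  rewrite -[leRHS](integral_prob_cst mu); apply: ge0_le_integral => //.
  - by move=> y _; apply: adde_ge0; [exact: adde_ge0|apply: mule_ge0; rewrite ?lee_fin].
  - by apply: emeasurable_funD; [exact: emeasurable_funD|exact: measurable_funeM].
move: key; rewrite -(fineK fI) -EFinM -!EFinD !lee_fin; lra.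
Qed.

(** The bound [V n r = A (1 - c n * q^r)] has concavity defect [A * c n * q^r * (1 - q)^2],
    proportional to its distance from [A]; so one use of [cells_step] lets [c] grow by the factor
    [1 + eta]. With [c N = 1] the final bound is [A (1 - q^r) <= A * r * l]. *)
Lemma cells_bound N u : (0 < N)%N -> separated u ->
  (cells N u <= ((1 + 8 / rho) * (size u)%:R / Num.sqrt N%:R)%:E)%E.
Proof.
move=> N0 su; set sN := Num.sqrt N%:R : R.
have sN0 : 1 <= sN by rewrite -sqrtr1 ler_wsqrtr// ler1n.
have sN2 : sN ^+ 2 = N%:R by rewrite sqr_sqrtr.
(* [l] is of order [N^(-1/2)]: this keeps [N * eta] above [rho / 8], while [1 - q^r <= r * l] gives
   the rate. *)
pose l := (1 + sN)^-1; pose q := 1 - l; pose eta := rho * l ^+ 2 / 2.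
have l0 : 0 < l by rewrite invr_gt0; lra.
have l1 : l < 1 by rewrite invf_lt1; lra.
have q0 : 0 < q by rewrite /q; lra.
have q1 : q < 1 by rewrite /q; lra.
have eta0 : 0 < eta by rewrite /eta divr_gt0// mulr_gt0// exprn_gt0.
pose c n := (1 + eta) ^+ n / (1 + eta) ^+ N.
have c0 n : 0 < c n by rewrite divr_gt0// exprn_gt0// addr_gt0.
have c1 n : (n <= N)%N -> c n <= 1.
  move=> nN; rewrite ler_pdivrMr ?exprn_gt0// ?addr_gt0// mul1r.
  by rewrite ler_weXn2l// lerDl ltW.
(* The value with [A (1 - 1 / (1 + rho / 8)) = 1], so that [V 0] is at least 1, the bound of
   [cells0_le1]. *)
pose A := 1 + 8 / rho.
have A0 : 0 < A by rewrite addr_gt0// divr_gt0.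
pose V n r := A * (1 - c n * q ^+ r).
have qr1 r : q ^+ r <= 1 by rewrite exprn_ile1// ltW.
have qr0 r : 0 < q ^+ r by rewrite exprn_gt0.
have Neta : rho / 8 <= N%:R * eta.
  rewrite /eta -sN2; have -> : sN ^+ 2 * (rho * l ^+ 2 / 2) = rho / 2 * (sN * l) ^+ 2 by ring.
  have : 2^-1 <= sN * l by rewrite ler_pdivlMr; lra.
  move=> h; have : 4^-1 <= (sN * l) ^+ 2 by nra.
  by have := rho_gt0; nra.
have V0 : 1 <= A * (1 - c 0%N).
  have bern : 1 + rho / 8 <= (1 + eta) ^+ N.
    apply: (@le_trans _ _ (1 + N%:R * eta)); first lra.
    elim: (N) => [|m ih]; first by rewrite mul0r addr0 expr0.
    rewrite exprS -natr1; have : 0 <= m%:R :> R by []. nra.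
  have : c 0%N <= (1 + rho / 8)^-1.
    by rewrite /c expr0 div1r lef_pV2// posrE ?exprn_gt0// addr_gt0// divr_gt0.
  have -> : A * (1 - c 0%N) = A - A * c 0%N by ring.
  move=> h; have : A * c 0%N <= A * (1 + rho / 8)^-1 by rewrite ler_pM2l.
  have -> : A * (1 + rho / 8)^-1 = 8 / rho.
    by rewrite /A; field; have := rho_gt0; lra.
  by rewrite /A; lra.
have claim n : (n <= N)%N -> forall w, separated w -> (cells n w <= (V n (size w))%:E)%E.
  elim: n => [|n ih] nN w sw.
    case: w sw => [|v w] sw.
      rewrite /cells big_nil lee_fin /V expr0 mulr1; lra.
    apply: (le_trans (cells0_le1 sw)); rewrite lee_fin; apply: (le_trans V0).
    by rewrite ler_pM2l// lerB// ger_pMr.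
  case: w sw => [|v w] sw.
    rewrite /cells big_nil lee_fin /V expr0 mulr1.
    by apply: mulr_ge0; [exact: ltW|rewrite subr_ge0 c1].
  have k0 : 0 <= A * c n * q ^+ size w * l ^+ 2 by rewrite mulr_ge0 ?sqr_ge0// mulr_ge0 ?(ltW (qr0 _))// mulr_ge0 ?(ltW A0) ?(ltW (c0 _)).
  have hk : V n (size w).+2 + V n (size w) + A * c n * q ^+ size w * l ^+ 2 <= 2 * V n (size w).+1.
    rewrite /V !exprS; have := qr0 (size w); set z := q ^+ size w => z0.
    by rewrite le_eqVlt; apply/orP; left; apply/eqP; rewrite /q; ring.
  apply: (le_trans (cells_step (ih (ltnW nN)) k0 hk sw)).
  rewrite lee_fin /V /= /c [(1 + eta) ^+ n.+1]exprS -/(c n).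
  have -> : (1 + eta) * (1 + eta) ^+ n / (1 + eta) ^+ N = (1 + eta) * c n by rewrite /c mulrA.
  have : q * q ^+ size w <= q ^+ size w by rewrite ger_pMl ?qr0// ltW.
  rewrite exprS /eta; have := qr0 (size w); set z := q ^+ size w => z0 hz.
  suff : 0 <= A * c n * (rho * l ^+ 2 / 2) * (z - q * z) by lra.
  by rewrite mulr_ge0 ?subr_ge0// mulr_ge0 ?(ltW eta0)// mulr_ge0 ?(ltW A0) ?(ltW (c0 _)).
apply: (le_trans (claim N (leqnn N) u su)); rewrite lee_fin /V -/A -/sN.
have -> : c N = 1 by rewrite /c divff// gt_eqF// exprn_gt0// addr_gt0.
rewrite mul1r -mulrA ler_pM2l//.
have bern r : 1 - q ^+ r <= r%:R * l.
  elim: r => [|r ih]; first by rewrite expr0 mul0r subrr.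
  rewrite exprS -natr1; move: ih (qr1 r); set z := q ^+ r => ih z1.
  have : l * z <= l by rewrite ger_pMr.
  rewrite /q; lra.
apply: (le_trans (bern _)); rewrite ler_wpM2l// lef_pV2 ?posrE; lra.
Qed.

Lemma Ppow_interval_le N (y x : R) : (0 < N)%N -> 0 <= x ->
  (Ppow mu N (fun t => (y <= total t) && (total t <= y + x))%R <=
   ((1 + 8 / rho) * (x / delta + 1) / Num.sqrt N%:R)%:E)%E.
Proof.
move=> N0 x0; pose r := Num.truncn (x / delta).
(* [r + 1] adjacent cells, from the top down, that cover the interval. *)
pose u := [seq y + (r - i)%:R * delta | i <- iota 0 r.+1].
have xd0 : 0 <= x / delta by rewrite divr_ge0// ltW.
have su : separated u.
  rewrite /separated pairwise_map.
  have : pairwise ltn (iota 0 r.+1) by rewrite -sorted_pairwise ?iota_ltn_sorted//; exact: ltn_trans.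
  apply: (sub_in_pairwise (P := fun i => i <= r)%N); last first.
    by apply/allP => i; rewrite mem_iota.
  move=> i j ir jr /= ij.
  have : (r - j)%:R + 1 <= (r - i)%:R :> R.
    by rewrite natr1 ler_nat ltn_sub2l// (leq_trans ij).
  have := delta_gt0; nra.
apply: (@le_trans _ _ (cells N u)).
  rewrite /cells /Ppow /Epow -ge0_integral_sum//; last first.
    move=> v; exact: (seq_measurable_natr (seq_measurable_in_cell v)).
  apply: ge0_le_integral => //.
  - apply: measurable_natr_bool; apply: measurable_and; apply: measurable_fun_ler => //;
      exact: seq_measurable_total.
  - apply: emeasurable_sum => v; exact: (seq_measurable_natr (seq_measurable_in_cell v)).
  - move=> t _; have [/andP[h1 h2]|_] := boolP (_ && _); last by apply: sume_ge0.
    pose j := Num.truncn ((total t - y) / delta).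
    have d0 : 0 <= (total t - y) / delta by rewrite divr_ge0 ?subr_ge0// ltW.
    have /andP[j1 j2] := truncn_itv d0; rewrite -/j in j1 j2.
    have jr : (j <= r)%N.
      apply: le_truncn; rewrite ler_pM2r ?invr_gt0//; lra.
    have vu : y + j%:R * delta \in u.
      apply/mapP; exists (r - j)%N; first by rewrite mem_iota/= add0n ltnS leq_subr.
      by rewrite subKn.
    rewrite (big_rem _ vu)/= -[leLHS]adde0; apply: leeD; last by apply: sume_ge0.
    rewrite lee_fin; rewrite ler_pdivlMr// in j1; rewrite ltr_pdivrMr// -natr1 in j2.
    by rewrite (_ : in_cell _ _ = true)//; apply/andP; split; lra.
apply: (le_trans (cells_bound N0 su)); rewrite lee_fin ler_pM2r ?invr_gt0 ?sqrtr_gt0 ?ltr0n//.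
rewrite ler_pM2l ?addr_gt0 ?divr_gt0// size_map size_iota -natr1 lerD2r.
by rewrite truncn_le.
Qed.

End concentration.

(** * Constants for a centred step law *)

Section constants.
Context (R : realType) (mu : probability R R).
Variables (a s2 : R).
Hypothesis a_gt0 : 0 < a.
Hypothesis int_pos : (\int[mu]_x (Num.max x 0)%:E = a%:E)%E.
Hypothesis int_neg : (\int[mu]_x (Num.max (- x) 0)%:E = a%:E)%E.
Hypothesis int_sq : (\int[mu]_x (x ^+ 2)%:E = s2%:E)%E.

Let s2_ge0 : 0 <= s2.
Proof.
by rewrite -lee_fin -int_sq integral_ge0// => x _; rewrite lee_fin sqr_ge0.
Qed.

Let int_sign (e : R) : e = 1 \/ e = -1 ->
  (\int[mu]_x (Num.max (e * x) 0)%:E = a%:E)%E.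
Proof.
case=> ->; first by under eq_integral do rewrite mul1r.
by under eq_integral do rewrite mulN1r.
Qed.

Let eta := a / 4.
Let K := 4 * s2 / a + 1.

Let eta_gt0 : 0 < eta. Proof. by rewrite divr_gt0. Qed.
Let K_gt0 : 0 < K. Proof. by rewrite ltr_wpDl// divr_ge0 ?mulr_ge0// ltW. Qed.
Let s2K : s2 / K <= a / 4.
Proof.
rewrite ler_pdivrMr// /K mulrDr mulr1.
have -> : a / 4 * (4 * s2 / a) = s2 by field; rewrite gt_eqF.
by rewrite lerDl divr_ge0// ltW.
Qed.

Let int_finite (f : R -> R) (M : R) : measurable_fun [set: R] f ->
  (forall x, 0 <= f x) -> (forall x, f x <= M) ->
  (\int[mu]_x (f x)%:E)%E \is a fin_num.
Proof.
move=> mf f0 fM; rewrite ge0_fin_numE; last first.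
  by apply: integral_ge0 => x _; rewrite lee_fin.
apply: (@le_lt_trans _ _ (\int[mu]_x M%:E)%E); last by rewrite integral_prob_cst ltry.
apply: ge0_le_integral => //.
- by move=> x _; rewrite lee_fin.
- exact/measurable_EFinP.
- by move=> x _; rewrite lee_fin.
Qed.

(* With eta = a/4 and K >= 4 s2/a, a third of the mass of x^+ comes from the
   window between eta and K. *)
Let window_gt0 (e : R) (f : R -> R) (k : R) : e = 1 \/ e = -1 ->
  measurable_fun [set: R] f -> (forall x, 0 <= f x) -> 0 < k ->
  (forall x, eta < e * x <= K -> e * x <= k * f x) ->
  (0 < \int[mu]_x (f x)%:E)%E.
Proof.
move=> he mf f0 k0 hf; rewrite lt0e integral_ge0 ?andbT; last first.
  by move=> x _; rewrite lee_fin.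
apply/eqP => If0.
have e2 x : (e * x) ^+ 2 = x ^+ 2.
  by case: he => ->; rewrite ?mul1r ?mulN1r ?sqrrN.
have : (a%:E <= \int[mu]_x (eta%:E + (k%:E * (f x)%:E + K^-1%:E * (x ^+ 2)%:E)))%E.
  rewrite -(int_sign he); apply: ge0_le_integral => //.
  - by move=> x _; rewrite lee_fin le_max lexx orbT.
  - by apply/measurable_EFinP; apply: measurable_maxr => //; exact: measurable_funM.
  - apply: emeasurable_funD => //; apply: emeasurable_funD.
      by apply: measurable_funeM; exact/measurable_EFinP.
    by apply: measurable_funeM; exact/measurable_EFinP.
  - move=> x _; rewrite -!EFinM -!EFinD lee_fin.
    have kf : 0 <= k * f x by rewrite mulr_ge0// ltW.
    have xK : 0 <= K^-1 * x ^+ 2 by rewrite mulr_ge0 ?sqr_ge0// invr_ge0 ltW.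
    have [ex|ex] := leP (e * x) 0; first by rewrite addr_ge0 ?addr_ge0// ltW.
    have [h1|h1] := leP (e * x) eta; first by rewrite -[leLHS]addr0 lerD// addr_ge0.
    have [h2|h2] := leP (e * x) K.
      have := hf x; rewrite h1 h2 => /(_ isT); have := eta_gt0; lra.
    suff : e * x <= K^-1 * x ^+ 2 by have := eta_gt0; lra.
    by rewrite -e2 [leRHS]mulrC ler_pdivlMr// expr2 ler_pM2l// ltW.
rewrite ge0_integralD//; last 3 first.
- by move=> x _; rewrite lee_fin ltW.
- move=> x _; rewrite -!EFinM -!EFinD lee_fin; apply: addr_ge0; apply: mulr_ge0;
    by rewrite ?sqr_ge0 ?invr_ge0 ?(ltW k0) ?(ltW K_gt0).
- apply: emeasurable_funD; apply: measurable_funeM; exact/measurable_EFinP.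
rewrite ge0_integralD//; last 4 first.
- by move=> x _; rewrite -EFinM lee_fin mulr_ge0// ltW.
- by apply: measurable_funeM; exact/measurable_EFinP.
- by move=> x _; rewrite -EFinM lee_fin mulr_ge0 ?sqr_ge0// invr_ge0 ltW.
- by apply: measurable_funeM; exact/measurable_EFinP.
rewrite ge0_integralZl//; last 3 first.
- exact/measurable_EFinP.
- by move=> x _; rewrite lee_fin.
- by rewrite lee_fin ltW.
rewrite ge0_integralZl//; last 3 first.
- exact/measurable_EFinP.
- by move=> x _; rewrite lee_fin sqr_ge0.
- by rewrite lee_fin invr_ge0 ltW.
rewrite If0 int_sq mule0 add0e integral_prob_cst -EFinM -EFinD lee_fin.
have := s2K; rewrite /eta mulrC; have := a_gt0; lra.
Qed.

Lemma prefix_le_const : exists2 C : R, 0 < C & forall e, e = 1 \/ e = -1 ->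
  forall n (x : R), 0 <= x -> (0 < n)%N ->
  (Ppow mu n (prefix_le e x) <= (C * (1 + x) / Num.sqrt n%:R)%:E)%E.
Proof.
pose f (e x : R) := (0 <= e * x <= K)%R%:R * x ^+ 2 : R.
have mf e : measurable_fun [set: R] (f e).
  have mb : measurable_fun [set: R] (fun x : R => (0 <= e * x) && (e * x <= K)).
    by apply: measurable_and; apply: measurable_fun_ler => //; exact: measurable_funM.
  by apply: measurable_funM => //; apply/measurable_EFinP; exact: (measurable_natr_bool mb).
have f0 e x : 0 <= f e x by rewrite mulr_ge0// sqr_ge0.
have sq (e x : R) : e = 1 \/ e = -1 -> (e * x) ^+ 2 = x ^+ 2.
  by case => ->; rewrite ?mul1r ?mulN1r ?sqrrN.
have fin e : e = 1 \/ e = -1 -> (\int[mu]_x (f e x)%:E)%E \is a fin_num.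
  move=> he; apply: (@int_finite _ (K ^+ 2)) => // x; rewrite /f -(sq e x he).
  have [/andP[h1 h2]|_] := boolP (_ && _); rewrite ?mul1r ?mul0r ?sqr_ge0//.
  by rewrite ler_sqr// nnegrE// ltW.
have pos (e : R) : e = 1 \/ e = -1 -> (0 < \int[mu]_x (f e x)%:E)%E.
  (* On the window [e * x > eta], hence [e * x <= eta^-1 * (e * x)^2]. *)
  move=> he; apply: (@window_gt0 e _ eta^-1) => //; first by rewrite invr_gt0.
  move=> x /andP[h1 h2]; rewrite /f -(sq e x he) h2 andbT (ltW (lt_trans eta_gt0 h1)) mul1r.
  by rewrite [leRHS]mulrC ler_pdivlMr// expr2 ler_pM2l ?(ltW h1)// (lt_trans eta_gt0 h1).
pose c e := fine (\int[mu]_x (f e x)%:E)%E.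
have c0 e : e = 1 \/ e = -1 -> 0 < c e.
  by move=> he; rewrite -lte_fin /c fineK ?fin// pos.
pose C e := (s2 + 1) / c e * (1 + K).
have C0 e : e = 1 \/ e = -1 -> 0 < C e.
  move=> he; apply: mulr_gt0; last by rewrite addr_gt0.
  by rewrite divr_gt0 ?c0// ltr_wpDl.
have [h1 hN1] : (1 = 1 :> R \/ 1 = -1 :> R) /\ (-1 = 1 :> R \/ -1 = -1 :> R) by split; [left|right].
exists (C 1 + C (-1)); first by rewrite addr_gt0// C0.
move=> e he n x x0 n0.
have e2 : e ^+ 2 = 1 by case: he => ->; rewrite ?expr1n ?sqrrN ?expr1n.
have ipos := int_sign he.
have ineg : (\int[mu]_x (Num.max (- (e * x)) 0)%:E = a%:E)%E.
  under eq_integral do rewrite -mulNr; apply: int_sign.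
  by case: he => ->; [right|left; rewrite opprK].
have icut : (\int[mu]_x ((0 <= e * x <= K)%R%:R * x ^+ 2)%:E = (c e)%:E)%E.
  by rewrite /c fineK// fin.
apply: (le_trans (prefix_le_bound e2 ipos ineg int_sq (ltW K_gt0) icut (c0 e he) x0 n0)).
rewrite lee_fin ler_pM2r ?invr_gt0 ?sqrtr_gt0 ?ltr0n//.
apply: (@le_trans _ _ (C e * (1 + x))).
  have D0 : 0 < (s2 + 1) / c e by rewrite divr_gt0 ?c0// ltr_wpDl.
  rewrite /C -[leRHS]mulrA ler_pM2l//.
  have := K_gt0; nra.
rewrite ler_pM2r ?ltr_wpDr//.
by case: he => ->; rewrite ?lerDl ?lerDr ltW// C0.
Qed.

(** Two independent steps, one at least [eta] and the other at most [- eta], differ by at least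
    [2 * eta = delta]; both events have positive probability because [window_gt0] applies to either
    sign. *)
Lemma interval_const : exists2 C : R, 0 < C & forall n (y x : R), 0 <= x -> (0 < n)%N ->
  (Ppow mu n (fun t => (y <= total t) && (total t <= y + x))%R <=
   (C * (1 + x) / Num.sqrt n%:R)%:E)%E.
Proof.
pose delta := 2 * eta; have delta0 : 0 < delta by rewrite mulr_gt0.
pose p (e x : R) := ((eta <= e * x)%R%:R : R).
have mp e : measurable_fun [set: R] (p e).
  apply/measurable_EFinP; apply: (@measurable_natr_bool _ _ _ (fun x : R => eta <= e * x)).
  by apply: measurable_fun_ler => //; exact: measurable_funM.
have pos (e : R) : e = 1 \/ e = -1 -> (0 < \int[mu]_x (p e x)%:E)%E.
  move=> he; apply: (@window_gt0 e _ K) => //.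
  by move=> x /andP[h1 h2]; rewrite /p (ltW h1) mulr1.
pose S (x y : R) := ((delta <= `|x - y|)%R%:R : R).
have mS : measurable_fun [set: R * R] (fun z : R * R => (S z.1 z.2)%:E).
  apply: measurable_natr_bool; apply: measurable_fun_ler => //.
  by apply: measurableT_comp => //; exact: measurable_funB.
have mS1 x : measurable_fun [set: R] (fun y : R => (S x y)%:E).
  apply: (@measurable_natr_bool _ _ _ (fun y : R => delta <= `|x - y|)).
  apply: measurable_fun_ler => //.
  by apply: measurableT_comp => //; exact: measurable_funB.
have S0 x y : (0 <= (S x y)%:E)%E by rewrite lee_fin.
have mSS : measurable_fun [set: R] (fun x => \int[mu]_y (S x y)%:E)%E.
  exact: (measurable_fun_fubini_tonelli_F (fun z : R * R => (S z.1 z.2)%:E)).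
have Sfin : (\int[mu]_x \int[mu]_y (S x y)%:E)%E \is a fin_num.
  rewrite ge0_fin_numE; last by apply: integral_ge0 => x _; exact: integral_ge0.
  apply: (@le_lt_trans _ _ (\int[mu]_x 1)%E); last by rewrite integral_prob_cst ltry.
  apply: ge0_le_integral => //; first by move=> x _; exact: integral_ge0.
  move=> x _; rewrite -[leRHS](integral_prob_cst mu); apply: ge0_le_integral => // y _.
  by rewrite /S lee_fin; case: (delta <= _).
have Spos : (0 < \int[mu]_x \int[mu]_y (S x y)%:E)%E.
  apply: (@lt_le_trans _ _ ((\int[mu]_x (p 1%R x)%:E) * (\int[mu]_y (p (-1)%R y)%:E))%E).
    by apply: mule_gt0; apply: pos; [left|right].
  rewrite -ge0_integralZr//; last 3 first.
  - exact/measurable_EFinP.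
  - by move=> x _; rewrite lee_fin.
  - by apply/ltW/pos; right.
  apply: ge0_le_integral => //.
  - by move=> x _; rewrite mule_ge0 ?lee_fin//; apply/ltW/pos; right.
  - under eq_fun do rewrite muleC; apply: measurable_funeM; exact/measurable_EFinP.
  - move=> x _; rewrite -ge0_integralZl//; last 3 first.
    + exact/measurable_EFinP.
    + by move=> y _; rewrite lee_fin.
    + by rewrite lee_fin.
    apply: ge0_le_integral => //.
    + by move=> y _; rewrite mule_ge0 ?lee_fin.
    + by apply: measurable_funeM; exact/measurable_EFinP.
    + move=> y _; rewrite -EFinM lee_fin /p /S /delta -natrM mulnb ler_nat.
      rewrite mul1r mulN1r; have [/andP[h1 h2]|//] := boolP (_ && _).
      by rewrite (le_trans _ (ler_norm _))//; lra.
pose rho := fine (\int[mu]_x \int[mu]_y (S x y)%:E)%E.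
have rho0 : 0 < rho by rewrite -lte_fin fineK.
have hS : (\int[mu]_x \int[mu]_y ((delta <= `|x - y|)%R%:R)%:E = rho%:E)%E by rewrite fineK.
exists ((1 + 8 / rho) * (1 + delta^-1)).
  by rewrite mulr_gt0// addr_gt0// ?divr_gt0// invr_gt0.
move=> n y x x0 n0; apply: (le_trans (Ppow_interval_le delta0 rho0 hS y n0 x0)).
rewrite lee_fin ler_pM2r ?invr_gt0 ?sqrtr_gt0 ?ltr0n// -mulrA ler_pM2l ?addr_gt0 ?divr_gt0//.
have : 0 < delta^-1 by rewrite invr_gt0.
nra.
Qed.

End constants.

(** * Walks staying nonnegative *)

Section sums_of_inverse_roots.
Context (R : realType).

Lemma sum_inv_sqrt n : \sum_(0 <= j < n) (Num.sqrt (j.+1%:R : R))^-1 <= 2 * Num.sqrt n%:R.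
Proof.
elim: n => [|n ih]; first by rewrite big_geq// sqrtr0 mulr0.
rewrite big_nat_recr//=; apply: (le_trans (lerD ih (lexx _))).
set a := Num.sqrt n%:R; set b := Num.sqrt n.+1%:R.
have b0 : 0 < b by rewrite sqrtr_gt0.
have a0 : 0 <= a by exact: sqrtr_ge0.
have a2 : a ^+ 2 = n%:R by rewrite sqr_sqrtr.
have b2 : b ^+ 2 = n%:R + 1 by rewrite sqr_sqrtr// natr1.
rewrite -lerBrDl -mulrBr -[leLHS]mul1r ler_pdivrMr//.
nra.
Qed.

End sums_of_inverse_roots.

Section walk_estimates.
Context (R : realType) (mu : probability R R).
Variable C : R.
Hypothesis C_gt0 : 0 < C.
Hypothesis prefix_bound : forall e, e = 1 \/ e = -1 ->
  forall n (x : R), 0 <= x -> (0 < n)%N ->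
  (Ppow mu n (prefix_le e x) <= (C * (1 + x) / Num.sqrt n%:R)%:E)%E.
Hypothesis interval_bound : forall n (y x : R), 0 <= x -> (0 < n)%N ->
  (Ppow mu n (fun t => (y <= total t) && (total t <= y + x))%R <=
   (C * (1 + x) / Num.sqrt n%:R)%:E)%E.

Lemma Ppow_cat_le k n (p A : seq R -> bool) (Q : \bar R) :
  seq_measurable p -> seq_measurable A -> (0 <= Q)%E ->
  (forall s u, size s = k -> size u = n -> p (s ++ u) -> A s) ->
  (forall s, size s = k -> A s -> Ppow mu n (fun u => p (s ++ u)) <= Q)%E ->
  (Ppow mu (k + n) p <= Q * Ppow mu k A)%E.
Proof.
move=> mp mA Q0 pA hQ; rewrite {1}/Ppow Epow_cat//; last exact: (seq_measurable_natr mp).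
rewrite -EpowZl//; last exact: (seq_measurable_natr mA).
apply: le_Epow.
- apply: (@seq_measurable_Epow_cat _ _ _ mu n (fun t => ((p t)%:R)%:E)) => //.
  exact: (seq_measurable_natr mp).
- by move=> i; apply: measurable_funeM; exact: (seq_measurable_natr mA).
- by move=> t; apply: Epow_ge0 => u; rewrite lee_fin.
- move=> s sk; have [As|nAs] := boolP (A s); first by rewrite mule1 hQ.
  rewrite mule0 (@eq_Epow _ _ _ mu n _ (cst 0%E)) ?Epow_cst// => u un /=.
  by have [/(pA s u sk un)|//] := boolP (p (s ++ u)); rewrite (negbTE nAs).
Qed.

(** A nonnegative path ending below [x], seen from its end: with time reversed, its partial sums are
    at most [x]. Only the first [k] of these constraints are kept; the remaining steps serve to hit
    the window. *)
Definition window_pred k (c x : R) : seq R -> bool := fun t =>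
  all (fun j => psum t j <= x) (iota 0 k.+1) && ((c <= total t) && (total t <= c + x)).

Lemma seq_measurable_window (c x : R) :
  seq_measurable (fun t : seq R => (c <= total t) && (total t <= c + x)).
Proof.
by move=> n; apply: measurable_and; apply: measurable_fun_ler => //; exact: seq_measurable_total.
Qed.

Lemma seq_measurable_window_pred k (c x : R) : seq_measurable (window_pred k c x).
Proof.
move=> n; apply: measurable_and; last exact: (@seq_measurable_window c x n).
apply: (@measurable_fun_all _ _ _ _ (fun j (t : n.-tuple R) => psum t j <= x)) => j.
by apply: measurable_fun_ler => //; exact: seq_measurable_psum.
Qed.

Lemma Ppow_window_pred_le k n (c x : R) : (0 < k)%N -> (0 < n)%N -> 0 <= x ->
  (Ppow mu (k + n) (window_pred k c x) <=
   (C * (1 + x) / Num.sqrt n%:R * (C * (1 + x) / Num.sqrt k%:R))%:E)%E.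
Proof.
move=> k0 n0 x0; have Q0 i : 0 <= C * (1 + x) / Num.sqrt i%:R.
  by rewrite divr_ge0 ?sqrtr_ge0// mulr_ge0 ?addr_ge0// ltW.
have h : forall s u, size s = k -> size u = n -> window_pred k c x (s ++ u) -> prefix_le 1 x s.
  move=> s u sk un /andP[/allP h _]; apply/prefix_leP => j js.
  rewrite mul1r -(psum_catl u js); apply: h; rewrite mem_iota/= add0n ltnS.
  by rewrite -sk.
have /le_trans : (Ppow mu (k + n) (window_pred k c x) <=
    (C * (1 + x) / Num.sqrt n%:R)%:E * Ppow mu k (prefix_le 1 x))%E.
  apply: Ppow_cat_le => //; first exact: seq_measurable_window_pred.
  - exact: seq_measurable_prefix_le.
  - by rewrite lee_fin.
  - move=> s sk _; apply: le_trans (interval_bound (c - total s) x0 n0).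
    apply: le_Ppow.
    + exact: (seq_measurable_catl s (@seq_measurable_window_pred k c x)).
    + exact: (@seq_measurable_window (c - total s) x).
    + move=> u _ /andP[_]; rewrite total_cat => /andP[h1 h2].
      by apply/andP; split; lra.
apply; rewrite [leRHS]EFinM; apply: lee_wpmul2l; first by rewrite lee_fin.
by apply: prefix_bound => //; left.
Qed.

Lemma psum_rev_take t j : (j <= size t)%N ->
  psum (rev t) j = total t - psum t (size t - j) :> R.
Proof. exact: psum_rev. Qed.

Lemma total_rev t : total (rev t) = total t :> R.
Proof. by rewrite /total size_rev psum_rev// subnn psum0 subr0. Qed.

Definition stay_below (x : R) : seq R -> bool := fun t => prefix_le (-1) 0 t && (total t <= x).

Lemma seq_measurable_stay_below x : seq_measurable (stay_below x).
Proof.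
move=> n; apply: measurable_and; first exact: seq_measurable_prefix_le.
by apply: measurable_fun_ler => //; exact: seq_measurable_total.
Qed.

(* The first [k] steps stay nonnegative, the last [k] steps read backwards stay
   below [x], and the [n] steps in between bridge a window of length [x]. *)
Lemma Ppow_stay_below_le k n (x : R) : (0 < k)%N -> (0 < n)%N -> 0 <= x ->
  (Ppow mu (k + (k + n)) (stay_below x) <=
   (C * (1 + x) / Num.sqrt n%:R * (C * (1 + x) / Num.sqrt k%:R) * (C / Num.sqrt k%:R))%:E)%E.
Proof.
move=> k0 n0 x0.
have Q0 i : 0 <= C * (1 + x) / Num.sqrt i%:R.
  by rewrite divr_ge0 ?sqrtr_ge0// mulr_ge0 ?addr_ge0// ltW.
have /le_trans : (Ppow mu (k + (k + n)) (stay_below x) <=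
    (C * (1 + x) / Num.sqrt n%:R * (C * (1 + x) / Num.sqrt k%:R))%:E *
    Ppow mu k (prefix_le (-1)%R 0%R))%E.
  apply: Ppow_cat_le.
  - exact: seq_measurable_stay_below.
  - exact: seq_measurable_prefix_le.
  - by rewrite lee_fin mulr_ge0.
  - by move=> s u _ _ /andP[/prefix_le_catl].
  - move=> s sk _; apply: le_trans (Ppow_window_pred_le (- total s) k0 n0 x0).
    rewrite -[leRHS]Ppow_rev; last exact: seq_measurable_window_pred.
    apply: le_Ppow.
    + exact: (seq_measurable_catl s (@seq_measurable_stay_below x)).
    + exact: (seq_measurable_rev (@seq_measurable_window_pred k (- total s) x)).
    + move=> u un /andP[/prefix_leP hp]; rewrite total_cat => tx.
      have hp' j : (j <= size u)%N -> 0 <= total s + psum u j.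
        move=> ju; have := hp (size s + j)%N; rewrite size_cat leq_add2l => /(_ ju).
        by rewrite psum_catr mulN1r oppr_le0.
      apply/andP; split; last first.
        rewrite total_rev; have := hp' (size u) (leqnn _); rewrite -/(total u) => ?.
        by apply/andP; split; lra.
      apply/allP => j; rewrite mem_iota/= add0n ltnS => jk.
      rewrite psum_rev_take ?un ?(leq_trans jk)// ?leq_addr//.
      by have := hp' (k + n - j)%N; rewrite un leq_subr => /(_ isT); lra.
apply; rewrite [leRHS]EFinM; apply: lee_wpmul2l; first by rewrite lee_fin mulr_ge0.
by have := @prefix_bound (-1) (or_intror erefl) k 0 (lexx _) k0; rewrite addr0 mulr1.
Qed.

(** Each of the three blocks has at least [k = m %/ 3] steps, and [m <= 9 k] costs a factor 3 for
    each inverse root, whence 27. The summand 3 covers [m <= 2], where [sqrt m ^ 3 <= 3]. *)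
Lemma stay_below_bound m (x : R) : (0 < m)%N -> 0 <= x ->
  (Ppow mu m (stay_below x) <=
   ((27 * C ^+ 3 + 3) * (1 + x) ^+ 2 / Num.sqrt m%:R ^+ 3)%:E)%E.
Proof.
move=> m0 x0; set s := Num.sqrt m%:R : R.
have s0 : 0 < s by rewrite sqrtr_gt0 ltr0n.
have s2 : s ^+ 2 = m%:R by rewrite sqr_sqrtr.
have [m3|m3] := leqP m 2.
  apply: (le_trans (Ppow_le1 mu m (@seq_measurable_stay_below x))).
  rewrite lee_fin ler_pdivlMr ?exprn_gt0// mul1r.
  have : s ^+ 2 <= 2 by rewrite s2 (ler_nat R m 2).
  have : 0 <= C ^+ 3 by rewrite exprn_ge0// ltW.
  move=> c3 h; have s3 : s ^+ 3 <= 3 by rewrite exprS; nra.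
  apply: (le_trans s3); apply: (@le_trans _ _ ((27 * C ^+ 3 + 3) * 1)); first lra.
  by rewrite ler_wpM2l//; [lra|rewrite expr2; nra].
pose k := (m %/ 3)%N.
have k0 : (0 < k)%N by rewrite divn_gt0.
have e : m = (k + (k + (m - k - k)))%N.
  rewrite /k; have := leq_trunc_div m 3; set z := (m %/ 3)%N; lia.
have mk : (m <= 9 * k)%N.
  rewrite /k; have := ltn_ceil m (isT : 0 < 3)%N; set z := (m %/ 3)%N; rewrite -/z in k0 *.
  move: k0; rewrite /k -/z; lia.
have nk : (k <= m - k - k)%N.
  rewrite /k; have := leq_trunc_div m 3; set z := (m %/ 3)%N; lia.
rewrite {1}e.
apply: (le_trans (Ppow_stay_below_le k0 (leq_trans k0 nk) x0)).
rewrite lee_fin.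
have inv_le i : (k <= i)%N -> (Num.sqrt i%:R)^-1 <= 3 / s.
  move=> ki; rewrite -[leRHS]invrK lef_pV2 ?posrE ?sqrtr_gt0 ?ltr0n ?(leq_trans k0)//; last first.
    by rewrite invf_div divr_gt0.
  rewrite invf_div ler_pdivrMr//.
  have -> : (3 : R) = Num.sqrt 9.
    by rewrite -[LHS]ger0_norm// -sqrtr_sqr; congr Num.sqrt; ring.
  rewrite -sqrtrM ?ler0n// ler_wsqrtr// -natrM ler_nat (leq_trans mk)//.
  by rewrite mulnC leq_mul2r ki orbT.
have i0 i : 0 <= (Num.sqrt i%:R : R)^-1 by rewrite invr_ge0 sqrtr_ge0.
have hC : 0 <= C * (1 + x) by rewrite mulr_ge0 ?addr_ge0// ltW.
apply: (@le_trans _ _ (C * (1 + x) * (3 / s) * (C * (1 + x) * (3 / s)) * (C * (3 / s)))).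
  have t0 i : 0 <= C * (1 + x) / Num.sqrt i%:R by rewrite mulr_ge0.
  have tle i : (k <= i)%N -> C * (1 + x) / Num.sqrt i%:R <= C * (1 + x) * (3 / s).
    by move=> ki; rewrite ler_wpM2l// inv_le.
  apply: ler_pM.
  - by rewrite mulr_ge0.
  - by rewrite mulr_ge0// ltW.
  - by apply: ler_pM => //; exact: tle.
  - by rewrite ler_wpM2l ?inv_le// ltW.
have -> : C * (1 + x) * (3 / s) * (C * (1 + x) * (3 / s)) * (C * (3 / s)) =
   27 * C ^+ 3 * (1 + x) ^+ 2 / s ^+ 3 by field; rewrite gt_eqF.
by rewrite ler_pM2r ?invr_gt0 ?exprn_gt0// ler_wpM2r ?sqr_ge0// lerDl.
Qed.

Definition pstay n : R := fine (Ppow mu n (prefix_le (-1) 0)).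

Lemma pstayE n : (pstay n)%:E = Ppow mu n (prefix_le (-1)%R 0%R).
Proof. by rewrite fineK// Ppow_fin//; exact: seq_measurable_prefix_le. Qed.

Lemma pstay_ge0 n : 0 <= pstay n.
Proof. by rewrite -lee_fin pstayE Ppow_ge0. Qed.

Lemma pstay_le1 n : pstay n <= 1.
Proof. by rewrite -lee_fin pstayE Ppow_le1//; exact: seq_measurable_prefix_le. Qed.

Lemma pstay_bound n : (0 < n)%N -> pstay n <= C / Num.sqrt n%:R.
Proof.
move=> n0; rewrite -lee_fin pstayE.
by have := @prefix_bound (-1) (or_intror erefl) n 0 (lexx _) n0; rewrite addr0 mulr1.
Qed.

Lemma sum_pstay n : (0 < n)%N ->
  \sum_(0 <= j < n) pstay j <= (1 + 2 * C) * Num.sqrt n%:R.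
Proof.
case: n => // n _; rewrite big_nat_recl//=.
have s1 : 1 <= Num.sqrt n.+1%:R :> R by rewrite -[leLHS]sqrtr1 ler_wsqrtr// ler1n.
rewrite mulrDl; apply: lerD; first by rewrite mul1r (le_trans (pstay_le1 0)).
apply: (@le_trans _ _ (\sum_(0 <= i < n) C * (Num.sqrt i.+1%:R)^-1)).
  by apply: ler_sum => i _; exact: pstay_bound.
rewrite -mulr_sumr [2 * C]mulrC -mulrA ler_pM2l//.
apply: (le_trans (sum_inv_sqrt R n)); rewrite ler_pM2l// ler_wsqrtr//.
by rewrite ler_nat.
Qed.

Definition jump (h : R) : seq R -> bool := has (fun x => h < x).

Lemma seq_measurable_jump h : seq_measurable (jump h).
Proof.
move=> n; rewrite (_ : (fun _ => _) = (fun t : n.-tuple R =>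
   ~~ all (fun i => ~~ (h < t`_i)) (iota 0 n))).
  apply: measurable_neg.
  apply: (@measurable_fun_all _ _ _ _ (fun i (t : n.-tuple R) => ~~ (h < t`_i))) => i.
  apply: measurable_neg; apply: measurable_fun_ltr => //.
  exact: seq_measurable_nth.
apply/funext => t; rewrite /jump; apply/idP/allPn => [/hasP[x /(nthP 0)[i it <-] hx]|[i]].
  by exists i; rewrite ?mem_iota ?negbK// -(size_tuple t).
rewrite mem_iota negbK/= add0n => it hx; apply/hasP; exists (t`_i) => //.
by apply: mem_nth; rewrite size_tuple.
Qed.

(** A union over the time [j] of a step above [h]: this step is independent of the first [j] steps,
    which stay nonnegative with probability [pstay j], and the constraint after time [j] is dropped.
    The sum of the [pstay j] is of order [sqrt m]. *)
Lemma jump_bound m (h : R) : (0 < m)%N ->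
  (Ppow mu m (fun t => prefix_le (-1)%R 0%R t && jump h t) <=
   ((1 + 2 * C) * Num.sqrt m%:R)%:E * \int[mu]_x ((h < x)%R%:R)%:E)%E.
Proof.
move=> m0; set J := (\int[mu]_x ((h < x)%R%:R)%:E)%E.
have J0 : (0 <= J)%E by apply: integral_ge0 => x _; rewrite lee_fin.
pose A j : seq R -> bool := fun t =>
  all (fun k => -1 * psum t k <= 0) (iota 0 j.+1) && (h < t`_j).
have mA j : seq_measurable (A j).
  move=> n; apply: measurable_and.
    apply: (@measurable_fun_all _ _ _ _ (fun k (t : n.-tuple R) => -1 * psum t k <= 0)) => k.
    apply: measurable_fun_ler => //; apply: measurable_funM => //; exact: seq_measurable_psum.
  by apply: measurable_fun_ltr => //; exact: seq_measurable_nth.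
apply: (@le_trans _ _ (\sum_(0 <= j < m) Ppow mu m (A j))%E).
  rewrite /Ppow /Epow -ge0_integral_sum//; last by move=> j; exact: (seq_measurable_natr (mA j)).
  apply: ge0_le_integral => //.
  - apply: measurable_natr_bool; apply: measurable_and; first exact: seq_measurable_prefix_le.
    exact: seq_measurable_jump.
  - by apply: emeasurable_sum => j; exact: (seq_measurable_natr (mA j)).
  - move=> t _; have [/andP[/prefix_leP h1 /hasP[x /(nthP 0)[j jt <-] hx]]|_] := boolP (_ && _); last first.
      by apply: sume_ge0.
    rewrite size_tuple in jt h1.
    rewrite (big_rem j) ?mem_index_iota//= -[leLHS]adde0; apply: leeD; last by apply: sume_ge0.
    rewrite lee_fin (_ : A j t = true)// /A hx andbT; apply/allP => k.
    by rewrite mem_iota/= add0n ltnS => kj; apply: h1; rewrite (leq_trans kj)// ltnW.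
apply: (@le_trans _ _ (\sum_(0 <= j < m) J * (pstay j)%:E)%E).
  rewrite big_nat [leRHS]big_nat; apply: lee_sum => j /andP[_ jm].
  rewrite pstayE -[in leLHS](subnKC (ltnW jm)); apply: Ppow_cat_le => //.
  - exact: seq_measurable_prefix_le.
  - move=> s u sj _ /andP[/allP hp _]; apply/prefix_leP => k ks.
    by rewrite -(psum_catl u ks); apply: hp; rewrite mem_iota/= add0n ltnS -sj.
  - move=> s sj _; rewrite -(subnSK jm).
    have mh : seq_measurable (fun u : seq R => h < u`_0).
      by move=> n; apply: measurable_fun_ltr => //; exact: seq_measurable_nth.
    apply: (@le_trans _ _ (Ppow mu (m - j.+1).+1 (fun u => (h < u`_0)%R))).
      apply: le_Ppow => //; first exact: (seq_measurable_catl s (mA j)).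
      by move=> u _ /andP[_]; rewrite nth_cat sj ltnn subnn.
    rewrite /Ppow EpowS//; last exact: (seq_measurable_natr mh).
    by under eq_integral do rewrite /= Epow_cst.
rewrite -ge0_sume_distrr; last by move=> j _; rewrite lee_fin pstay_ge0.
by rewrite muleC; apply: lee_wpmul2r => //; rewrite sumEFin lee_fin sum_pstay.
Qed.

Definition below0 : seq R -> bool := fun t => all (fun k => psum t k < 0) (iota 1 (size t)).

Lemma seq_measurable_below0 : seq_measurable below0.
Proof.
move=> n; rewrite (_ : (fun _ => _) = (fun t : n.-tuple R =>
   all (fun k => psum t k < 0) (iota 1 n))); last first.
  by apply/funext => t; rewrite /below0 size_tuple.
apply: (@measurable_fun_all _ _ _ _ (fun k (t : n.-tuple R) => psum t k < 0)) => k.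
by apply: measurable_fun_ltr => //; exact: seq_measurable_psum.
Qed.

Lemma below0P t : reflect (forall k, (0 < k <= size t)%N -> psum t k < 0) (below0 t).
Proof.
apply: (iffP allP) => h k; first by move=> kt; apply: h; rewrite mem_iota add1n ltnS.
by rewrite mem_iota add1n ltnS; exact: h.
Qed.

Definition dneg n : R := fine (Ppow mu n below0).

Lemma dnegE n : (dneg n)%:E = Ppow mu n below0.
Proof. by rewrite fineK// Ppow_fin//; exact: seq_measurable_below0. Qed.

Lemma dneg_ge0 n : 0 <= dneg n.
Proof. by rewrite -lee_fin dnegE Ppow_ge0. Qed.

Lemma dneg_le1 n : dneg n <= 1.
Proof. by rewrite -lee_fin dnegE Ppow_le1//; exact: seq_measurable_below0. Qed.

Lemma dneg_bound n : (0 < n)%N -> dneg n <= C / Num.sqrt n%:R.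
Proof.
move=> n0; rewrite -lee_fin dnegE.
have := @prefix_bound 1 (or_introl erefl) n 0 (lexx _) n0; rewrite addr0 mulr1.
apply: le_trans; apply: le_Ppow.
- exact: seq_measurable_below0.
- exact: seq_measurable_prefix_le.
- move=> t _ /below0P h; apply/prefix_leP => -[|k] kt; first by rewrite psum0 mulr0.
  by rewrite mul1r ltW// h.
Qed.

Lemma sum_dneg n : (0 < n)%N ->
  \sum_(0 <= j < n) dneg j <= (1 + 2 * C) * Num.sqrt n%:R.
Proof.
case: n => // n _; rewrite big_nat_recl//=.
have s1 : 1 <= Num.sqrt n.+1%:R :> R by rewrite -[leLHS]sqrtr1 ler_wsqrtr// ler1n.
rewrite mulrDl; apply: lerD; first by rewrite mul1r (le_trans (dneg_le1 0)).
apply: (@le_trans _ _ (\sum_(0 <= i < n) C * (Num.sqrt i.+1%:R)^-1)).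
  by apply: ler_sum => i _; exact: dneg_bound.
rewrite -mulr_sumr [2 * C]mulrC -mulrA ler_pM2l//.
apply: (le_trans (sum_inv_sqrt R n)); rewrite ler_pM2l// ler_wsqrtr//.
by rewrite ler_nat.
Qed.

Lemma dneg_antimono n k : dneg (n + k) <= dneg n.
Proof.
rewrite -lee_fin !dnegE; apply: Ppow_catl_le; first exact: seq_measurable_below0.
move=> s t /below0P h; apply/below0P => j /andP[j0 js].
by rewrite -(psum_catl t js); apply: h; rewrite j0 size_cat (leq_trans js)// leq_addr.
Qed.

(** The values before the first minimum are strictly larger, those after it only at least as large;
    hence a strict condition on the reversed past and a weak one on the future. *)
Lemma exists_first_argmin (t : seq R) : exists2 k, (k <= size t)%N &
  below0 (rev (take k t)) && prefix_le (-1) 0 (drop k t).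
Proof.
pose P k := (k <= size t)%N && all (fun j => psum t k <= psum t j) (iota 0 (size t).+1).
have exP : exists k, P k.
  pose F (i : 'I_(size t).+1) := psum t i.
  case: (Order.TotalTheory.arg_minP F (isT : xpredT (ord0 : 'I_(size t).+1))) => i _ hi.
  exists i; rewrite /P -ltnS ltn_ord andTb; apply/allP => j; rewrite mem_iota/= add0n => jt.
  exact: (hi (Ordinal jt)).
case: (ex_minnP exP) => k /andP[kt /allP kmin] kfirst; exists k => //.
have kmin' j : (j <= size t)%N -> psum t k <= psum t j.
  by move=> jt; apply: kmin; rewrite mem_iota.
have sk : size (take k t) = k by exact: size_takel.
have tk j : (j <= k)%N -> psum (take k t) j = psum t j.
  by move=> jk; rewrite -[in RHS](cat_take_drop k t) psum_catl// sk.
apply/andP; split.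
  apply/below0P => j; rewrite size_rev sk => /andP[j0 jk].
  rewrite psum_rev sk// !tk ?leq_subr// subr_lt0.
  have lt : (k - j < k)%N by rewrite ltn_subrL j0 (leq_trans j0 jk).
  rewrite ltNge; apply/negP => le.
  suff /kfirst : P (k - j)%N by rewrite leqNgt lt.
  rewrite /P (leq_trans (ltnW lt))// andTb; apply/allP => i; rewrite mem_iota/= add0n ltnS => it.
  by rewrite (le_trans le)// kmin'.
apply/prefix_leP => j; rewrite size_drop => jt; rewrite mulN1r oppr_le0.
have := kmin' (k + j)%N; rewrite -leq_subRL// => /(_ jt).
have -> : psum t (k + j) = psum t k + psum (drop k t) j.
  by have := psum_catr (take k t) (drop k t) j; rewrite cat_take_drop sk tk.
lra.
Qed.

(* Decomposition at the first time of the minimum. *)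
Lemma sum_dneg_pstay n : 1 <= \sum_(0 <= k < n.+1) dneg k * pstay (n - k).
Proof.
pose A k : seq R -> bool := fun t =>
  below0 (rev (take k t)) && prefix_le (-1) 0 (drop k t).
have Acat k s u : size s = k -> A k (s ++ u) = below0 (rev s) && prefix_le (-1) 0 u.
  by move=> <-; rewrite /A take_size_cat// drop_size_cat.
have mb : seq_measurable (fun s => below0 (rev s)).
  exact: (seq_measurable_rev seq_measurable_below0).
have mA k : seq_measurable (A k).
  move=> m; have [mk|km] := ltnP m k.
    have e : (fun t : m.-tuple R => A k t) = (fun t : m.-tuple R => below0 (rev t) && prefix_le (-1) 0 ([::] : seq R)).
      apply/funext => t; rewrite /A take_oversize ?drop_oversize// size_tuple ltnW//.
    rewrite [X in measurable_fun _ X]e; exact: (measurable_and (mb m) (measurable_cst _)).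
  rewrite [X in measurable_fun _ X](_ : _ = (fun t : m.-tuple R =>
    all (fun j => psum t k - psum t (k - j) < 0) (iota 1 k) &&
    all (fun j => -1 * (psum t (k + j) - psum t k) <= 0) (iota 0 (m - k).+1))).
    apply: measurable_and.
      apply: (@measurable_fun_all _ _ _ _ (fun j (t : m.-tuple R) => psum t k - psum t (k - j) < 0)) => j.
      by apply: measurable_fun_ltr => //; apply: measurable_funB; exact: seq_measurable_psum.
    apply: (@measurable_fun_all _ _ _ _ (fun j (t : m.-tuple R) => -1 * (psum t (k + j) - psum t k) <= 0)) => j.
    apply: measurable_fun_ler => //; apply: measurable_funM => //.
    by apply: measurable_funB; exact: seq_measurable_psum.
  apply/funext => t; have kt : (k <= size t)%N by rewrite size_tuple.
  have tk j : (j <= k)%N -> psum (take k t) j = psum t j.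
    by move=> jk; rewrite -[in RHS](cat_take_drop k t) psum_catl// size_takel.
  rewrite /A /below0 /prefix_le size_rev size_takel// size_drop size_tuple; congr andb.
    apply: eq_in_all => j; rewrite mem_iota add1n ltnS => /andP[_ jk].
    by rewrite psum_rev size_takel// !tk// leq_subr.
  apply: eq_all => j; congr (-1 * _ <= 0).
  have sk : size (take k t) = k by exact: size_takel.
  have -> : psum t (k + j) = psum t k + psum (drop k t) j.
    by have := psum_catr (take k t) (drop k t) j; rewrite cat_take_drop sk tk.
  by rewrite addrAC subrr add0r.
have key : (1 <= \sum_(0 <= k < n.+1) Ppow mu n (A k))%E.
  rewrite /Ppow /Epow -ge0_integral_sum//; last by move=> k; exact: (seq_measurable_natr (mA k)).
  rewrite -[leLHS](Epow_cst mu n); apply: ge0_le_integral => //.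
    by apply: emeasurable_sum => k; exact: (seq_measurable_natr (mA k)).
  move=> t _; have [k kt hk] := exists_first_argmin t.
  rewrite size_tuple in kt.
  rewrite (big_rem k) ?mem_index_iota ?ltnS//= -[leLHS]adde0; apply: leeD; last by apply: sume_ge0.
  by rewrite lee_fin /A hk.
rewrite -lee_fin; apply: (le_trans key); rewrite -sumEFin big_nat [leRHS]big_nat.
apply: lee_sum => k /andP[_]; rewrite ltnS => kn.
rewrite EFinM pstayE dnegE muleC -[in Ppow mu k _]Ppow_rev; last exact: seq_measurable_below0.
rewrite -[X in Ppow mu X (A k)](subnKC kn); apply: Ppow_cat_le => //.
- exact: Ppow_ge0.
- by move=> s u sk _; rewrite Acat// => /andP[].
- move=> s sk _; apply: le_Ppow.
  + exact: (seq_measurable_catl s (mA k)).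
  + exact: seq_measurable_prefix_le.
  + by move=> u _; rewrite Acat// => /andP[].
Qed.

End walk_estimates.

(** * Generating functions *)

Section generating_function.
Context (R : realType).

Definition gf (q : probability nat R) (u : R) : R := fine (\int[q]_k (u ^+ k)%:E).

Section gf_facts.
Variables (q : probability nat R) (u : R).
Hypothesis u01 : 0 <= u <= 1.

Lemma gf_int_bounds : (0 <= \int[q]_k (u ^+ k)%:E <= 1)%E.
Proof.
have /andP[u0 u1] := u01; apply/andP; split.
  by apply: integral_ge0 => k _; rewrite lee_fin exprn_ge0.
rewrite -[leRHS](integral_prob_cst q); apply: ge0_le_integral => //.
- by move=> k _; rewrite lee_fin exprn_ge0.
- by move=> k _; rewrite lee_fin exprn_ile1.
Qed.

Lemma gfE : (gf q u)%:E = (\int[q]_k (u ^+ k)%:E)%E.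
Proof.
have /andP[h0 h1] := gf_int_bounds.
by rewrite /gf fineK// ge0_fin_numE// (le_lt_trans h1)// ltry.
Qed.

Lemma gf_bounds : 0 <= gf q u <= 1.
Proof. by have := gf_int_bounds; rewrite -gfE !lee_fin. Qed.

End gf_facts.

Lemma expr_mul_le1 (t : R) k : 0 <= t <= 1 -> (1 - t) ^+ k * (1 + k%:R * t) <= 1.
Proof.
move=> /andP[t0 t1]; elim: k => [|k ih]; first by rewrite expr0 mul0r addr0 mulr1.
apply: le_trans ih; rewrite exprSr -mulrA ler_wpM2l ?exprn_ge0 ?subr_ge0//.
rewrite -natr1; have : 0 <= k%:R :> R by []. nra.
Qed.

(* The tangent-line form of the Cauchy-Schwarz inequality
   E[Y] ^ 2 <= E[Y / (1 + Y)] * E[Y * (1 + Y)], for Y = k * t. *)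
Lemma gf_le (q : probability nat R) (M kappa t : R) :
  0 < t <= 1 -> 0 < M -> 0 <= kappa ->
  (\int[q]_k (k%:R)%:E = M%:E)%E ->
  (\int[q]_k (k%:R ^+ 2)%:E <= (kappa * M ^+ 2)%:E)%E ->
  gf q (1 - t) <= 1 - 1 / (1 / (M * t) + kappa).
Proof.
move=> /andP[t0 t1] M0 k0 hM hM2.
have u01 : 0 <= 1 - t <= 1 by apply/andP; split; lra.
have D0 : 0 < 1 + kappa * M * t by rewrite ltr_pwDl// mulr_ge0 ?mulr_ge0// ltW.
(* The optimal coefficient of the tangent line is [E[Y] / E[Y (1 + Y)]]; replacing the second moment
   of [q] by its bound [kappa * M^2] turns it into this value. *)
pose l := (1 + kappa * M * t)^-1; have l0 : 0 < l by rewrite invr_gt0.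
have key : ((gf q (1 - t))%:E + (2 * l * t)%:E * M%:E <=
   1 + ((l ^+ 2 * t)%:E * M%:E + (l ^+ 2 * t ^+ 2)%:E * (kappa * M ^+ 2)%:E))%E.
  apply: (@le_trans _ _ (1 + ((l ^+ 2 * t)%:E * M%:E + (l ^+ 2 * t ^+ 2)%:E * \int[q]_k (k%:R ^+ 2)%:E)))%E; last first.
    apply: leeD => //; apply: leeD => //; apply: lee_wpmul2l => //.
    by rewrite lee_fin mulr_ge0// sqr_ge0.
  rewrite gfE// -hM -!ge0_integralZl//; last 3 first.
  - by rewrite lee_fin mulr_ge0// sqr_ge0.
  - by rewrite lee_fin mulr_ge0 ?sqr_ge0// ltW.
  - by rewrite lee_fin !mulr_ge0// ltW.
  rewrite -[X in (_ <= X + _)%E](integral_prob_cst q) -!ge0_integralD//; last 5 first.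
  - move=> k _; rewrite -!EFinM -EFinD lee_fin.
    by apply: addr_ge0; apply: mulr_ge0; rewrite ?mulr_ge0 ?sqr_ge0// ltW.
  - by move=> k _; rewrite -!EFinM lee_fin; apply: mulr_ge0; rewrite ?mulr_ge0 ?sqr_ge0// ltW.
  - by move=> k _; rewrite -!EFinM lee_fin; apply: mulr_ge0; rewrite ?mulr_ge0 ?sqr_ge0// ltW.
  - by move=> k _; rewrite lee_fin exprn_ge0// subr_ge0.
  - by move=> k _; rewrite -!EFinM lee_fin !mulr_ge0// ltW.
  apply: ge0_le_integral => //.
  - move=> k _; rewrite -!EFinM -EFinD lee_fin; apply: addr_ge0.
      by rewrite exprn_ge0// subr_ge0.
    by rewrite !mulr_ge0// ltW.
  - move=> k _; rewrite -!EFinM -!EFinD lee_fin.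
    have := @expr_mul_le1 t k; rewrite (ltW t0) t1 => /(_ isT).
    have : 0 <= k%:R * t by rewrite mulr_ge0// ltW.
    have -> : l ^+ 2 * t * k%:R + l ^+ 2 * t ^+ 2 * k%:R ^+ 2 = l ^+ 2 * ((k%:R * t) * (1 + k%:R * t)) by ring.
    have -> : 2 * l * t * k%:R = 2 * l * (k%:R * t) by ring.
    set z := (1 - t) ^+ k; set x := k%:R * t => x0 hz.
    have x1 : 0 < 1 + x by lra.
    rewrite -(ler_pM2r x1); have : 0 <= x * (1 - l * (1 + x)) ^+ 2 by rewrite mulr_ge0// sqr_ge0.
    nra.
move: key; rewrite -!EFinM -!EFinD lee_fin => key.
have -> : 1 / (1 / (M * t) + kappa) = l * (M * t).
  have -> : 1 / (M * t) + kappa = (1 + kappa * M * t) / (M * t) by field; rewrite !gt_eqF.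
  by rewrite div1r invf_div mulrC.
have e : l * (1 + kappa * M * t) = 1 by rewrite mulVf// gt_eqF.
have : l ^+ 2 * t * M + l ^+ 2 * t ^+ 2 * (kappa * M ^+ 2) = l * (M * t) * (l * (1 + kappa * M * t)) by ring.
rewrite e mulr1 => e2; lra.
Qed.

End generating_function.

(** * Iterated generating functions along a fixed environment *)

Section telescoping.
Context (R : realType).
Variables (f : nat -> R -> R).

(* For f n the generating function of the n-th reproduction law, the generating
   function at time m of the process started from 0 with one immigrant per
   generation. *)
Fixpoint imm_gf m (u : R) : R := if m is m'.+1 then u * imm_gf m' (f m' u) else 1.

Hypothesis f01 : forall n u, 0 <= u <= 1 -> 0 <= f n u <= 1.

Lemma imm_gf_bounds m u : 0 <= u <= 1 -> 0 <= imm_gf m u <= 1.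
Proof.
elim: m u => [|m ih] u u01 /=; first by rewrite ler01 lexx.
have /andP[h1 h2] := ih _ (f01 m u01); have /andP[u0 u1] := u01.
by rewrite mulr_ge0// mulr_ile1.
Qed.

(** In the application [x n] is [exp(- S_n)], [D] is [exp h], and [kappa * M n ^ 2] bounds the
    second moment of the [n]-th offspring law. *)
Variables (M x : nat -> R) (kappa D : R).
Hypothesis f_le : forall n t, 0 < t <= 1 -> f n (1 - t) <= 1 - 1 / (1 / (M n * t) + kappa).
Hypothesis M_gt0 : forall n, 0 < M n.
Hypothesis x_gt0 : forall n, 0 < x n.
Hypothesis xS : forall n, x n = M n * x n.+1.
Hypothesis kappa_ge1 : 1 <= kappa.
Hypothesis D_gt0 : 0 < D.

(** For [L = r] this is equivalent to [ln r <= r - 1]. Here the largest step enters, at the price of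
    the factor [1 + ln L]. *)
Lemma ln_le_ratio (r L : R) : 1 <= r -> r <= L -> ln r <= (1 - r^-1) * (1 + ln L).
Proof.
move=> r1 rL; have r0 : 0 < r by lra.
have L0 : 0 < L by lra.
have h : ln r <= r - 1.
  by have := @le_ln1Dx R (r - 1); rewrite addrCA subrr addr0; apply; lra.
have hL : ln r <= ln L by rewrite ler_ln.
have ir : r^-1 <= 1 by rewrite invf_le1.
apply: (@le_trans _ _ ((1 - r^-1) * (1 + ln r))); last by rewrite ler_wpM2l; lra.
have e : r * r^-1 = 1 by rewrite divff// gt_eqF.
have ir0 : 0 < r^-1 by rewrite invr_gt0.
nra.
Qed.

(* Each generation back replaces A by A + kappa * x m and costs a factor
   u <= 1 - x m / A; these relative increments add up to a logarithm. *)
Lemma imm_gf_le m A u : 0 < A -> 0 <= u <= 1 -> x m / A <= 1 - u ->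
  (forall j, (j < m)%N -> x j <= D * x j.+1) ->
  ((0 < m)%N -> x m.-1 <= D * A) ->
  imm_gf m u <= expR (1 - x m / A -
    (ln (A + kappa * \sum_(0 <= i < m) x i) - ln A) / (kappa * (1 + ln (1 + kappa * D)))).
Proof.
set c := kappa * (1 + ln _).
have k0 : 0 < kappa by apply: lt_le_trans kappa_ge1.
have c0 : 0 < c.
  apply: mulr_gt0 => //; apply: ltr_pwDl => //.
  by rewrite ln_ge0// lerDl mulr_ge0// ltW.
elim: m A u => [|m ih] A u A0 u01 hu hx hlast /=.
  rewrite big_geq// mulr0 addr0 subrr mul0r subr0 -[leLHS]expR0 ler_expR.
  by have /andP[? ?] := u01; lra.
have /andP[u0 u1] := u01.
pose A' := A + kappa * x m.
have A'0 : 0 < A' by rewrite addr_gt0// mulr_gt0.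
have t0 : 0 < 1 - u by apply: lt_le_trans hu; rewrite divr_gt0.
(* The invariant of the recursion: [1 / (1 / (M m * t) + kappa)] increases with [t], and at
   [t = x m.+1 / A] it equals [x m / A'] by [xS]. *)
have hu' : x m / A' <= 1 - f m u.
  have := @f_le m (1 - u); rewrite t0 lerBlDr lerDl u0 => /(_ isT).
  rewrite (_ : 1 - (1 - u) = u); last by ring.
  move=> h; apply: (@le_trans _ _ (1 / (1 / (M m * (1 - u)) + kappa))); last lra.
  have -> : x m / A' = 1 / (A / x m + kappa).
    by rewrite /A'; field; rewrite !gt_eqF//= -/A' ?gt_eqF// mulrC -/A'.
  have p1 : 0 < (M m * (1 - u))^-1 by rewrite invr_gt0 mulr_gt0.
  rewrite !div1r lef_pV2 ?posrE ?addr_gt0 ?divr_gt0//.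
  rewrite lerD2r -div1r ler_pdivrMr ?mulr_gt0//.
  rewrite xS; have -> : A / (M m * x m.+1) * (M m * (1 - u)) = (1 - u) / (x m.+1 / A).
    by field; rewrite !gt_eqF.
  by rewrite ler_pdivlMr ?divr_gt0// mul1r.
have hx' j : (j < m)%N -> x j <= D * x j.+1 by move=> jm; apply: hx; rewrite ltnW.
have hlast' : (0 < m)%N -> x m.-1 <= D * A'.
  move=> m0; have := hx' m.-1; rewrite prednK// leqnn => /(_ isT) hm.
  apply: (le_trans hm); rewrite ler_pM2l// /A'.
  have : x m <= kappa * x m by rewrite ler_peMl// ltW.
  by move: A0; lra.
have := ih A' (f m u) A'0 (f01 m u01) hu' hx' hlast'; set H := imm_gf m (f m u).
move=> hH.
have uexp : u <= expR (- (x m.+1 / A)).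
  apply: (@le_trans _ _ (expR (- (1 - u)))); last by rewrite ler_expR lerN2.
  by have := expR_ge1Dx (- (1 - u)); lra.
have H0 : 0 <= H by have /andP[] := @imm_gf_bounds m _ (f01 m u01).
apply: (@le_trans _ _ (expR (- (x m.+1 / A)) * expR (1 - x m / A' -
    (ln (A' + kappa * \sum_(0 <= i < m) x i) - ln A') / c))).
  exact: ler_pM.
rewrite -expRD ler_expR big_nat_recr//=.
have -> : A + kappa * (\sum_(0 <= i < m) x i + x m) = A' + kappa * \sum_(0 <= i < m) x i.
  by rewrite /A'; ring.
set B := ln _.
suff : (ln A' - ln A) / c <= x m / A'.
  have -> : (B - ln A') / c = (B - ln A) / c - (ln A' - ln A) / c by ring.
  lra.
rewrite ler_pdivrMr// -ln_div ?posrE//.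
have rA : A' / A = 1 + kappa * x m / A by rewrite /A'; field; rewrite gt_eqF.
have r1 : 1 <= A' / A by rewrite rA lerDl divr_ge0 ?mulr_ge0// ltW.
have rL : A' / A <= 1 + kappa * D.
  by rewrite rA lerD2l -mulrA ler_pM2l// ler_pdivrMr//; exact: hlast.
apply: (le_trans (ln_le_ratio r1 rL)).
rewrite /c mulrA ler_wpM2r//.
  by rewrite addr_ge0// ln_ge0// lerDl mulr_ge0// ltW.
have -> : 1 - (A' / A)^-1 = x m / A' * kappa; last by [].
by rewrite invf_div /A'; field; rewrite gt_eqF// -/A'.
Qed.

End telescoping.

(** * The process given its environment *)

Section countable_split.
Context d (T : measurableType d) (R : realType) (P : {measure set T -> \bar R}).

Lemma integral_split_nat (f : T -> nat) (g : T -> R) :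
  measurable_fun setT f -> measurable_fun setT g -> (forall w, 0 <= g w) ->
  (\int[P]_w (g w)%:E = \sum_(k <oo) \int[P]_w (g w * (f w == k)%:R)%:E)%E.
Proof.
move=> mf mg g0; pose F k := f @^-1` [set k].
have mF k : measurable (F k) by rewrite -[F k]setTI; exact: mf.
have UF : \bigcup_k F k = setT by apply/seteqP; split => // w _; exists (f w).
have tF : trivIset setT F.
  by apply/trivIsetP => i j _ _ ij; apply/seteqP; split => // w [/= fi fj]; case/eqP: ij; rewrite -fi -fj.
rewrite -[in LHS]UF ge0_integral_bigcup//; last 2 first.
- by rewrite UF; exact/measurable_EFinP.
- by move=> w _; rewrite lee_fin.
apply: eq_eseriesr => k _; rewrite integral_mkcond; apply: eq_integral => w _.
rewrite patchE; case: ifPn => [|].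
  by rewrite inE /F /= => ->; rewrite eqxx mulr1.
by rewrite notin_setE /F /= => /eqP/negbTE ->; rewrite mulr0.
Qed.

End countable_split.

Section law_on_nat.
Context (R : realType) (q : probability nat R).

Lemma integral_law_nat (g : nat -> R) : (forall k, 0 <= g k) ->
  (\int[q]_k (g k)%:E = \sum_(k <oo) (g k)%:E * q [set k])%E.
Proof.
move=> g0; rewrite (@integral_split_nat _ _ _ q id)//.
apply: eq_eseriesr => k _.
rewrite (eq_integral (fun j => (g k)%:E * (\1_[set k] j)%:E)%E); last first.
  move=> j _; rewrite -EFinM indicE in_set1; congr EFin.
  by case: eqP => [->|]; rewrite ?mulr0.
rewrite ge0_integralZl ?lee_fin//; congr (_ * _)%E.
by rewrite (integral_indic q measurableT) ?setIT.
Qed.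

End law_on_nat.

Section pprobability_measurable.
Context (R : realType).

Lemma measurable_pprob_ev (A : set nat) :
  measurable_fun [set: pprobability nat R] (fun q : pprobability nat R => (q : probability nat R) A).
Proof.
exact: (measurable_kernel (kprobability (@measurable_id _ (pprobability nat R) setT)) A).
Qed.

Lemma measurable_pprob_integral (g : nat -> R) : (forall k, 0 <= g k) ->
  measurable_fun [set: pprobability nat R]
    (fun q : pprobability nat R => \int[(q : probability nat R)]_k (g k)%:E)%E.
Proof.
move=> g0; under eq_fun do rewrite integral_law_nat//.
apply: ge0_emeasurable_sum => [k q _ _|k _].
  by rewrite mule_ge0// lee_fin.
by apply: measurable_funeM; exact: measurable_pprob_ev.
Qed.

End pprobability_measurable.

Section integral_extension.
Context d (T : measurableType d) (R : realType) (P : {measure set T -> \bar R}).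
Variable G : set (set T).
Hypothesis Gm : <<s G >> `<=` measurable.

Local Notation TG := (g_sigma_algebraType G).

Lemma sub_measurable_fun d' (T' : measurableType d') (V : T -> T') :
  measurable_fun [set: TG] V -> measurable_fun [set: T] V.
Proof. by move=> mV _ B mB; rewrite setTI; apply: Gm; rewrite -[X in <<s G >> X]setTI; exact: mV. Qed.

Import HBNNSimple.

(** Passage from indicators to nonnegative functions by simple functions and monotone convergence.
    The approximation of [V] is taken on the generated sigma-algebra, so that the level sets of its
    members are admissible sets [B]. *)
Lemma integral_extension (h k : T -> R) (V : TG -> R) :
  measurable_fun [set: T] h -> measurable_fun [set: T] k ->
  (forall w, 0 <= h w) -> (forall w, 0 <= k w) ->
  (forall B, <<s G >> B -> (\int[P]_w (\1_B w * h w)%:E = \int[P]_w (\1_B w * k w)%:E)%E) ->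
  measurable_fun [set: TG] V -> (forall w, 0 <= V w) ->
  (\int[P]_w (V w * h w)%:E = \int[P]_w (V w * k w)%:E)%E.
Proof.
move=> mh mk h0 k0 hk mV V0.
have mVE : measurable_fun [set: TG] (EFin \o V) by exact/measurable_EFinP.
pose g := nnsfun_approx measurableT mVE.
have mg n : measurable_fun [set: T] (g n).
  by apply: sub_measurable_fun; exact: measurable_funPT.
have gV w : (g n w)%:E @[n --> \oo] --> (V w)%:E.
  by have := @cvg_nnsfun_approx _ TG R setT measurableT (EFin \o V) mVE (fun w _ => V0 w) w I.
have aux (f : T -> R) : measurable_fun [set: T] f -> (forall w, 0 <= f w) ->
    (\int[P]_w (V w * f w)%:E = limn (fun n => \int[P]_w (g n w * f w)%:E))%E.
  move=> mf f0.
  rewrite -(@monotone_convergence _ T R P setT measurableT (fun n w => (g n w * f w)%:E)); first last.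
  - move=> w _ m n mn; rewrite lee_fin ler_wpM2r//.
    by have := @nd_nnsfun_approx _ TG R setT measurableT (EFin \o V) mVE _ _ mn => /lefP/(_ w).
  - by move=> n w _; rewrite lee_fin mulr_ge0.
  - by move=> n; apply/measurable_EFinP; exact: measurable_funM.
  apply: eq_integral => w _; apply/esym/cvg_lim => //.
  under eq_fun do rewrite EFinM.
  by rewrite EFinM; apply: cvgeZr => //; exact: gV.
rewrite aux// aux//; congr (limn _); apply/funext => n.
have sumE (f : T -> R) : measurable_fun [set: T] f -> (forall w, 0 <= f w) ->
    (\int[P]_w (g n w * f w)%:E =
     \sum_(r \in range (g n)) r%:E * \int[P]_w (\1_(g n @^-1` [set r]) w * f w)%:E)%E.
  move=> mf f0.
  have mgr r : measurable (g n @^-1` [set r] : set T).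
    by apply: Gm; exact: (measurable_sfunP (g n)).
  transitivity (\int[P]_w (\sum_(r \in range (g n)) (r * \1_(g n @^-1` [set r]) w * f w)%:E))%E.
    apply: eq_integral => w _; rewrite fsumEFin//; congr EFin.
    by rewrite -mulr_fsuml// -fimfunE.
  rewrite ge0_integral_fsum//; last 2 first.
  - move=> r; apply/measurable_EFinP; apply: measurable_funM => //.
    by apply: measurable_funM => //; exact: measurable_indic.
  - move=> r w _; rewrite lee_fin mulr_ge0//.
    rewrite indicE; case: (boolP (w \in _)) => [|_]; last by rewrite mulr0.
    by rewrite inE /= => <-; rewrite mulr1.
  apply: eq_fsbigr => r; rewrite inE => -[w0 _ rw0].
  have r0 : 0 <= r by rewrite -rw0.
  rewrite -ge0_integralZl//; last 2 first.
  - by apply/measurable_EFinP; apply: measurable_funM => //; exact: measurable_indic.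
  - by move=> w _; rewrite lee_fin mulr_ge0.
  by apply: eq_integral => w _; rewrite -EFinM mulrA.
rewrite sumE// sumE//; apply: eq_fsbigr => r _; congr (_ * _)%E.
by apply: hk; exact: (measurable_sfunP (g n)).
Qed.

End integral_extension.

(** The conditional law is given for square blocks of indices; filling a block with full sets
    outside a finite list reduces its product to the list. *)
Lemma big_square_mem (R : realType) (N : nat) (s : seq (nat * nat)) (F : nat * nat -> R) :
  uniq s -> all (fun p => (p.1 < N) && (p.2 < N))%N s ->
  \prod_(n < N) \prod_(i < N) (if (n : nat, i : nat) \in s then F (n : nat, i : nat) else 1) =
  \prod_(p <- s) F p.
Proof.
move=> us /allP sN.
pose G n i := if (n, i) \in s then F (n, i) else 1.
transitivity (\prod_(0 <= n < N) \prod_(0 <= i < N) G n i).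
  by rewrite big_mkord; apply: eq_bigr => n _; rewrite big_mkord.
rewrite -(@big_allpairs _ _ _ _ _ _ _ (fun p => if p \in s then F p else 1)).
rewrite -big_mkcond -big_filter; apply: perm_big; apply: uniq_perm => //.
  by rewrite filter_uniq// allpairs_uniq ?iota_uniq// => -[? ?] [? ?].
move=> p; rewrite mem_filter; case: (boolP (p \in s)) => //= ps.
have /andP[p1 p2] := sN _ ps; apply/allpairsP; exists p.
by rewrite !mem_index_iota p1 p2; case: p {ps p1 p2}.
Qed.

Lemma measurable_nat_subst d (T : measurableType d) d' (T' : measurableType d')
    (f : T -> nat) (g : nat -> T -> T') :
  measurable_fun setT f -> (forall k, measurable_fun setT (g k)) ->
  measurable_fun setT (fun w => g (f w) w).
Proof.
move=> mf mg _ B mB; rewrite setTI.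
rewrite (_ : _ @^-1` B = \bigcup_k (f @^-1` [set k] `&` (g k) @^-1` B)); last first.
  by apply/seteqP; split => [w Bw|w [k _ [/= <-]]//]; exists (f w).
apply: bigcup_measurable => k _; apply: measurableI.
  by rewrite -[X in measurable X]setTI; exact: mf.
by rewrite -[X in measurable X]setTI; exact: mg.
Qed.

Section quenched.
Context (R : realType) (Y : bprei R).
Local Notation P := (bpP Y).
Local Notation T := (bp_space Y).

(** Generators of the environment sigma-algebra; measurability on [Env] below means dependence on
    the environment only. *)
Definition mark_gen : set (set T) :=
  \bigcup_i preimage_set_system setT (bpmark Y i) measurable.

Local Notation Env := (g_sigma_algebraType mark_gen).

Lemma env_sub : <<s mark_gen >> `<=` measurable.
Proof.
apply: smallest_sub; first exact: sigma_algebra_measurable.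
move=> _ [i _ [B mB <-]]; suff m : measurable_fun setT (bpmark Y i) by exact: m.
by apply: measurable_fun_pair.
Qed.

Lemma env_measurable_mark i : measurable_fun [set: Env] (bpmark Y i).
Proof.
by move=> _ B mB; apply: sub_sigma_algebra; exists i => //; exists B.
Qed.

Lemma env_measurable_Q i : measurable_fun [set: Env] (bpQ Y i).
Proof. exact: (measurableT_comp measurable_fst (env_measurable_mark i)). Qed.

Lemma env_measurable_fun d (S : measurableType d) (V : T -> S) :
  measurable_fun [set: Env] V -> measurable_fun [set: T] V.
Proof. by apply: sub_measurable_fun; exact: env_sub. Qed.

Definition Qp n e w : R := fine ((bpQ Y n w : probability nat R) [set e]).

Lemma QpE n e w : ((Qp n e w)%:E = (bpQ Y n w : probability nat R) [set e])%E.
Proof. by rewrite fineK// fin_num_measure. Qed.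

Lemma Qp_ge0 n e w : 0 <= Qp n e w.
Proof. by rewrite fine_ge0. Qed.

Lemma env_measurable_Qp n e : measurable_fun [set: Env] (Qp n e).
Proof.
apply/measurable_EFinP; rewrite (_ : _ \o _ = fun w => (bpQ Y n w : probability nat R) [set e]).
  exact: (measurableT_comp (measurable_pprob_ev [set e]) (env_measurable_Q n)).
by apply/funext => w /=; rewrite QpE.
Qed.

Definition xi (p : nat * nat) w : nat := bpxi Y p.1 p.2 w.

Definition all_xi (s : seq (nat * nat)) (e : nat * nat -> nat) w : bool :=
  all (fun p => xi p w == e p) s.

Lemma measurable_xi p : measurable_fun [set: T] (xi p).
Proof. by []. Qed.

Lemma measurable_natr_eq (f : T -> nat) k : measurable_fun [set: T] f ->
  measurable_fun [set: T] (fun w => ((f w == k)%:R : R)).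
Proof. by move=> mf; apply: (@measurableT_comp _ _ _ _ _ _ (fun i : nat => (i == k)%:R : R)). Qed.

Lemma measurable_all_xi s e : measurable_fun [set: T] (fun w => (all_xi s e w)%:R : R).
Proof.
elim: s => [|p s ih]; first exact: measurable_cst.
rewrite (_ : (fun _ => _) = (fun w => (xi p w == e p)%:R * (all_xi s e w)%:R)).
  by apply: measurable_funM => //; exact: measurable_natr_eq.
by apply/funext => w; rewrite /all_xi /= -mulnb natrM.
Qed.

(** The quenched product law of finitely many offspring numbers, tested against functions of the
    environment. Immigration is left unconstrained because that of the comparison process is
    deterministic. *)
Lemma cond_law_all_xi s e (V : T -> R) : uniq s ->
  measurable_fun [set: Env] V -> (forall w, 0 <= V w) ->
  (\int[P]_w (V w * (all_xi s e w)%:R)%:E =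
   \int[P]_w (V w * \prod_(p <- s) Qp p.1 (e p) w)%:E)%E.
Proof.
move=> us; apply: (@integral_extension _ _ _ P mark_gen env_sub).
- exact: measurable_all_xi.
- by apply: env_measurable_fun; apply: measurable_prod => p _; exact: env_measurable_Qp.
- by move=> w.
- by move=> w; apply: prodr_ge0 => p _; exact: Qp_ge0.
move=> B sB; have mB : measurable B by exact: env_sub.
pose N := (\max_(p <- s) maxn p.1 p.2).+1.
have sN : all (fun p => (p.1 < N) && (p.2 < N))%N s.
  apply/allP => p ps; rewrite /N !ltnS.
  by apply/andP; split; apply: (leq_trans _ (leq_bigmax_seq p ps isT)); rewrite ?leq_maxl ?leq_maxr.
pose A n i := if (n, i) \in s then [set e (n, i)] else setT.
have [_ /(_ B sB)] := @bp_cond_law R Y N A (fun=> setT).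
set E := [set w | _].
have EE : E = [set w | all_xi s e w].
  apply/seteqP; split => w /=.
    move=> h; apply/allP => -[n i] ps; have /andP[/= n1 i1] := allP sN _ ps.
    by have [_ /(_ i i1)] := h n n1; rewrite /A ps => /= /eqP.
  move=> /allP h n n1; split => // i i1; rewrite /A; case: ifP => // ps.
  by have /eqP := h _ ps.
have -> : (\int[P]_w (\1_B w * (all_xi s e w)%:R)%:E = P (E `&` B))%E.
  have mE : measurable E.
    rewrite EE [X in measurable X](_ : _ = (fun w => (all_xi s e w)%:R : R) @^-1` [set 1]).
      by rewrite -[X in measurable X]setTI; apply: measurable_all_xi.
    apply/seteqP; split => w /=; first by move=> ->.
    by case: (all_xi s e w) => //= /eqP; rewrite eq_sym oner_eq0.
  have := integral_indic P measurableT (measurableI _ _ mE mB); rewrite setIT => <-.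
  apply: eq_integral => w _; congr EFin; rewrite !indicE in_setI mulrC -natrM mulnb EE.
  by congr (nat_of_bool (_ && _))%:R; apply/idP/idP; rewrite inE.
move=> ->; rewrite [LHS]integral_mkcond; apply: eq_integral => w _.
rewrite patchE indicE; case: ifPn => _; last by rewrite mul0r.
rewrite mul1r -(@big_square_mem _ N s (fun p => Qp p.1 (e p) w))//.
rewrite -prodEFin; apply: eq_bigr => n _.
rewrite probability_setT mul1e -prodEFin; apply: eq_bigr => i _.
by rewrite /A; case: ifP => _; rewrite ?QpE ?probability_setT.
Qed.

(* [h] depends only on the offspring numbers in [pst]: given the environment,
   the offspring numbers outside [pst] are independent of [h]. *)
Definition past (pst : pred (nat * nat)) (h : T -> R) : Prop :=
  [/\ measurable_fun [set: T] h, forall w, 0 <= h w &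
   forall s e (V : T -> R), uniq s -> all (predC pst) s ->
   measurable_fun [set: Env] V -> (forall w, 0 <= V w) ->
   (\int[P]_w (V w * (h w * (all_xi s e w)%:R))%:E =
    \int[P]_w (V w * (h w * \prod_(p <- s) Qp p.1 (e p) w))%:E)%E].

Lemma past_cst pst (c : R) : 0 <= c -> past pst (fun=> c).
Proof.
move=> c0; split => // s e V us _ mV V0.
under eq_integral do rewrite mulrA; under [RHS]eq_integral do rewrite mulrA.
apply: (@cond_law_all_xi s e (fun w => V w * c)) => //; first exact: measurable_funM.
by move=> w; rewrite mulr_ge0.
Qed.

Lemma past_sub (pst pst' : pred (nat * nat)) h : (forall p, pst p -> pst' p) ->
  past pst h -> past pst' h.
Proof.
move=> sub [mh h0 hh]; split => // s e V us sp; apply: hh => //.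
by apply: sub_all sp => p /=; apply: contra; exact: sub.
Qed.

Lemma measurable_prod_Qp (s : seq (nat * nat)) (e : nat * nat -> nat) : measurable_fun [set: T] (fun w => \prod_(p <- s) Qp p.1 (e p) w).
Proof. by apply: env_measurable_fun; apply: measurable_prod => p _; exact: env_measurable_Qp. Qed.

Lemma prod_Qp_ge0 (s : seq (nat * nat)) (e : nat * nat -> nat) w : 0 <= \prod_(p <- s) Qp p.1 (e p) w.
Proof. by apply: prodr_ge0 => p _; exact: Qp_ge0. Qed.

Lemma past_split pst (h : T -> R) (f : T -> nat) : measurable_fun [set: T] h ->
  (forall w, 0 <= h w) -> measurable_fun [set: T] f ->
  (forall k, past pst (fun w => h w * (f w == k)%:R)) -> past pst h.
Proof.
move=> mh h0 mf hf; split => // s e V us sp mV V0.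
have mVT := env_measurable_fun mV.
rewrite (@integral_split_nat _ _ _ _ f)//; last 2 first.
- by apply: measurable_funM => //; apply: measurable_funM => //; exact: measurable_all_xi.
- by move=> w; rewrite !mulr_ge0.
rewrite [RHS](@integral_split_nat _ _ _ _ f)//; last 2 first.
- by apply: measurable_funM => //; apply: measurable_funM => //; exact: measurable_prod_Qp.
- by move=> w; rewrite !mulr_ge0// prod_Qp_ge0.
apply: eq_eseriesr => k _; have [_ _ /(_ s e V us sp mV V0) hk] := hf k.
transitivity (\int[P]_w (V w * (h w * (f w == k)%:R * (all_xi s e w)%:R))%:E)%E.
  by apply: eq_integral => w _; congr EFin; ring.
by rewrite hk; apply: eq_integral => w _; congr EFin; ring.
Qed.

(** The indicator of the newly revealed value joins the list [s]. Once the hypothesis on [h] has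
    been applied to [p :: s], the factors of [s] depend on the environment only and move into [V],
    and the same hypothesis for [[:: p]] restores the indicator. *)
Lemma past_step (pst : pred (nat * nat)) h p e0 : ~~ pst p -> past pst h ->
  past (fun p' => pst p' || (p' == p)) (fun w => h w * (xi p w == e0)%:R).
Proof.
move=> np [mh h0 hh]; split.
- by apply: measurable_funM => //; exact: measurable_natr_eq.
- by move=> w; rewrite mulr_ge0.
move=> s e V us sp mV V0.
pose e' p' := if p' == p then e0 else e p'.
have ps : p \notin s.
  by apply/negP => /(allP sp) /=; rewrite eqxx orbT.
have es : {in s, forall p', e' p' = e p'}.
  by move=> p' p's; rewrite /e'; case: eqP => // pp; rewrite pp (negbTE ps) in p's.
have sp' : all (predC pst) s by apply: sub_all sp => p' /=; rewrite negb_or => /andP[].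
transitivity (\int[P]_w (V w * (h w * (all_xi (p :: s) e' w)%:R))%:E)%E.
  apply: eq_integral => w _; congr (_ * _)%:E; rewrite -mulrA; congr (_ * _).
  rewrite /all_xi /= -natrM mulnb /e' eqxx; congr (nat_of_bool (_ && _))%:R.
  by apply: eq_in_all => p' p's; rewrite -/(e' p') es.
rewrite hh//=; last 2 first.
- by rewrite ps.
- by rewrite np.
pose V' w := V w * \prod_(p <- s) Qp p.1 (e p) w.
transitivity (\int[P]_w (V' w * (h w * \prod_(p <- [:: p]) Qp p.1 (e' p) w))%:E)%E.
  apply: eq_integral => w _; congr EFin; rewrite big_cons big_seq1 /V'.
  rewrite [in LHS]big_seq [in RHS]big_seq; rewrite (eq_bigr (fun p => Qp p.1 (e p) w)); last first.
    by move=> p' p's; rewrite es.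
  by ring.
rewrite -hh//; last 3 first.
- by rewrite /= np.
- apply: measurable_funM => //; apply: measurable_prod => p' _; exact: env_measurable_Qp.
- by move=> w; rewrite mulr_ge0// prod_Qp_ge0.
apply: eq_integral => w _; congr EFin; rewrite /V' /all_xi /= andbT /e' eqxx; ring.
Qed.

End quenched.

(** * The comparison process and its generating function *)

Section immigrant_process.
Context (R : realType) (Y : bprei R).
Local Notation P := (bpP Y).
Local Notation T := (bp_space Y).
Local Notation Env := (g_sigma_algebraType (@mark_gen R Y)).

(* The process started from 0 with exactly one immigrant per generation. *)
Fixpoint zeta m (w : T) : nat :=
  if m is m'.+1 then (\sum_(0 <= i < zeta m' w) xi (m', i) w).+1 else 0%N.

Definition rsum m a j (w : T) : nat := (\sum_(a <= i < a + j) xi (m, i) w)%N.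

Lemma rsumSl m a j w : rsum m a j.+1 w = (xi (m, a) w + rsum m a.+1 j w)%N.
Proof. by rewrite /rsum -addSnnS big_ltn// leq_addr. Qed.

Lemma rsumSr m a j w : rsum m a j.+1 w = (rsum m a j w + xi (m, a + j)%N w)%N.
Proof. by rewrite /rsum addnS big_nat_recr// leq_addr. Qed.

Lemma measurable_rsum m a j : measurable_fun [set: T] (rsum m a j).
Proof.
elim: j a => [|j ih] a.
  rewrite (_ : rsum m a 0 = cst 0%N)//; apply/funext => w.
  by rewrite /rsum addn0 big_geq.
rewrite (_ : rsum m a j.+1 = fun w => (fun k w => (k + rsum m a.+1 j w)%N) (xi (m, a) w) w).
  apply: (@measurable_nat_subst _ T _ nat (xi (m, a)) (fun k w => (k + rsum m a.+1 j w)%N)) => // k.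
  by apply: (@measurableT_comp _ _ _ _ _ _ (fun i => (k + i)%N)).
by apply/funext => w; rewrite rsumSl.
Qed.

Lemma zetaS m w : zeta m.+1 w = (rsum m 0 (zeta m w) w).+1.
Proof. by []. Qed.

Lemma measurable_zeta m : measurable_fun [set: T] (zeta m).
Proof.
elim: m => [|m ih]; first exact: measurable_cst.
rewrite (_ : zeta m.+1 = fun w => (fun k w => (rsum m 0 k w).+1) (zeta m w) w)//.
apply: (@measurable_nat_subst _ T _ nat (zeta m) (fun k w => (rsum m 0 k w).+1)) => // k.
by apply: (@measurableT_comp _ _ _ _ _ _ S); [|exact: measurable_rsum].
Qed.

(** Offspring numbers are revealed in lexicographic order; this is what has been revealed before
    individual [j] of generation [m]. *)
Definition rowpst m j : pred (nat * nat) :=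
  fun p => (p.1 < m)%N || ((p.1 == m) && (p.2 < j)%N).

Lemma past_scale pst h (c : R) : 0 <= c -> @past R Y pst h ->
  past pst (fun w => h w * c).
Proof.
move=> c0 [mh h0 hh]; split.
- exact: measurable_funM.
- by move=> w; rewrite mulr_ge0.
move=> s e V us sp mV V0.
have := hh s e (fun w => V w * c) us sp.
rewrite (_ : (fun w => (V w * (h w * c * _))%:E) = (fun w => (V w * c * (h w * (all_xi s e w)%:R))%:E)); last first.
  by apply/funext => w; congr EFin; ring.
rewrite (_ : (fun w => (V w * (h w * c * _))%:E) = (fun w => (V w * c * (h w * \prod_(p <- s) Qp p.1 (e p) w))%:E)); last first.
  by apply/funext => w; congr EFin; ring.
apply; first exact: measurable_funM.
by move=> w; rewrite mulr_ge0.
Qed.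

Lemma past0 pst : @past R Y pst (fun=> 0).
Proof. exact: past_cst. Qed.

Lemma past_rsum m j l h : @past R Y (rowpst m 0) h ->
  past (rowpst m j) (fun w => h w * (rsum m 0 j w == l)%:R).
Proof.
move=> ph; have [mh h0 _] := ph; elim: j l => [|j ih] l.
  have := @past_scale _ _ (0%N == l)%:R (ler0n _ _) ph.
  rewrite (_ : (fun w => h w * (rsum m 0 0 w == l)%:R) = (fun w => h w * (0%N == l)%:R))//.
  by apply/funext => w; rewrite /rsum big_geq.
apply: (@past_split _ _ _ _ (xi (m, j))).
- by apply: measurable_funM => //; apply: measurable_natr_eq; exact: measurable_rsum.
- by move=> w; rewrite mulr_ge0.
- exact: measurable_xi.
move=> e; have [el|le] := leqP e l.
  rewrite (_ : (fun w => _) = (fun w => h w * (rsum m 0 j w == l - e)%N%:R * (xi (m, j) w == e)%:R)).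
    apply: past_sub (past_step _ _ (ih (l - e)%N)); last by rewrite /rowpst /= eqxx !ltnn.
    by move=> [n i]; rewrite /rowpst /= ltnS [(i <= j)%N]leq_eqVlt => /orP[/orP[->//|/andP[-> ->]]|/eqP[-> ->]];
      rewrite ?eqxx ?orbT.
  apply/funext => w; rewrite -!mulrA; congr (_ * _); rewrite rsumSr add0n.
  case: (xi (m, j) w =P e) => [->|]; rewrite ?mulr0// !mulr1; congr (nat_of_bool _)%:R.
  by rewrite -(eqn_add2r e (rsum m 0 j w)) subnK.
rewrite (_ : (fun w => _) = (fun=> 0)); first exact: past0.
apply/funext => w; rewrite rsumSr add0n.
case: eqP; last by rewrite mulr0 mul0r.
move=> hl; case: eqP; last by rewrite mulr0.
by move=> he; move: le; rewrite -hl he ltnNge leq_addl.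
Qed.

Lemma past_zeta m k : @past R Y (rowpst m 0) (fun w => (zeta m w == k)%:R).
Proof.
elim: m k => [|m ih] k; first exact: past_cst.
apply: (@past_split _ _ _ _ (zeta m)) => //.
- by apply: measurable_natr_eq; exact: measurable_zeta.
- exact: measurable_zeta.
move=> k'; case: k => [|l].
  rewrite (_ : (fun w => _) = (fun=> 0)); first exact: past0.
  by apply/funext => w; rewrite zetaS mul0r.
rewrite (_ : (fun w => _) = (fun w => (zeta m w == k')%:R * (rsum m 0 k' w == l)%:R)).
  apply: past_sub (past_rsum k' l (ih k')) => -[n i]; rewrite /rowpst /= ltnS [(n <= m)%N]leq_eqVlt.
  by move=> /orP[->|/andP[->]]; rewrite ?orbT.
apply/funext => w; rewrite zetaS eqSS mulrC.
by case: (zeta m w =P k') => [->//|]; rewrite !mul0r.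
Qed.

Local Notation gfQ n w := (gf (bpQ Y n w : probability nat R)).

Lemma gf_series n w u : 0 <= u <= 1 ->
  ((gfQ n w u)%:E = \sum_(k <oo) (u ^+ k * Qp n k w)%:E)%E.
Proof.
move=> u01; have /andP[u0 _] := u01.
rewrite gfE// integral_law_nat//; last by move=> k; rewrite exprn_ge0.
by apply: eq_eseriesr => k _; rewrite EFinM QpE.
Qed.

Lemma env_measurable_gf n (U : T -> R) : measurable_fun [set: Env] U ->
  (forall w, 0 <= U w <= 1) -> measurable_fun [set: Env] (fun w => gfQ n w (U w)).
Proof.
move=> mU U01; apply/measurable_EFinP.
rewrite (_ : _ \o _ = fun w => (\sum_(k <oo) (U w ^+ k * Qp n k w)%:E)%E).
  apply: ge0_emeasurable_sum => [k w _ _|k _].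
    by rewrite lee_fin mulr_ge0 ?Qp_ge0// exprn_ge0//; have /andP[] := U01 w.
  apply/measurable_EFinP; apply: measurable_funM; first exact: measurable_funX.
  exact: env_measurable_Qp.
by apply/funext => w /=; exact: gf_series.
Qed.

(** One individual is integrated out at a time. Splitting over the value of [xi (m, a)] keeps the
    enlarged [h] a function of the past for the remaining individuals; the indicator is then
    replaced by the weight [Qp], and the series over the values is the generating function. *)
Lemma rsum_gf m j a h (V U : T -> R) : @past R Y (rowpst m a) h ->
  measurable_fun [set: Env] V -> (forall w, 0 <= V w) ->
  measurable_fun [set: Env] U -> (forall w, 0 <= U w <= 1) ->
  (\int[P]_w (V w * (h w * U w ^+ rsum m a j w))%:E =
   \int[P]_w (V w * (h w * gfQ m w (U w) ^+ j))%:E)%E.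
Proof.
move=> ph mV V0 mU U01; elim: j a h V ph mV V0 => [|j ih] a h V ph mV V0.
  apply: eq_integral => w _; rewrite /rsum addn0 big_geq//.
have [mh h0 hh] := ph.
have U0 w : 0 <= U w by have /andP[] := U01 w.
have mg := env_measurable_gf m mU U01.
have g01 w : 0 <= gfQ m w (U w) <= 1 by exact: gf_bounds.
have g0 w : 0 <= gfQ m w (U w) by have /andP[] := g01 w.
have mUr k a' : measurable_fun [set: T] (fun w => U w ^+ rsum m a' k w).
  apply: (@measurable_nat_subst _ T _ R (rsum m a' k) (fun k w => U w ^+ k)).
    exact: measurable_rsum.
  by move=> i; apply: measurable_funX; exact: env_measurable_fun.
rewrite (@integral_split_nat _ _ _ _ (xi (m, a)))//; last 2 first.
- by apply: measurable_funM; [exact: env_measurable_fun|exact: measurable_funM].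
- by move=> w; rewrite !mulr_ge0// exprn_ge0.
transitivity (\sum_(e <oo) \int[P]_w ((V w * h w * gfQ m w (U w) ^+ j)%:E * (U w ^+ e * Qp m e w)%:E))%E.
  apply: eq_eseriesr => e _.
  transitivity (\int[P]_w (V w * U w ^+ e * ((h w * (xi (m, a) w == e)%:R) * U w ^+ rsum m a.+1 j w))%:E)%E.
    apply: eq_integral => w _; congr EFin; rewrite rsumSl.
    by case: (xi (m, a) w =P e) => [->|]; rewrite ?(mulr0, mul0r)// !mulr1 exprD; ring.
  rewrite ih; last 3 first.
  - apply: past_sub (past_step _ _ ph); last by rewrite /rowpst /= eqxx !ltnn.
    by move=> [n i]; rewrite /rowpst /= ltnS [(i <= a)%N]leq_eqVlt => /orP[/orP[->//|/andP[-> ->]]|/eqP[-> ->]];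
      rewrite ?eqxx ?orbT.
  - by apply: measurable_funM => //; exact: measurable_funX.
  - by move=> w; rewrite mulr_ge0// exprn_ge0.
  have := hh [:: (m, a)] (fun=> e) (fun w => V w * U w ^+ e * gfQ m w (U w) ^+ j).
  rewrite /= /rowpst /= eqxx !ltnn /= => /(_ isT isT) hh'.
  transitivity (\int[P]_w (V w * U w ^+ e * gfQ m w (U w) ^+ j * (h w * (all_xi [:: (m, a)] (fun=> e) w)%:R))%:E)%E.
    by apply: eq_integral => w _; congr EFin; rewrite /all_xi /= andbT; ring.
  rewrite hh'.
  - by apply: eq_integral => w _; rewrite -EFinM big_seq1; congr EFin => /=; ring.
  - apply: measurable_funM; last exact: measurable_funX.
    by apply: measurable_funM => //; exact: measurable_funX.
  - by move=> w; rewrite !mulr_ge0// exprn_ge0.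
rewrite -integral_nneseries//; last 2 first.
- move=> e; apply: emeasurable_funM; apply/measurable_EFinP.
    apply: measurable_funM; first by apply: measurable_funM => //; exact: env_measurable_fun.
    by apply: measurable_funX; exact: env_measurable_fun.
  apply: env_measurable_fun; apply: measurable_funM; first exact: measurable_funX.
  exact: env_measurable_Qp.
- by move=> e w _; rewrite -EFinM lee_fin !mulr_ge0 ?exprn_ge0// Qp_ge0.
apply: eq_integral => w _.
rewrite nneseriesZl; last by move=> e _; rewrite lee_fin mulr_ge0 ?exprn_ge0// Qp_ge0.
by rewrite -gf_series// -EFinM exprS; congr EFin; ring.
Qed.

(** [U] has to be random, since the recursion replaces [u] by [f_m(u)], a function of the
    environment. Fixing the value of [zeta m], which is determined by earlier generations, reduces
    the step to [rsum_gf]. *)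
Lemma zeta_gf m (V U : T -> R) :
  measurable_fun [set: Env] V -> (forall w, 0 <= V w) ->
  measurable_fun [set: Env] U -> (forall w, 0 <= U w <= 1) ->
  (\int[P]_w (V w * U w ^+ zeta m w)%:E =
   \int[P]_w (V w * imm_gf (fun n => gfQ n w) m (U w))%:E)%E.
Proof.
elim: m V U => [|m ih] V U mV V0 mU U01; first by [].
have U0 w : 0 <= U w by have /andP[] := U01 w.
have mg := env_measurable_gf m mU U01.
have g01 w : 0 <= gfQ m w (U w) <= 1 by exact: gf_bounds.
have g0 w : 0 <= gfQ m w (U w) by have /andP[] := g01 w.
have mUr k : measurable_fun [set: T] (fun w => U w ^+ rsum m 0 k w).
  apply: (@measurable_nat_subst _ T _ R (rsum m 0 k) (fun k w => U w ^+ k)).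
    exact: measurable_rsum.
  by move=> i; apply: measurable_funX; exact: env_measurable_fun.
have mUz (W : T -> R) k : measurable_fun [set: Env] W -> measurable_fun [set: T] (fun w => W w ^+ zeta k w).
  move=> mW; apply: (@measurable_nat_subst _ T _ R (zeta k) (fun k w => W w ^+ k)).
    exact: measurable_zeta.
  by move=> i; apply: measurable_funX; exact: env_measurable_fun.
have mVU : measurable_fun [set: Env] (fun w => V w * U w) by exact: measurable_funM.
transitivity (\int[P]_w (V w * U w * gfQ m w (U w) ^+ zeta m w)%:E)%E; last first.
  rewrite (ih (fun w => V w * U w) (fun w => gfQ m w (U w)))//; last first.
    by move=> w; rewrite mulr_ge0.
  by apply: eq_integral => w _; rewrite /= mulrA.
rewrite (@integral_split_nat _ _ _ _ (zeta m))//; last 3 first.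
- exact: measurable_zeta.
- by apply: measurable_funM; [exact: env_measurable_fun|exact: mUz].
- by move=> w; rewrite mulr_ge0// exprn_ge0.
rewrite [RHS](@integral_split_nat _ _ _ _ (zeta m))//; last 3 first.
- exact: measurable_zeta.
- by apply: measurable_funM; [exact: env_measurable_fun|exact: mUz].
- by move=> w; rewrite !mulr_ge0// exprn_ge0.
apply: eq_eseriesr => k _.
transitivity (\int[P]_w (V w * U w * ((zeta m w == k)%:R * U w ^+ rsum m 0 k w))%:E)%E.
  apply: eq_integral => w _; congr EFin; rewrite zetaS exprS.
  by case: (zeta m w =P k) => [->|]; rewrite ?(mulr0, mul0r)// mulr1 mul1r mulrA.
rewrite rsum_gf//.
- apply: eq_integral => w _; congr EFin.
  by case: (zeta m w =P k) => [->|]; rewrite ?(mulr0, mul0r)// mulr1 mul1r.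
- exact: past_zeta.
- by move=> w; rewrite mulr_ge0.
Qed.

End immigrant_process.

(** * The order of d_n and the summability of the rates *)

Section dneg_lower.
Context (R : realType) (mu : probability R R).
Variable C : R.
Hypothesis C_gt0 : 0 < C.
Hypothesis prefix_bound : forall e, e = 1 \/ e = -1 ->
  forall n (x : R), 0 <= x -> (0 < n)%N ->
  (Ppow mu n (prefix_le e x) <= (C * (1 + x) / Num.sqrt n%:R)%:E)%E.

(* In the decomposition at the minimum over a horizon of order n the terms k < n
   contribute at most 1/2; the others are bounded by dneg n. *)
Lemma dneg_lower : exists2 c : R, 0 < c & forall n, (0 < n)%N -> c / Num.sqrt n%:R <= dneg mu n.
Proof.
pose D := 1 + 2 * C; have D0 : 0 < D by rewrite /D; have := C_gt0; lra.
(* Chosen so that [C * D / sqrt K <= 1 / 2], the share of the terms [k < n] at the horizon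
   [(K + 1) n]. *)
pose K := (Num.truncn ((2 * C * D) ^+ 2)).+1.
have K0 : 0 < Num.sqrt K%:R :> R by rewrite sqrtr_gt0 ltr0n.
have KD : 2 * C * D <= Num.sqrt K%:R.
  have CD0 : 0 <= 2 * C * D by rewrite mulr_ge0 ?mulr_ge0 ?(ltW C_gt0) ?(ltW D0).
  rewrite -[leLHS]ger0_norm//.
  by rewrite -sqrtr_sqr ler_wsqrtr// ltW// truncnS_gt.
have s0 : 0 < Num.sqrt K.+1%:R :> R by rewrite sqrtr_gt0 ltr0n.
exists (2 * D * Num.sqrt K.+1%:R)^-1; first by rewrite invr_gt0 !mulr_gt0.
move=> n n0; pose N := (K.+1 * n)%N; have q0 : 0 < Num.sqrt n%:R :> R by rewrite sqrtr_gt0 ltr0n.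
have nN : (n <= N)%N by rewrite /N leq_pmull.
have := sum_dneg_pstay mu N; rewrite (@big_cat_nat _ _ _ n) ?leqW//=.
have h1 : \sum_(0 <= k < n) dneg mu k * pstay mu (N - k) <= 2^-1.
  apply: (@le_trans _ _ (\sum_(0 <= k < n) dneg mu k * (C / (Num.sqrt K%:R * Num.sqrt n%:R)))).
    rewrite big_nat [leRHS]big_nat; apply: ler_sum => k /andP[_ kn].
    rewrite ler_wpM2l ?dneg_ge0//.
    have kN : (K * n <= N - k)%N by rewrite leq_subRL ?(leq_trans (ltnW kn))// /N mulSn leq_add2r ltnW.
    have kN0 : (0 < N - k)%N by rewrite (leq_trans _ kN)// muln_gt0.
    apply: (le_trans (pstay_bound prefix_bound kN0)); rewrite ler_pM2l//.
    rewrite lef_pV2 ?posrE ?mulr_gt0 ?sqrtr_gt0 ?ltr0n//.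
    by rewrite -sqrtrM// ler_wsqrtr// -natrM ler_nat.
  rewrite -mulr_suml; apply: (@le_trans _ _ (D * Num.sqrt n%:R * (C / (Num.sqrt K%:R * Num.sqrt n%:R)))).
    rewrite ler_wpM2r// ?(sum_dneg C_gt0 prefix_bound n0)// divr_ge0// ?mulr_ge0// ?ltW//.
  have -> : D * Num.sqrt n%:R * (C / (Num.sqrt K%:R * Num.sqrt n%:R)) = C * D / Num.sqrt K%:R.
    by field; rewrite !gt_eqF.
  rewrite ler_pdivrMr//; lra.
have h2 : \sum_(n <= k < N.+1) dneg mu k * pstay mu (N - k) <= dneg mu n * (D * (Num.sqrt K.+1%:R * Num.sqrt n%:R)).
  apply: (@le_trans _ _ (\sum_(n <= k < N.+1) dneg mu n * pstay mu (N - k))).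
    rewrite big_nat [leRHS]big_nat; apply: ler_sum => k /andP[nk _].
    by rewrite ler_wpM2r ?pstay_ge0// -(subnKC nk) dneg_antimono.
  rewrite -mulr_sumr ler_wpM2l ?dneg_ge0// -sqrtrM// -natrM.
  apply: le_trans (sum_pstay C_gt0 prefix_bound _); last by rewrite muln_gt0.
  have e : \sum_(n <= k < N.+1) pstay mu (N - k) = \sum_(0 <= i < N.+1 - n) pstay mu i.
    rewrite -{1}[n]add0n big_addn big_nat_rev/= big_nat [RHS]big_nat.
    by apply: eq_bigr => i /andP[_ iN]; congr (pstay mu _); lia.
  rewrite -/N e [leRHS](@big_cat_nat _ _ _ (N.+1 - n))//=; last by lia.
  by rewrite lerDl; apply: sumr_ge0 => i _; exact: pstay_ge0.
move=> h; rewrite -invfM -[leLHS]mulr1 ler_pdivrMl; last by rewrite !mulr_gt0.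
have : 2^-1 <= dneg mu n * (D * (Num.sqrt K.+1%:R * Num.sqrt n%:R)) by lra.
lra.
Qed.

End dneg_lower.

(** * Sums and convolutions of power rates *)

Section rates.
Context (R : realType).

(** A discrete form of the comparison with an integral, from [ln(1 - 1 / (m + 2)) <= - 1 / (m + 2)]
    and [exp z >= 1 + z]. *)
Lemma powR_succ_telescope (eta : R) (m : nat) : 0 < eta ->
  eta * m.+2%:R `^ (- 1 - eta) <= m.+1%:R `^ (- eta) - m.+2%:R `^ (- eta).
Proof.
move=> e0; have a0 : 0 < m.+1%:R :> R by []. have b0 : 0 < m.+2%:R :> R by [].
have -> : m.+1%:R `^ (- eta) = m.+2%:R `^ (- eta) * expR (- eta * (ln m.+1%:R - ln m.+2%:R)) :> R.
  rewrite /powR !gt_eqF// -expRD; congr expR; ring.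
have -> : m.+2%:R `^ (- 1 - eta) = m.+2%:R `^ (- eta) / m.+2%:R :> R.
  have -> : - 1 - eta = - eta + - 1 by ring.
  rewrite powRD; last by rewrite (gt_eqF b0) implybT.
  by rewrite [X in _ * X]powRN powRr1.
set p := _ `^ _; have p0 : 0 < p by rewrite powR_gt0.
have -> : eta * (p / m.+2%:R) = p * (eta / m.+2%:R) by ring.
rewrite -[X in _ - X]mulr1 -mulrBr ler_pM2l//.
have h1 : ln m.+1%:R - ln m.+2%:R <= - m.+2%:R^-1 :> R.
  rewrite -ln_div ?posrE//; have -> : m.+1%:R / m.+2%:R = 1 + (- m.+2%:R^-1) :> R.
    have -> : m.+1%:R = m.+2%:R - 1 :> R by rewrite -[m.+2%:R]natr1 addrK.
    by rewrite mulrBl divff ?gt_eqF// mul1r.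
  apply: le_ln1Dx; rewrite ltrN2 invf_lt1//; by rewrite ltr1n.
have h2 := expR_ge1Dx (- eta * (ln m.+1%:R - ln m.+2%:R)).
have /le_trans : eta / m.+2%:R <= - eta * (ln m.+1%:R - ln m.+2%:R).
  by rewrite mulNr -mulrN ler_pM2l// lerNr.
by apply; rewrite lerBrDl.
Qed.

Lemma sum_powR_bounded (eta : R) (n : nat) : 0 < eta ->
  \sum_(0 <= m < n) m.+1%:R `^ (- 1 - eta) <= 1 + eta^-1 :> R.
Proof.
move=> e0; have i0 : 0 < eta^-1 by rewrite invr_gt0.
case: n => [|n]; first by rewrite big_geq// addr_ge0// ltW.
rewrite big_nat_recl//= powR1 lerD2l.
suff : \sum_(0 <= m < n) m.+2%:R `^ (- 1 - eta) <= eta^-1 * (1 - n.+1%:R `^ (- eta)) :> R.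
  move=> /le_trans; apply; rewrite ger_pMr// gerBl; exact: powR_ge0.
elim: n => [|n ih]; first by rewrite big_geq// powR1 subrr mulr0.
rewrite big_nat_recr//=; apply: (le_trans (lerD ih (lexx _))).
have := powR_succ_telescope n e0; rewrite -ler_pdivlMl// => h.
lra.
Qed.

Variables (a : nat -> R) (K eta : R).
Hypothesis eta_gt0 : 0 < eta.
Hypothesis K_ge0 : 0 <= K.
Hypothesis a_ge0 : forall m, 0 <= a m.
Hypothesis a_le : forall m, (0 < m)%N -> a m <= K * m%:R `^ (- 1 - eta).

Lemma rate_summable : cvgn (series a).
Proof.
apply: nondecreasing_is_cvgn.
  apply/nondecreasing_seqP => n; rewrite /series /= big_nat_recr//= lerDl; exact: a_ge0.
exists (a 0%N + K * (1 + eta^-1)) => _ [n _ <-]; rewrite /series /=.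
case: n => [|n].
  rewrite big_geq// addr_ge0// mulr_ge0// addr_ge0// invr_ge0 ltW//.
rewrite big_nat_recl//= lerD2l.
apply: (@le_trans _ _ (\sum_(0 <= m < n) K * m.+1%:R `^ (- 1 - eta))).
  by apply: ler_sum => m _; exact: a_le.
by rewrite -mulr_sumr ler_wpM2l// sum_powR_bounded.
Qed.

Variables (d : nat -> R) (C c : R).
Hypothesis c_gt0 : 0 < c.
Hypothesis d_ge0 : forall n, 0 <= d n.
Hypothesis d_lower : forall n, (0 < n)%N -> c / Num.sqrt n%:R <= d n.
Hypothesis d_sum : forall n, (0 < n)%N -> \sum_(0 <= j < n) d j <= C * Num.sqrt n%:R.

Lemma powRN_cvg0 : (n%:R : R) `^ (- eta) @[n --> \oo] --> (0 : R).
Proof.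
apply/cvgrPdist_lt => e e0; near=> n; rewrite sub0r normrN ger0_norm ?powR_ge0//.
have hn : e `^ (- eta^-1) < n%:R by near: n; exact: nbhs_infty_gtr.
have n0 : 0 < n%:R :> R by apply: le_lt_trans hn; exact: powR_ge0.
have -> : e = (e `^ (- eta^-1)) `^ (- eta).
  by rewrite -powRrM mulrNN mulVf ?powRr1 ?gt_eqF// ltW.
rewrite !(powRN _ eta) ltf_pV2 ?posrE ?powR_gt0//.
by apply: gt0_ltr_powR; rewrite ?nnegrE ?powR_ge0// ltW.
Unshelve. all: by end_near. Qed.

(** For [k <= n / 2] all [a (n - k)] are at most of order [n^(-1 - eta)]; the sum of the [d k] and
    the inverse of [d n] are each at most of order [sqrt n], so [n^(- eta)] remains. *)
Lemma rate_ratio_cvg0 :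
  (d n)^-1 * (\sum_(0 <= k < (n./2).+1) d k * a (n - k)%N) @[n --> \oo] --> (0 : R).
Proof.
have C0 : 0 <= C.
  have := d_sum (isT : 0 < 1)%N; rewrite sqrtr1 mulr1 big_nat1.
  exact: le_trans (d_ge0 0%N).
have ee : 1 + (- 1 - eta) = - eta by ring.
have eprod (q p2 p : R) : c^-1 * q * (C * q * (K * (p * p2))) = c^-1 * (C * (K * p2)) * (q ^+ 2 * p).
  by ring.
pose H := c^-1 * (C * (K * 2^-1 `^ (- 1 - eta))).
apply: (@squeeze_cvgr _ _ _ _ (fun=> 0) (fun n : nat => H * (n%:R : R) `^ (- eta))); last 2 first.
- exact: cvg_cst.
- rewrite -[X in _ --> X](mulr0 H); apply: cvgMr; exact: powRN_cvg0.
near=> n; have n1 : (1 < n)%N by near: n; exists 2%N.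
have n0 : (0 < n)%N by exact: ltn_trans n1.
have nR : 0 < n%:R :> R by rewrite ltr0n.
have q0 : 0 < Num.sqrt n%:R :> R by rewrite sqrtr_gt0.
have dn0 : 0 < d n by apply: lt_le_trans (d_lower n0); rewrite divr_gt0.
apply/andP; split.
  apply: mulr_ge0; first by rewrite invr_ge0 ltW.
  by apply: sumr_ge0 => k _; rewrite mulr_ge0 ?d_ge0 ?a_ge0.
have dinv : (d n)^-1 <= c^-1 * Num.sqrt n%:R.
  rewrite -[leRHS]invrK lef_pV2 ?posrE// ?invr_gt0 ?mulr_gt0 ?invr_gt0//.
  by rewrite invfM invrK d_lower.
have sumle : \sum_(0 <= k < (n./2).+1) d k * a (n - k)%N <=
    C * Num.sqrt n%:R * (K * (n%:R / 2) `^ (- 1 - eta)).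
  apply: (@le_trans _ _ (\sum_(0 <= k < (n./2).+1) d k * (K * (n%:R / 2) `^ (- 1 - eta)))).
    rewrite big_nat [leRHS]big_nat; apply: ler_sum => k /andP[_]; rewrite ltnS => kn.
    have nk0 : (0 < n - k)%N by rewrite subn_gt0; lia.
    rewrite ler_wpM2l ?d_ge0//; apply: (le_trans (a_le nk0)); rewrite ler_wpM2l//.
    rewrite -opprD !powRN lef_pV2 ?posrE ?powR_gt0 ?divr_gt0 ?ltr0n//.
    apply: ge0_ler_powR; rewrite ?nnegrE ?divr_ge0//; first by rewrite addr_ge0// ltW.
    by rewrite ler_pdivrMr// -natrM ler_nat; lia.
  rewrite -mulr_suml ler_wpM2r ?mulr_ge0 ?powR_ge0//.
  apply: (le_trans (d_sum (isT : 0 < (n./2).+1)%N)); rewrite ler_wpM2l// ler_wsqrtr// ler_nat; lia.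
apply: (@le_trans _ _ (c^-1 * Num.sqrt n%:R * (C * Num.sqrt n%:R * (K * (n%:R / 2) `^ (- 1 - eta))))).
  apply: ler_pM => //; first by rewrite invr_ge0 ltW.
  by apply: sumr_ge0 => k _; rewrite mulr_ge0 ?d_ge0 ?a_ge0.
rewrite powRM ?invr_ge0//.
have -> : n%:R `^ (- eta) = Num.sqrt n%:R ^+ 2 * n%:R `^ (- 1 - eta) :> R.
  rewrite sqr_sqrtr// -[X in _ = X * _]powRr1// -powRD; last by rewrite (gt_eqF nR) implybT.
  by rewrite ee.
by rewrite eprod.
Unshelve. all: by end_near. Qed.

End rates.

(** * The environmental walk *)

Section step_law.
Context (R : realType).

Definition log_mean (z : pprobability nat R * pprobability nat R) : R :=
  ln (fine (law_mean (z.1 : probability nat R))).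

Lemma law_meanE (q : probability nat R) : law_mean q = (\int[q]_k (k%:R)%:E)%E.
Proof. by rewrite /law_mean unlock. Qed.

Lemma measurable_law_mean :
  measurable_fun [set: pprobability nat R] (fun q => law_mean (q : probability nat R)).
Proof.
under eq_fun do rewrite law_meanE; exact: measurable_pprob_integral.
Qed.

Lemma measurable_log_mean : measurable_fun setT log_mean.
Proof.
apply: measurableT_comp; first exact: measurable_ln.
apply: measurableT_comp; first exact: fine_measurable.
exact: (measurableT_comp measurable_law_mean measurable_fst).
Qed.

Lemma env_measurable_logM (Y : bprei R) n :
  measurable_fun [set: g_sigma_algebraType (@mark_gen R Y)] (logM Y n).
Proof. exact: (measurableT_comp measurable_log_mean (env_measurable_mark n)). Qed.

Lemma measurable_logM (Y : bprei R) n : measurable_fun [set: bp_space Y] (logM Y n).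
Proof. by apply: env_measurable_fun; exact: env_measurable_logM. Qed.

HB.instance Definition _ (Y : bprei R) n :=
  isMeasurableFun.Build _ _ _ _ (logM Y n) (@measurable_logM Y n).

Definition step_law (X : bprei R) : probability R R :=
  distribution (bpP X) (logM X 0).

Lemma measurable_bpmark (Y : bprei R) n : measurable_fun [set: bp_space Y] (bpmark Y n).
Proof. by apply: env_measurable_fun; exact: env_measurable_mark. Qed.

Lemma mark_law (X Y : bprei R) n A : same_mark_law X Y -> measurable A ->
  bpP Y (bpmark Y n @^-1` A) = bpP X (bpmark X 0 @^-1` A).
Proof. by move=> XY mA; rewrite -XY//; exact: bp_mark_ident. Qed.

(** Only the mark law enters, hence one set of constants, computed from [step_law X], serves all
    initial laws. *)
Lemma walk_law (X Y : bprei R) n F : same_mark_law X Y ->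
  seq_measurable F -> (forall t, 0 <= F t)%E ->
  (\int[bpP Y]_w F (mkseq (logM Y ^~ w) n) = Epow (step_law X) n F)%E.
Proof.
move=> XY mF F0.
apply: (@law_power_measure _ _ R (step_law X) _ _ (bpP Y) (logM Y) n) => //.
move=> A mA.
have mlA i : measurable (log_mean @^-1` A i).
  by rewrite -[X in measurable X]setTI; apply: measurable_log_mean.
have := @bp_mark_indep R Y (iota 0 n) (fun i => log_mean @^-1` A i) (iota_uniq 0 n) mlA.
rewrite (_ : \bigcap_(i in _) _ = [set w | forall i : 'I_n, A i (logM Y i w)]); last first.
  apply/seteqP; split => w /= h i; first by apply: h => /=; rewrite mem_iota/= add0n.
  by rewrite /= mem_iota/= add0n => ni; exact: (h (Ordinal ni)).
move=> ->; rewrite -[in RHS](big_mkord xpredT (fun i => step_law X (A i))) /index_iota subn0.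
by apply: eq_bigr => i _; rewrite (mark_law i XY).
Qed.

Lemma walk_psum (Y : bprei R) n k w : (k <= n)%N ->
  walk Y k w = psum (mkseq (logM Y ^~ w) n) k.
Proof.
move=> kn; apply: eq_big_nat => i /andP[_ ik].
by rewrite nth_mkseq// (leq_trans ik).
Qed.

Lemma walk_min_prefix (Y : bprei R) n w : 0 <= walk_min Y n w ->
  prefix_le (-1) 0 (mkseq (logM Y ^~ w) n).
Proof.
move=> h; apply/prefix_leP => k; rewrite size_mkseq => kn.
rewrite -walk_psum// mulN1r oppr_le0; apply: (le_trans h).
rewrite /walk_min; have : k \in index_iota 0 n.+1 by rewrite mem_index_iota.
elim: (index_iota _ _) => // j s ih; rewrite inE big_cons => /orP[/eqP ->|/ih].
  by rewrite ge_min lexx.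
by move=> hk; rewrite ge_min hk orbT.
Qed.

Lemma env_measurable_walk (Y : bprei R) k :
  measurable_fun [set: g_sigma_algebraType (@mark_gen R Y)] (walk Y k).
Proof. by apply: measurable_sum => i; exact: env_measurable_logM. Qed.

Lemma measurable_walk (Y : bprei R) k : measurable_fun [set: bp_space Y] (walk Y k).
Proof. by apply: env_measurable_fun; exact: env_measurable_walk. Qed.

Lemma probability_integral_bool d (T : measurableType d) (P : probability T R) (b : T -> bool) :
  measurable_fun setT b -> P [set w | b w] = (\int[P]_w (b w)%:R%:E)%E.
Proof.
move=> mb; have mE : measurable [set w | b w].
  rewrite [X in measurable X](_ : _ = b @^-1` [set true]).
    by rewrite -[X in measurable X]setTI; exact: mb.
  by apply/seteqP; split => w /=.
have := integral_indic P measurableT mE; rewrite setIT => <-.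
apply: eq_integral => w _; rewrite indicE; congr (nat_of_bool _)%:R%:E.
by apply/idP/idP; rewrite inE.
Qed.

Lemma dminus_dneg (X : bprei R) n : dminus X n = dneg (step_law X) n.
Proof.
rewrite /dminus /dneg /Ppow; congr fine.
have h0 (t : seq R) : (0 <= (below0 t)%:R%:E :> \bar R)%E by rewrite lee_fin.
have <- := @walk_law X X n (fun t => (below0 t)%:R%:E) (fun _ _ => erefl)
  (seq_measurable_natr (@seq_measurable_below0 R)) h0.
pose b w := all (fun k => walk X k w < 0) (iota 1 n).
have bE w : below0 (mkseq (logM X ^~ w) n) = b w.
  rewrite /below0 size_mkseq; apply: eq_in_all => k; rewrite mem_iota add1n ltnS => /andP[_ kn].
  by rewrite -walk_psum.
have maxE w (s : seq nat) : ((\big[maxe/-oo]_(j <- s) (walk X j w)%:E < 0) = all (fun k => (walk X k w < 0)%R) s)%E.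
  elim: s => [|k s ih]; first by rewrite big_nil ltNyr.
  by rewrite big_cons /= gt_max ih lte_fin.
under eq_integral do rewrite bE; rewrite -probability_integral_bool.
  by congr (bpP X _); apply/seteqP; split => w /=; rewrite maxE /index_iota subSS subn0.
apply: (@measurable_fun_all _ _ _ _ (fun k w => walk X k w < 0)) => k.
by apply: measurable_fun_ltr => //; exact: measurable_walk.
Qed.

End step_law.

(** * Moments and constants of the step law *)

Section moments.
Context (R : realType) (X : bprei R).
Local Notation P := (bpP X).
Local Notation mu := (step_law X).

Lemma integral_step_law (g : R -> \bar R) : measurable_fun setT g -> (forall x, 0 <= g x)%E ->
  (\int[mu]_x g x = \int[P]_w g (logM X 0 w))%E.
Proof. by move=> mg g0; rewrite /step_law ge0_integral_distribution. Qed.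

Hypothesis mean0 : ('E_P[logM X 0] = 0)%E.
Hypothesis var_pos : (0 < 'V_P[logM X 0])%E.
Hypothesis var_fin : ('V_P[logM X 0] < +oo)%E.

Lemma variance_sq : ('V_P[logM X 0] = \int[mu]_x (x ^+ 2)%:E)%E.
Proof.
rewrite integral_step_law; last 2 first.
- by apply/measurable_EFinP; exact: measurable_funX.
- by move=> x; rewrite lee_fin sqr_ge0.
rewrite /variance unlock mean0 unlock; apply: eq_integral => w _.
by rewrite /= -[X in _ = (X ^+ 2)%:E]subr0 expr2.
Qed.

(** Mean zero makes the integrals of the positive and negative parts equal; were they 0, the step
    would vanish almost surely, and the variance with it. *)
Lemma step_moments : exists a s2 : R, [/\ 0 < a,
  (\int[mu]_x (Num.max x 0)%:E = a%:E)%E,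
  (\int[mu]_x (Num.max (- x) 0)%:E = a%:E)%E &
  (\int[mu]_x (x ^+ 2)%:E = s2%:E)%E].
Proof.
have sq0 : (0 <= \int[mu]_x (x ^+ 2)%:E)%E.
  by apply: integral_ge0 => x _; rewrite lee_fin sqr_ge0.
have sqfin : (\int[mu]_x (x ^+ 2)%:E)%E \is a fin_num by rewrite ge0_fin_numE// -variance_sq.
have fin (g : R -> R) : measurable_fun setT g -> (forall x, 0 <= g x) -> (forall x, g x <= 1 + x ^+ 2) ->
    (\int[mu]_x (g x)%:E)%E \is a fin_num.
  move=> mg g0 gle; rewrite ge0_fin_numE; last by apply: integral_ge0 => x _; rewrite lee_fin.
  apply: (@le_lt_trans _ _ (\int[mu]_x (1%:E + (x ^+ 2)%:E))%E).
    apply: ge0_le_integral => //.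
    - by move=> x _; rewrite lee_fin.
    - exact/measurable_EFinP.
    - by apply: emeasurable_funD => //; apply/measurable_EFinP; exact: measurable_funX.
    - by move=> x _; rewrite -EFinD lee_fin.
  rewrite ge0_integralD//; last 2 first.
  - by move=> x _; rewrite lee_fin sqr_ge0.
  - by apply/measurable_EFinP; exact: measurable_funX.
  by rewrite integral_prob_cst lte_add_pinfty ?ltry// -variance_sq.
have mp : measurable_fun [set: R] (fun x : R => Num.max x 0) by exact: measurable_maxr.
have mn : measurable_fun [set: R] (fun x : R => Num.max (- x) 0).
  by apply: measurable_maxr => //; exact: measurableT_comp.
have max0 (x : R) : 0 <= Num.max x 0 by rewrite le_max lexx orbT.
have maxle (x : R) : Num.max x 0 <= 1 + x ^+ 2.
  have [h|h] := leP x 0; first by rewrite addr_ge0// sqr_ge0.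
  nra.
have pfin : (\int[mu]_x (Num.max x 0)%:E)%E \is a fin_num by exact: fin.
have nfin : (\int[mu]_x (Num.max (- x) 0)%:E)%E \is a fin_num.
  by apply: fin => // x; rewrite -sqrrN.
have pn : (\int[mu]_x (Num.max x 0)%:E = \int[mu]_x (Num.max (- x) 0)%:E)%E.
  have e1 : (\int[mu]_x (Num.max x 0)%:E = \int[P]_w ((EFin \o logM X 0)^\+ w))%E.
    rewrite integral_step_law; [|exact/measurable_EFinP|by move=> x; rewrite lee_fin].
    by apply: eq_integral => w _; rewrite funeposE /= EFin_max.
  have e2 : (\int[mu]_x (Num.max (- x) 0)%:E = \int[P]_w ((EFin \o logM X 0)^\- w))%E.
    rewrite integral_step_law; [|exact/measurable_EFinP|by move=> x; rewrite lee_fin].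
    by apply: eq_integral => w _; rewrite funenegE /= EFin_max.
  have := mean0; rewrite unlock integralE -e1 -e2 -(fineK pfin) -(fineK nfin) -EFinB => -[].
  by move/eqP; rewrite subr_eq0 => /eqP ->.
exists (fine (\int[mu]_x (Num.max x 0)%:E)%E), (fine (\int[mu]_x (x ^+ 2)%:E)%E).
split; rewrite ?fineK//.
rewrite lt_neqAle fine_ge0 ?andbT; last by apply: integral_ge0 => x _; rewrite lee_fin.
apply/eqP => a0.
have p0 : (\int[mu]_x (Num.max x 0)%:E = 0)%E by rewrite -(fineK pfin) -a0.
have abs0 : (\int[mu]_x `|x%:E| = 0)%E.
  have -> : (\int[mu]_x `|x%:E| = \int[mu]_x ((Num.max x 0)%R%:E + (Num.max (- x) 0)%R%:E))%E.
    apply: eq_integral => x _; rewrite -EFinD abse_EFin; congr EFin.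
    have [h|h] := leP x 0; have [h'|h'] := leP (- x) 0; rewrite ?(ger0_norm (ltW h))// ?(ler0_norm h)//; lra.
  rewrite ge0_integralD//.
  - by rewrite -pn p0 adde0.
  - by move=> x _; rewrite lee_fin.
  - exact/measurable_EFinP.
  - by move=> x _; rewrite lee_fin.
  - exact/measurable_EFinP.
have mid : measurable_fun [set: R] (fun x : R => x%:E) by exact/measurable_EFinP.
have /(ae_eq_integral_abs mu measurableT mid) ae0 := abs0.
have : (\int[mu]_x (x ^+ 2)%:E = \int[mu]_x (cst 0%E x))%E.
  apply: ge0_ae_eq_integral => //.
  - by apply/measurable_EFinP; exact: measurable_funX.
  - by move=> x _; rewrite lee_fin sqr_ge0.
  - by apply: filterS ae0 => x /= /(_ I) [->]; rewrite expr0n.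
rewrite integral0 => h; have := var_pos; by rewrite variance_sq h ltxx.
Qed.

Lemma step_constants : exists2 C : R, 0 < C &
  (forall e, e = 1 \/ e = -1 -> forall n (x : R), 0 <= x -> (0 < n)%N ->
     (Ppow mu n (prefix_le e x) <= (C * (1 + x) / Num.sqrt n%:R)%:E)%E) /\
  (forall n (y x : R), 0 <= x -> (0 < n)%N ->
     (Ppow mu n (fun t => (y <= total t) && (total t <= y + x))%R <=
       (C * (1 + x) / Num.sqrt n%:R)%:E)%E).
Proof.
have [a [s2 [a0 ip ineg isq]]] := step_moments.
have [C1 C10 h1] := prefix_le_const a0 ip ineg isq.
have [C2 C20 h2] := interval_const a0 ip ineg isq.
exists (C1 + C2); first exact: addr_gt0.
have hle (c : R) n (x : R) : c <= C1 + C2 -> 0 <= x ->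
    (c * (1 + x) / Num.sqrt n%:R <= (C1 + C2) * (1 + x) / Num.sqrt n%:R).
  by move=> hc x0; rewrite ler_wpM2r ?invr_ge0 ?sqrtr_ge0// ler_wpM2r// addr_ge0.
split=> [e he n x x0 n0|n y x x0 n0].
  by apply: (le_trans (h1 e he n x x0 n0)); rewrite lee_fin hle// lerDl ltW.
by apply: (le_trans (h2 n y x x0 n0)); rewrite lee_fin hle// lerDr ltW.
Qed.

End moments.

(** * Almost sure conditions on the environment *)

Section good_environment.
Context (R : realType).

(** The conditions on offspring and immigration form one measurable set of marks, because only the
    mark law passes from [X] to [Y]. In particular, immigration of at least 1 becomes
    [G {0} = 0]. *)
Definition good_mark (kappa : R) : set (pprobability nat R * pprobability nat R) :=
  [set z | [/\ (0 < law_mean (z.1 : probability nat R))%E,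
     (law_mean (z.1 : probability nat R) < +oo)%E,
     (\int[(z.1 : probability nat R)]_k (k%:R ^+ 2)%:E <=
        (kappa * fine (law_mean (z.1 : probability nat R)) ^+ 2)%:E)%E &
     ((z.2 : probability nat R) [set 0%N] = 0)%E]].

Lemma measurable_good_mark kappa : measurable (good_mark kappa).
Proof.
have mm : measurable_fun setT (fun z : pprobability nat R * pprobability nat R =>
    law_mean (z.1 : probability nat R)).
  exact: (measurableT_comp (@measurable_law_mean R) measurable_fst).
have m2 : measurable_fun setT (fun z : pprobability nat R * pprobability nat R =>
    \int[(z.1 : probability nat R)]_k (k%:R ^+ 2)%:E)%E.
  apply: (measurableT_comp (measurable_pprob_integral (g := fun k => k%:R ^+ 2) _) measurable_fst).
  by move=> k; rewrite sqr_ge0.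
have mz : measurable_fun setT (fun z : pprobability nat R * pprobability nat R =>
    (z.2 : probability nat R) [set 0%N]).
  exact: (measurableT_comp (@measurable_pprob_ev R [set 0%N]) measurable_snd).
rewrite (_ : good_mark kappa =
  (fun z => law_mean (z.1 : probability nat R)) @^-1` [set x | 0 < x]%E `&`
  ((fun z => law_mean (z.1 : probability nat R)) @^-1` [set x | x < +oo]%E `&`
  ([set z | \int[(z.1 : probability nat R)]_k (k%:R ^+ 2)%:E <=
        (kappa * fine (law_mean (z.1 : probability nat R)) ^+ 2)%:E]%E `&`
   (fun z => (z.2 : probability nat R) [set 0%N]) @^-1` [set 0%E]))); last first.
  apply/seteqP; split => z /=; first by case.
  by case=> ? [? [? ?]].
apply: measurableI; [|apply: measurableI; [|apply: measurableI]].
- rewrite -[X in measurable X]setTI; exact: measurable_lte.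
- rewrite -[X in measurable X]setTI; exact: measurable_lte.
- rewrite -[X in measurable X]setTI; apply: measurable_lee => //.
  apply/measurable_EFinP; apply: measurable_funM => //; apply: measurable_funX.
  by apply: measurableT_comp mm; exact: fine_measurable.
- by rewrite -[X in measurable X]setTI; apply: mz.
Qed.

Lemma eta0_prob (Y : bprei R) n :
  bpP Y [set w | bpeta Y n.+1 w = 0%N] =
  (\int[bpP Y]_w (bpG Y n w : probability nat R) [set 0%N])%E.
Proof.
pose A' k := if k == n then [set 0%N] else setT.
have sT : <<s (@mark_gen R Y) >> setT by exact: (@measurableT _ (g_sigma_algebraType (@mark_gen R Y))).
have [_ /(_ setT sT)] := @bp_cond_law R Y n.+1 (fun _ _ => setT) A'.
rewrite setIT; set E := [set w | _].
have -> : E = [set w | bpeta Y n.+1 w = 0%N].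
  apply/seteqP; split => w /=.
    by move=> /(_ n (ltnSn n)) [+ _]; rewrite /A' eqxx.
  by move=> h k _; split => //; rewrite /A'; case: eqP => [->|].
move=> ->; apply: eq_integral => w _; rewrite big_ord_recr /= big1 ?mul1e.
  rewrite /A' eqxx big1 ?mule1// => i _; exact: probability_setT.
move=> k _; rewrite /A' ltn_eqF// probability_setT mul1e big1// => i _.
exact: probability_setT.
Qed.

Lemma measurable_G0 (Y : bprei R) n : measurable_fun [set: bp_space Y]
  (fun w => (bpG Y n w : probability nat R) [set 0%N]).
Proof. exact: (measurableT_comp (@measurable_pprob_ev R [set 0%N]) _). Qed.

(** By [eta0_prob] both properties say that the nonnegative variable [G_n {0}] has integral 0. *)
Lemma eta_ge1_ae (Y : bprei R) n :
  {ae bpP Y, forall w, ((bpG Y n w : probability nat R) [set 0%N] = 0)%E} <->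
  {ae bpP Y, forall w, (1 <= bpeta Y n.+1 w)%N}.
Proof.
have mE : measurable [set w | bpeta Y n.+1 w = 0%N].
  rewrite [X in measurable X](_ : _ = bpeta Y n.+1 @^-1` [set 0%N])//.
  by rewrite -[X in measurable X]setTI; apply: measurable_funPT.
have absE : (\int[bpP Y]_w `|(bpG Y n w : probability nat R) [set 0%N]| =
  \int[bpP Y]_w (bpG Y n w : probability nat R) [set 0%N])%E.
  by apply: eq_integral => w _; rewrite gee0_abs.
split=> h.
  exists [set w | bpeta Y n.+1 w = 0%N]; split => //.
    rewrite eta0_prob -absE; apply/(ae_eq_integral_abs _ measurableT (measurable_G0 n)).
    by apply: filterS h => w + _.
  by move=> w /= /negP; rewrite -ltnNge ltnS leqn0 => /eqP.
have E0 : bpP Y [set w | bpeta Y n.+1 w = 0%N] = 0%E.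
  have [N [mN N0 subN]] := h; apply/eqP; rewrite eq_le measure_ge0 andbT -N0.
  by apply: le_measure; rewrite ?inE// => w /= e0; apply: subN => /=; rewrite e0.
have : (\int[bpP Y]_w `|(bpG Y n w : probability nat R) [set 0%N]| = 0)%E by rewrite absE -eta0_prob.
move=> /(ae_eq_integral_abs (bpP Y) measurableT (@measurable_G0 Y n)).
by apply: filterS => w /(_ I).
Qed.

Lemma good_mark_ae (X : bprei R) :
  (exists Cbar : R, {ae bpP X, forall w,
     (law_var (bpQ X 0 w) * ((bpM X 0 w ^+ 2)^-1)%:E <= Cbar%:E)%E}) ->
  {ae bpP X, forall w, (1 <= bpeta X 1 w)%N} ->
  exists2 kappa : R, 1 <= kappa & {ae bpP X, forall w, good_mark kappa (bpmark X 0 w)}.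
Proof.
(* The constant comes from [j^2 <= 2 (j - M)^2 + 2 M^2]; the maximum with 0 ensures [1 <= k]. *)
move=> [Cbar hC] heta; pose k := 2 * Num.max Cbar 0 + 2.
have C0 : 0 <= Num.max Cbar 0 by rewrite le_max lexx orbT.
exists k; first by rewrite /k; lra.
have hG := (eta_ge1_ae X 0).2 heta.
have hM := bp_mean_pos X 0.
near=> w.
have /andP[m0 moo] : (0 < law_mean (bpQ X 0 w) < +oo)%E by near: w.
have g0 : ((bpG X 0 w : probability nat R) [set 0%N] = 0)%E by near: w.
have hv : (law_var (bpQ X 0 w) * ((bpM X 0 w ^+ 2)^-1)%:E <= Cbar%:E)%E by near: w.
split => //=; set q := (bpQ X 0 w : probability nat R) in m0 moo hv *.
set M := fine (law_mean q).
have M0 : 0 < M by rewrite fine_gt0// m0.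
have mE : law_mean q = M%:E by rewrite fineK// gt0_fin_numE.
have vE : law_var q = (\int[q]_j ((j%:R - M) ^+ 2)%:E)%E.
  rewrite /law_var /variance unlock -/(law_mean q) mE unlock; apply: eq_integral => j _.
  by rewrite /= expr2.
have v0 : (0 <= law_var q)%E.
  by rewrite vE; apply: integral_ge0 => j _; rewrite lee_fin sqr_ge0.
have vle : (law_var q <= (Num.max Cbar 0 * M ^+ 2)%:E)%E.
  have M2 : 0 < M ^+ 2 by rewrite exprn_gt0.
  rewrite EFinM -lee_pdivrMr//; apply: (le_trans hv).
  by rewrite lee_fin le_max lexx.
apply: (@le_trans _ _ (\int[q]_j (2%:E * ((j%:R - M) ^+ 2)%:E + (2 * M ^+ 2)%:E))%E).
  apply: ge0_le_integral => //.
  - move=> j _; rewrite -EFinM -EFinD lee_fin.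
    have : 0 <= (j%:R - 2 * M) ^+ 2 by exact: sqr_ge0.
    nra.
rewrite ge0_integralD//; last 2 first.
- by move=> j _; rewrite -EFinM lee_fin mulr_ge0// sqr_ge0.
- by move=> j _; rewrite lee_fin mulr_ge0// sqr_ge0.
rewrite ge0_integralZl//; last by move=> j _; rewrite lee_fin sqr_ge0.
rewrite integral_prob_cst -vE.
apply: (@le_trans _ _ (2%:E * (Num.max Cbar 0 * M ^+ 2)%:E + (2 * M ^+ 2)%:E)%E).
  by apply: leeD => //; apply: lee_wpmul2l.
by rewrite -EFinM -EFinD lee_fin /k; lra.
Unshelve. all: by end_near. Qed.

Lemma good_mark_transfer (X Y : bprei R) kappa : same_mark_law X Y ->
  {ae bpP X, forall w, good_mark kappa (bpmark X 0 w)} ->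
  {ae bpP Y, forall w, forall n, good_mark kappa (bpmark Y n w)}.
Proof.
move=> XY h; apply/ae_foralln => n.
have mG := measurable_good_mark kappa.
exists (bpmark Y n @^-1` (~` good_mark kappa)); split.
- rewrite -[X in measurable X]setTI; apply: measurable_bpmark => //.
  exact: measurableC.
- apply: (etrans (mark_law n XY (measurableC mG))).
  have [N [mN N0 subN]] := h; apply/eqP; rewrite eq_le measure_ge0 andbT -N0.
  apply: le_measure; rewrite ?inE//.
  rewrite -[X in measurable X]setTI; apply: measurable_bpmark => //.
  exact: measurableC.
- by move=> w.
Qed.

Lemma zeta_le_bpZ (Y : bprei R) w : (forall n, (1 <= bpeta Y n.+1 w)%N) ->
  forall m, (zeta m w <= bpZ Y m w)%N.
Proof.
move=> h; elim=> [//|m ih] /=; rewrite -addn1; apply: leq_add => //.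
rewrite -(big_mkord xpredT (fun i => bpxi Y m i w)) [leqRHS](@big_cat_nat _ _ _ (zeta m w))//=.
exact: leq_addr.
Qed.

End good_environment.

(** * The negative moment *)

Section negative_moment.
Context (R : realType) (X Y : bprei R).
Local Notation P := (bpP Y).
Local Notation T := (bp_space Y).
Hypothesis XY : same_mark_law X Y.

Let path m (w : T) : seq R := mkseq (logM Y ^~ w) m.

Lemma measurable_bpZ m : measurable_fun [set: T] (bpZ Y m).
Proof.
elim: m => [//|m ih].
have mr : measurable_fun [set: T] (fun w => rsum m 0 (bpZ Y m w) w).
  exact: (measurable_nat_subst ih (fun k => measurable_rsum m 0 k)).
rewrite (_ : bpZ Y m.+1 =
  fun w => (fun k w => (k + rsum m 0 (bpZ Y m w) w)%N) (bpeta Y m.+1 w) w).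
  apply: (@measurable_nat_subst _ T _ nat (bpeta Y m.+1)
    (fun k w => (k + rsum m 0 (bpZ Y m w) w)%N)) => // k.
  exact: (measurableT_comp (f := fun i => (k + i)%N) _ mr).
apply/funext => w /=.
by rewrite /rsum add0n big_mkord addnC.
Qed.

Lemma measurable_walk_min m : measurable_fun [set: T] (walk_min Y m).
Proof.
rewrite /walk_min; elim: (index_iota 0 m.+1) => [|j r ih].
  by under eq_fun do rewrite big_nil; exact: measurable_walk.
under eq_fun do rewrite big_cons; apply: measurable_minr => //; exact: measurable_walk.
Qed.

Lemma env_measurable_path m : forall p : seq R -> bool, seq_measurable p ->
  measurable_fun [set: g_sigma_algebraType (@mark_gen R Y)] (fun w => p (path m w)).
Proof.
move=> p mp; pose V w := [tuple logM Y i w | i < m].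
have mV : measurable_fun [set: g_sigma_algebraType (@mark_gen R Y)] V.
  apply/measurable_fun_tnthP => i.
  rewrite (_ : _ \o _ = logM Y i); first exact: env_measurable_logM.
  by apply/funext => w; rewrite /= tnth_mktuple.
rewrite (_ : (fun w => _) = (fun t : m.-tuple R => p t) \o V).
  exact: (measurableT_comp (mp m)).
apply/funext => w /=; rewrite /path /mkseq -val_enum_ord -map_comp.
by congr p.
Qed.

(** [imm_gf_le] is applied with [A = exp y * exp(- S_m)], which makes [x m / A = exp(- y) = 1 - u].
    The final logarithm is nonnegative because the sum contains [exp(- S_0) = 1] and [kappa >= 1],
    while [ln A = y - S_m < y - x]. *)
Lemma imm_gf_path_bound kappa (h x y : R) m w : 1 <= kappa -> 0 <= y -> (0 < m)%N ->
  (forall n, good_mark kappa (bpmark Y n w)) ->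
  ~~ jump h (path m w) -> x < total (path m w) ->
  imm_gf (fun n => gf (bpQ Y n w)) m (1 - expR (- y)) <=
    expR (1 - (x - y) / (kappa * (1 + ln (1 + kappa * expR h)))).
Proof.
move=> k1 y0 m0 hg nj xt.
have k0 : 0 < kappa by apply: lt_le_trans k1.
have eh0 : 0 < expR h by exact: expR_gt0.
set c := kappa * _.
have c0 : 0 < c.
  by rewrite mulr_gt0// ltr_pwDl// ln_ge0// lerDl mulr_ge0// ltW.
pose xx n := expR (- walk Y n w).
have M0 n : 0 < bpM Y n w.
  by have [h1 h2 _ _] := hg n; rewrite fine_gt0// h1.
have mE n : law_mean (bpQ Y n w) = (bpM Y n w)%:E.
  by have [h1 h2 _ _] := hg n; rewrite fineK// gt0_fin_numE.
have wS n : walk Y n.+1 w = walk Y n w + logM Y n w by rewrite /walk big_nat_recr.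
have logE n : expR (logM Y n w) = bpM Y n w by rewrite lnK ?posrE.
have xxS n : xx n = bpM Y n w * xx n.+1.
  by rewrite /xx wS -logE -expRD; congr expR; ring.
have xx0 n : 0 < xx n by exact: expR_gt0.
have steple j : (j < m)%N -> xx j <= expR h * xx j.+1.
  move=> jm; rewrite xxS ler_pM2r// -logE ler_expR leNgt.
  apply/negP => hj; move/negP: nj; apply; apply/hasP; exists (logM Y j w) => //.
  by apply: map_f; rewrite mem_iota.
have A0 : 0 < expR y * xx m by rewrite mulr_gt0// expR_gt0.
have xA : xx m / (expR y * xx m) = expR (- y).
  by rewrite invfM mulrCA mulfV ?gt_eqF// mulr1 expRN.
have ey1 : expR (- y) <= 1 by rewrite -[leRHS]expR0 ler_expR; lra.
have u01 : 0 <= 1 - expR (- y) <= 1.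
  by rewrite subr_ge0 ey1 gerBl expR_ge0.
apply: (le_trans (@imm_gf_le R (fun n => gf (bpQ Y n w)) _ (fun n => bpM Y n w) xx kappa (expR h) _ M0 xx0 xxS k1 eh0 m _ _ A0 u01 _ _ _)).
- by move=> n u u01'; exact: gf_bounds.
- move=> n t t01; apply: gf_le => //.
  + exact: ltW.
  + by rewrite -law_meanE mE.
  + by have [_ _ h3 _] := hg n.
- by rewrite xA; lra.
- exact: steple.
- move=> _; apply: (le_trans (steple m.-1 _)); first by rewrite prednK.
  rewrite prednK// ler_pM2l// ler_peMl ?(ltW (xx0 m))//.
  by rewrite -[leLHS]expR0 ler_expR.
rewrite -/c ler_expR xA.
have lnA : ln (expR y * xx m) = y - walk Y m w.
  by rewrite /xx -expRD expRK.
have wt : walk Y m w = total (path m w).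
  by rewrite (walk_psum w (leqnn m)) /total size_mkseq.
have x00 : xx 0 = 1 by rewrite /xx /walk big_geq// oppr0 expR0.
have hs : 0 <= ln (expR y * xx m + kappa * \sum_(0 <= i < m) xx i).
  apply: ln_ge0; rewrite -[leLHS]add0r lerD ?(ltW A0)//.
  rewrite -[leLHS]mulr1 ler_pM// big_ltn// x00 lerDl.
  by apply: sumr_ge0 => i _; exact: ltW.
have : (x - y) / c <= (ln (expR y * xx m + kappa * \sum_(0 <= i < m) xx i) - ln (expR y * xx m)) / c.
  rewrite ler_pM2r ?invr_gt0// lnA wt; lra.
have := expR_ge0 (- y); lra.
Qed.

Let integrand s m (w : T) : R :=
  (bpZ Y m w)%:R `^ (- s) * \1_[set w | (0 < bpZ Y m w)%N /\ 0 <= walk_min Y m w] w.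

Let neg_momentE s m : (neg_moment Y s m = \int[P]_w (integrand s m w)%:E)%E.
Proof. by rewrite /neg_moment unlock. Qed.

Let measurable_integrand s m : measurable_fun [set: T] (integrand s m).
Proof.
have mZ := measurable_bpZ m.
apply: measurable_funM.
  exact: (measurableT_comp (f := fun k : nat => k%:R `^ (- s)) _ mZ).
apply: measurable_indic; apply: measurableI.
  rewrite -[X in measurable X]setTI.
  exact: (mZ measurableT [set k | (0 < k)%N]).
rewrite -[X in measurable X]setTI; apply: measurable_fun_le => //.
exact: measurable_walk_min.
Qed.

Let integrand_ge0 s m w : 0 <= integrand s m w.
Proof. by rewrite mulr_ge0// powR_ge0. Qed.

Let powRN_le1 (s : R) z : 0 < s -> (0 < z)%N -> z%:R `^ (- s) <= 1 :> R.
Proof.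
move=> s0 z0; rewrite /powR gt_eqF ?ltr0n// -[leRHS]expR0 ler_expR mulNr oppr_le0.
by rewrite mulr_ge0 ?(ltW s0)// ln_ge0// ler1n.
Qed.

Let integrand_le1 s m w : 0 < s -> integrand s m w <= 1.
Proof.
move=> s0; rewrite /integrand indicE; case: (boolP (w \in _)) => [/set_mem[z0 _]|_]; last by rewrite mulr0.
by rewrite mulr1 powRN_le1.
Qed.

Lemma neg_moment_le1 s m : 0 < s -> (neg_moment Y s m <= 1)%E.
Proof.
move=> s0; rewrite neg_momentE; apply: (@le_trans _ _ (\int[P]_w 1)%E).
  apply: ge0_le_integral => //.
  - by move=> w _; rewrite lee_fin.
  - exact/measurable_EFinP.
  - by move=> w _; rewrite lee_fin integrand_le1.
by rewrite integral_prob_cst.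
Qed.

Let offspring_range w (u : R) m : 0 <= u <= 1 -> (forall n, (1 <= bpeta Y n.+1 w)%N) ->
  u ^+ bpZ Y m w <= u ^+ zeta m w.
Proof. by move=> /andP[u0 u1] he; apply: ler_wiXn2l => //; exact: zeta_le_bpZ. Qed.

(** With [a = exp(- y) <= 1 / 2] one has [1 - a >= exp(- 2 a)]; hence [(1 - a)^Z >= exp(- 2)] as
    long as [Z <= exp y], whence the factor [exp 2], and [Z] may be replaced by the smaller [zeta].
    For [Z > exp y] the power [Z^(- s)] itself is at most [exp(- s y)]. *)
Let integrand_split (s h x y : R) m w : 0 < s -> ln 2 <= y -> (forall n, (1 <= bpeta Y n.+1 w)%N) ->
  integrand s m w <= (stay_below x (path m w))%:R +
   ((prefix_le (-1) 0 (path m w) && jump h (path m w))%:R + (expR (- s * y) +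
     expR 2 * ((~~ jump h (path m w) && (x < total (path m w)))%:R *
        (1 - expR (- y)) ^+ zeta m w))).
Proof.
move=> s0 y2 he.
have e0 := expR_gt0 (- y).
have e2 : expR (- y) <= 1 / 2.
  by rewrite expRN div1r lef_pV2 ?posrE ?expR_gt0// -[leLHS]lnK ?posrE// ler_expR.
set a := expR (- y) in e0 e2 *.
have u01 : 0 <= 1 - a <= 1 by apply/andP; split; lra.
have r0 (b : bool) : 0 <= expR 2 * (b%:R * (1 - a) ^+ zeta m w).
  by rewrite mulr_ge0 ?expR_ge0// mulr_ge0// exprn_ge0//; case/andP: u01.
have b0 : 0 <= expR (- s * y) by exact: expR_ge0.
rewrite /integrand indicE; case: (boolP (w \in _)) => [/set_mem[/= z0 L0]|_]; last first.
  by rewrite mulr0 !addr_ge0.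
rewrite mulr1; have pr := walk_min_prefix L0.
have Z1 : (bpZ Y m w)%:R `^ (- s) <= 1.
  exact: powRN_le1.
rewrite /stay_below -/(path m w) in pr *; rewrite pr /=.
have [tx|tx] := leP (total (path m w)) x.
  by apply: (le_trans Z1); rewrite lerDl !addr_ge0.
rewrite add0r; have [j|j] := boolP (jump h _).
  by apply: (le_trans Z1); rewrite lerDl addr_ge0.
rewrite add0r /= mul1r.
have [Zy|Zy] := leP (bpZ Y m w)%:R (expR y); last first.
  rewrite -[leLHS]addr0; apply: lerD; last by rewrite mulr_ge0 ?expR_ge0// exprn_ge0//; case/andP: u01.
  rewrite /powR gt_eqF ?ltr0n// ler_expR !mulNr lerN2 ler_pM2l//.
  by rewrite -[leLHS]expRK ler_ln ?posrE ?expR_gt0 ?ltr0n// ltW.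
apply: (le_trans Z1); rewrite -[leLHS]add0r; apply: lerD => //.
apply: (@le_trans _ _ (expR 2 * (1 - a) ^+ bpZ Y m w)); last first.
  by rewrite ler_pM2l ?expR_gt0//; exact: offspring_range.
have lo : expR (- 2 * a) <= 1 - a.
  have := expR_ge1Dx (2 * a); have := expR_gt0 (2 * a).
  rewrite mulNr expRN => E0 E1; rewrite -[leLHS]mul1r ler_pdivrMr//; nra.
have aZ : a * (bpZ Y m w)%:R <= 1.
  by rewrite /a expRN ler_pdivrMl ?expR_gt0// mulr1.
apply: (@le_trans _ _ (expR 2 * expR (- 2 * a) ^+ bpZ Y m w)).
  rewrite -expRM_natl -expRD -[leLHS]expR0 ler_expR; lra.
by rewrite ler_pM2l ?expR_gt0// lerXn2r ?nnegrE ?expR_ge0//; lra.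
Qed.

Let natr_env (b : T -> bool) :
  measurable_fun [set: g_sigma_algebraType (@mark_gen R Y)] b ->
  measurable_fun [set: g_sigma_algebraType (@mark_gen R Y)] (fun w => (b w)%:R : R).
Proof. by move=> mb; apply/measurable_EFinP; exact: (measurable_natr_bool mb). Qed.

Let env_measurable_imm_gf m (U : T -> R) :
  measurable_fun [set: g_sigma_algebraType (@mark_gen R Y)] U ->
  (forall w, 0 <= U w <= 1) ->
  measurable_fun [set: g_sigma_algebraType (@mark_gen R Y)]
    (fun w => imm_gf (fun n => gf (bpQ Y n w)) m (U w)).
Proof.
elim: m U => [|m ih] U mU U01 /=; first exact: measurable_cst.
apply: measurable_funM => //; apply: ih; first exact: env_measurable_gf.
by move=> w; exact: gf_bounds.
Qed.

Lemma neg_moment_split kappa (s h x y : R) m : 0 < s -> 1 <= kappa -> ln 2 <= y -> (0 < m)%N ->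
  {ae bpP Y, forall w, forall n, good_mark kappa (bpmark Y n w)} ->
  (neg_moment Y s m <=
   Ppow (step_law X) m (stay_below x) +
   (Ppow (step_law X) m (fun t => prefix_le (-1)%R 0%R t && jump h t) +
   (expR (- s * y) +
    expR 2 * expR (1 - (x - y) / (kappa * (1 + ln (1 + kappa * expR h)))))%:E))%E.
Proof.
move=> s0 k1 y2 m0 hg.
have y0 : 0 <= y by apply: le_trans y2; rewrite ln_ge0// ler1n.
have he : {ae P, forall w, forall n, (1 <= bpeta Y n.+1 w)%N}.
  apply/ae_foralln => n; apply/(eta_ge1_ae Y n).1.
  by apply: filterS hg => w /(_ n) [].
pose p1 := stay_below x : seq R -> bool.
pose p2 t := prefix_le (-1) 0 t && jump h t.
pose p3 t := ~~ jump h t && (x < total t).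
have mp1 : seq_measurable p1 by exact: seq_measurable_stay_below.
have mp2 : seq_measurable p2.
  by move=> n; apply: measurable_and; [exact: seq_measurable_prefix_le|exact: seq_measurable_jump].
have mp3 : seq_measurable p3.
  move=> n; apply: measurable_and; first by apply: measurable_neg; exact: seq_measurable_jump.
  by apply: measurable_fun_ltr => //; exact: seq_measurable_total.
have menv := natr_env (env_measurable_path m mp3).
pose u := 1 - expR (- y).
have u01 : 0 <= u <= 1.
  rewrite /u subr_ge0 gerBl expR_ge0 andbT -[leRHS]expR0 ler_expR; lra.
pose g w := (p3 (path m w))%:R * u ^+ zeta m w.
have mbool (p : seq R -> bool) : seq_measurable p -> measurable_fun [set: T] (fun w => (p (path m w))%:R%:E : \bar R).
  move=> mp; apply: (@measurable_natr_bool R _ T (fun w => p (path m w))).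
  by apply: env_measurable_fun; exact: env_measurable_path.
have mg : measurable_fun [set: T] g.
  apply: measurable_funM; first by apply/measurable_EFinP; exact: mbool.
  exact: (measurableT_comp (f := fun k : nat => u ^+ k) _ (measurable_zeta m)).
have g0 w : 0 <= g w by rewrite mulr_ge0// exprn_ge0//; case/andP: u01.
have e20 : 0 <= expR 2 :> R by exact: expR_ge0.
have mg2 : measurable_fun [set: T] (fun w => (expR 2)%:E * (g w)%:E)%E.
  apply: emeasurable_funM => //; exact/measurable_EFinP.
rewrite neg_momentE.
apply: (@le_trans _ _ (\int[P]_w ((p1 (path m w))%:R%:E + ((p2 (path m w))%:R%:E +
   ((expR (- s * y))%:E + (expR 2)%:E * (g w)%:E)))%E)%E).
  apply: ae_ge0_le_integral => //.
  - by move=> w _; rewrite lee_fin.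
  - exact/measurable_EFinP.
  - move=> w _; apply: adde_ge0; first by rewrite lee_fin.
    apply: adde_ge0; first by rewrite lee_fin.
    by apply: adde_ge0; rewrite -?EFinM lee_fin ?expR_ge0// mulr_ge0.
  - apply: emeasurable_funD; first exact: mbool.
    apply: emeasurable_funD; first exact: mbool.
    exact: emeasurable_funD.
  - apply: filterS he => w hw _; rewrite -EFinM -!EFinD lee_fin.
    exact: integrand_split.
have gint : (\int[P]_w (g w)%:E <= (expR (1 - (x - y) / (kappa * (1 + ln (1 + kappa * expR h)))))%:E)%E.
  (* The event [p3] is determined by the environment, so its indicator can serve as [V], and the
     path bound is needed on that event only. *)
  rewrite (@zeta_gf R Y m (fun w => (p3 (path m w))%:R) (cst u))//.
  apply: (@le_trans _ _ (\int[P]_w (expR (1 - (x - y) / (kappa * (1 + ln (1 + kappa * expR h)))))%:E)%E).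
    apply: ae_ge0_le_integral => //.
    - move=> w _; rewrite lee_fin mulr_ge0//.
      by have /andP[] := imm_gf_bounds (f := fun n => gf (bpQ Y n w)) (fun n v v01 => gf_bounds _ v01) m u01.
    - apply/measurable_EFinP; apply: env_measurable_fun.
      by apply: measurable_funM => //; exact: env_measurable_imm_gf.
    - apply: filterS hg => w hw _; rewrite lee_fin.
      case: (boolP (p3 (path m w))) => [/andP[p31 p32]|_]; last by rewrite mul0r expR_ge0.
      by rewrite mul1r; exact: imm_gf_path_bound.
  by rewrite integral_prob_cst.
have h0 w : (0 <= (expR (- s * y))%:E + (expR 2)%:E * (g w)%:E)%E.
  by apply: adde_ge0; rewrite -?EFinM lee_fin ?expR_ge0// mulr_ge0.
have mh : measurable_fun [set: T] (fun w => (expR (- s * y))%:E + (expR 2)%:E * (g w)%:E)%E.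
  exact: emeasurable_funD.
rewrite ge0_integralD//; last 3 first.
- exact: mbool.
- by move=> w _; apply: adde_ge0; rewrite ?h0// lee_fin.
- by apply: emeasurable_funD => //; exact: mbool.
rewrite ge0_integralD//; last exact: mbool.
rewrite ge0_integralD//; last by move=> w _; rewrite -EFinM lee_fin mulr_ge0.
rewrite ge0_integralZl//; [|exact/measurable_EFinP|by move=> w _; rewrite lee_fin].
have wl (p : seq R -> bool) : seq_measurable p ->
    (\int[P]_w ((p (path m w))%:R)%:E = Ppow (step_law X) m p)%E.
  move=> mp; apply: (walk_law m XY (F := fun t => ((p t)%:R)%:E)).
    exact: seq_measurable_natr.
  by move=> t; rewrite lee_fin.
rewrite (wl _ mp1) (wl _ mp2); apply: leeD => //; apply: leeD => //.
rewrite EFinD; apply: leeD.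
  by rewrite integral_prob_cst.
by rewrite EFinM; apply: lee_wpmul2l.
Qed.

End negative_moment.

Section rates.
Context (R : realType).

Lemma sqrt3_powR (m : nat) : (Num.sqrt m%:R ^+ 3)^-1 = m%:R `^ (- (3 / 2)) :> R.
Proof.
have -> : - (3 / 2) = 2^-1 * - 3%:R :> R by lra.
by rewrite powRrM powR12_sqrt// powRN powR_mulrn// sqrtr_ge0.
Qed.

(** [(m + 1)^(-2)] lies below [m^(-3/2)] even after multiplication by [sqrt m]; the factor 2 in the
    later choices of [x], [y] and of the logarithmic [h] aims at this power. *)
Lemma expR_ln_le (m : nat) : (0 < m)%N ->
  expR (- 2 * ln m.+1%:R) <= (Num.sqrt m%:R ^+ 3)^-1 :> R /\
  Num.sqrt m%:R * expR (- 2 * ln m.+1%:R) <= (Num.sqrt m%:R ^+ 3)^-1 :> R.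
Proof.
move=> m0; set r := Num.sqrt m%:R : R.
have r1 : 1 <= r by rewrite -[leLHS]sqrtr1 ler_wsqrtr// ler1n.
have r2 : r ^+ 2 = m%:R by rewrite sqr_sqrtr.
have r0 : 0 < r by apply: lt_le_trans r1.
have -> : expR (- 2 * ln m.+1%:R) = ((r ^+ 2 + 1) ^+ 2)^-1.
  by rewrite mulNr expRN expRM_natl lnK ?posrE// r2 natr1.
have b0 : 0 < r ^+ 2 + 1 by rewrite addr_gt0// exprn_gt0.
split.
  rewrite lef_pV2 ?posrE ?exprn_gt0//; have : 0 <= r ^+ 3 * (r - 1) by rewrite mulr_ge0 ?subr_ge0// exprn_ge0// ltW.
  have : 0 <= r ^+ 2 by exact: sqr_ge0.
  nra.
rewrite ler_pdivrMr ?exprn_gt0// mulrC ler_pdivlMr ?exprn_gt0//.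
have : 0 <= r ^+ 2 by exact: sqr_ge0.
nra.
Qed.

Lemma ln_succ_le_powR (eps : R) : 0 < eps -> exists2 K : R, 1 <= K &
  forall m : nat, (0 < m)%N -> 1 + ln m.+1%:R <= K * m%:R `^ eps.
Proof.
move=> e0; have i0 : 0 < eps^-1 by rewrite invr_gt0.
have l2 : 0 <= ln 2 :> R by rewrite ln_ge0// ler1n.
exists (1 + ln 2 + eps^-1); first by lra.
move=> m m0; have mp : 0 < m%:R :> R by rewrite ltr0n.
have m1 : 1 <= m%:R :> R by rewrite ler1n.
have p1 : 1 <= m%:R `^ eps :> R by rewrite -[leLHS](powRr0 (m%:R : R)) ler_powR// ltW.
have : ln m.+1%:R <= ln 2 + ln m%:R :> R.
  rewrite -lnM ?posrE// ler_ln ?posrE//; last by rewrite mulr_gt0.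
  rewrite -natr1; lra.
have : eps * ln m%:R <= m%:R `^ eps - 1 :> R.
  have := @expR_ge1Dx R (eps * ln m%:R); rewrite /powR gt_eqF//; lra.
rewrite -ler_pdivlMl// => h1 h2.
have : eps^-1 * (m%:R `^ eps - 1) <= eps^-1 * m%:R `^ eps by rewrite ler_pM2l//; lra.
have : 0 <= (1 + ln 2) * (m%:R `^ eps - 1) by apply: mulr_ge0; lra.
nra.
Qed.

End rates.

(** * The negative moment for a free level [h] *)

Section core_bound.
Context (R : realType) (X : bprei R).
Variables (C kappa s : R).
Hypothesis C_gt0 : 0 < C.
Hypothesis prefix_bound : forall e, e = 1 \/ e = -1 ->
  forall n (x : R), 0 <= x -> (0 < n)%N ->
  (Ppow (step_law X) n (prefix_le e x) <= (C * (1 + x) / Num.sqrt n%:R)%:E)%E.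
Hypothesis interval_bound : forall n (y x : R), 0 <= x -> (0 < n)%N ->
  (Ppow (step_law X) n (fun t => (y <= total t) && (total t <= y + x))%R <=
   (C * (1 + x) / Num.sqrt n%:R)%:E)%E.
Hypothesis kappa_ge1 : 1 <= kappa.
Hypothesis good_X : {ae bpP X, forall w, good_mark kappa (bpmark X 0 w)}.
Hypothesis s_gt0 : 0 < s.

(** [C1] is fixed before [Y], [m] and [h]; the level [h] stays free because the two moment
    conditions call for different choices. *)
Lemma neg_moment_bound : exists2 C1 : R, 0 < C1 & forall Y, same_mark_law X Y ->
  forall (m : nat) (h : R), (0 < m)%N -> 0 <= h ->
  (neg_moment Y s m <=
   (C1 * ((1 + h) * (1 + ln m.+1%:R)) ^+ 2 * (Num.sqrt m%:R ^+ 3)^-1)%:E +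
   (C1 * Num.sqrt m%:R)%:E * \int[step_law X]_x ((h < x)%R%:R)%:E)%E.
Proof.
have k0 : 0 < kappa by apply: lt_le_trans kappa_ge1.
have lk : 0 <= ln (2 * kappa) by rewrite ln_ge0//; have := kappa_ge1; lra.
have l2 : 0 <= ln 2 :> R by rewrite ln_ge0// ler1n.
(* Collects the coefficients of [1 + x], so that [1 + x <= A (1 + h) (1 + l)]. *)
pose A := 1 + ln 2 + 2 / s + 2 * (kappa * (1 + ln (2 * kappa))).
pose C2 := 27 * C ^+ 3 + 3.
have C20 : 0 < C2 by rewrite /C2 addr_gt0// mulr_gt0// exprn_gt0.
have s2 : 0 <= 2 / s by rewrite divr_ge0// ltW.
have e3 : 0 < expR 2 * expR 1 :> R by rewrite mulr_gt0 ?expR_gt0.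
have CA : 0 <= C2 * A ^+ 2 by rewrite mulr_ge0 ?(ltW C20)// sqr_ge0.
pose C1 := C2 * A ^+ 2 + (1 + expR 2 * expR 1) + (1 + 2 * C).
have := C_gt0 => C0.
exists C1; first by rewrite /C1; lra.
move=> Y XY m h m0 h0.
set l := ln m.+1%:R : R; have l0 : 0 <= l by rewrite ln_ge0// ler1n.
(* Makes [exp(- s y)] at most [(m + 1)^(-2)]; the summand [ln 2] meets the condition of
   [neg_moment_split]. *)
pose y := ln 2 + 2 / s * l.
have sl : 0 <= 2 / s * l by exact: mulr_ge0.
(* A bound, affine in [h], of [kappa (1 + ln(1 + kappa exp h))], obtained from
   [1 <= kappa exp h]. *)
pose b := kappa * (1 + ln (2 * kappa) + h).
have b0 : 0 <= b by rewrite mulr_ge0// ?(ltW k0)//; lra.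
have bl : 0 <= b * l by exact: mulr_ge0.
(* Then [(x - y) / c >= 2 l], and the generating function contributes [(m + 1)^(-2)] up to a
   constant. *)
pose x := y + 2 * (b * l).
have x0 : 0 <= x by rewrite /x /y; lra.
have y2 : ln 2 <= y by rewrite /y; lra.
have hY := good_mark_transfer XY good_X.
apply: (le_trans (neg_moment_split XY h x s_gt0 kappa_ge1 y2 m0 hY)).
have [hr1 hr2] := @expR_ln_le R m m0; rewrite -/l in hr1 hr2.
set r := (Num.sqrt m%:R ^+ 3)^-1 in hr1 hr2 *.
have r0 : 0 <= r by rewrite invr_ge0 exprn_ge0// sqrtr_ge0.
set c := kappa * (1 + ln (1 + kappa * expR h)).
have eh1 : 1 <= expR h by rewrite -[leLHS]expR0 ler_expR.
have keh : 1 <= kappa * expR h by rewrite -[leLHS]mulr1 ler_pM//.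
have c0 : 0 < c.
  by rewrite mulr_gt0// ltr_pwDl// ln_ge0//; lra.
have cb : c <= b.
  rewrite ler_pM2l// -addrA lerD2l.
  have -> : ln (2 * kappa) + h = ln (2 * kappa * expR h).
    by rewrite [in RHS]lnM ?posrE ?expR_gt0 ?mulr_gt0// expRK.
  by rewrite ler_ln ?posrE; lra.
have last1 : expR (- s * y) <= r.
  apply: le_trans hr1; rewrite ler_expR /y mulrDr.
  have -> : - s * (2 / s * l) = - 2 * l by field; rewrite gt_eqF.
  have : 0 <= s * ln 2 by rewrite mulr_ge0// ltW.
  lra.
have last2 : expR (1 - (x - y) / c) <= expR 1 * r.
  apply: (@le_trans _ _ (expR 1 * expR (- 2 * l))); last by rewrite ler_pM2l// expR_gt0.
  rewrite -expRD ler_expR.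
  have : 2 * l <= (x - y) / c.
    rewrite ler_pdivlMr// /x addrAC subrr add0r.
    have : c * l <= b * l by rewrite ler_wpM2r.
    nra.
  lra.
have x1 : 1 + x <= A * ((1 + h) * (1 + l)).
  have hl : 0 <= h * l by exact: mulr_ge0.
  have -> : 1 + x = 1 + ln 2 + 2 / s * l + 2 * (kappa * (1 + ln (2 * kappa)) * l) + 2 * (kappa * (h * l)).
    by rewrite /x /y /b; ring.
  set k1 := kappa * (1 + ln (2 * kappa)).
  have kk1 : kappa <= k1 by rewrite -[leLHS]mulr1 ler_pM2l//; lra.
  have : kappa * (h * l) <= k1 * (h * l) by rewrite ler_wpM2r.
  have k10 : 0 <= k1 by apply: le_trans kk1; exact: ltW.
  rewrite /A -/k1; set S := 2 / s in s2 sl *.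
  have := mulr_ge0 s2 h0; have := mulr_ge0 s2 hl.
  have := mulr_ge0 k10 h0; have := mulr_ge0 k10 hl; have := mulr_ge0 k10 l0.
  have := mulr_ge0 l2 h0; have := mulr_ge0 l2 hl; have := mulr_ge0 l2 l0.
  have -> : (1 + ln 2 + S + 2 * k1) * ((1 + h) * (1 + l)) =
    1 + ln 2 + S + 2 * k1 + h + ln 2 * h + S * h + 2 * (k1 * h) + l + ln 2 * l + S * l + 2 * (k1 * l) +
    (h * l + ln 2 * (h * l) + S * (h * l) + 2 * (k1 * (h * l))) by ring.
  lra.
set J := (\int[step_law X]_x0 _)%E.
have J0 : (0 <= J)%E by apply: integral_ge0 => z _; rewrite lee_fin.
have hstay := stay_below_bound C_gt0 prefix_bound interval_bound m0 x0.
have hjump := jump_bound C_gt0 prefix_bound h m0.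
set G := ((1 + h) * (1 + l)) in x1 *.
have G1 : 1 <= G by rewrite -[leLHS]mulr1 ler_pM//; lra.
apply: (@le_trans _ _ ((C2 * (1 + x) ^+ 2 * r)%:E +
    (((1 + 2 * C) * Num.sqrt m%:R)%:E * J + (r + expR 2 * (expR 1 * r))%:E))%E).
  apply: leeD => //; apply: leeD => //; rewrite lee_fin; apply: lerD => //.
  by rewrite ler_pM2l// expR_gt0.
rewrite addeCA addeC -EFinD; apply: leeD.
  rewrite lee_fin.
  have h1 : C2 * (1 + x) ^+ 2 * r <= C2 * (A * G) ^+ 2 * r.
    rewrite ler_wpM2r// ler_pM2l// lerXn2r ?nnegrE//; [lra|apply: le_trans x1; lra].
  have G2 : 1 <= G ^+ 2 by rewrite exprn_ege1.
  have h2 : (1 + expR 2 * expR 1) * r <= (1 + expR 2 * expR 1) * (G ^+ 2 * r).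
    rewrite ler_pM2l; last lra.
    by rewrite ler_peMl.
  have h3 : 0 <= (1 + 2 * C) * (G ^+ 2 * r).
    by rewrite mulr_ge0 ?mulr_ge0 ?sqr_ge0//; lra.
  have -> : C1 * G ^+ 2 * r = C2 * (A * G) ^+ 2 * r + (1 + expR 2 * expR 1) * (G ^+ 2 * r) + (1 + 2 * C) * (G ^+ 2 * r).
    by rewrite /C1; ring.
  have -> : r + expR 2 * (expR 1 * r) = (1 + expR 2 * expR 1) * r by ring.
  lra.
apply: lee_wpmul2r => //; rewrite lee_fin ler_wpM2r ?sqrtr_ge0//.
rewrite /C1; lra.
Qed.

End core_bound.

(** * Tail of one step and the two rates *)

Section jump_tail.
Context (R : realType) (X : bprei R).

(** Markov's inequality for [phi] of the positive part, in a form that covers both the exponential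
    and the power. *)
Lemma jump_tail_moment (phi : R -> R) (h E : R) : measurable_fun setT phi ->
  (forall x, 0 <= phi x) -> 0 < phi h -> (forall x, h < x -> phi h <= phi (Num.max x 0)) ->
  ('E_(bpP X)[fun w => (phi (Num.max (logM X 0 w) 0))%R] <= E%:E)%E ->
  (\int[step_law X]_x ((h < x)%R%:R)%:E <= ((phi h)^-1 * E)%:E)%E.
Proof.
move=> mphi phi0 ph hle hE.
have mb : measurable_fun [set: R] (fun x : R => ((h < x)%R%:R)%:E : \bar R).
  apply: (@measurable_natr_bool R _ R (fun x => h < x)).
  exact: measurable_fun_ltr.
rewrite integral_step_law//.
have ml := @measurable_logM R X 0.
have mm : measurable_fun [set: bp_space X] (fun w => (phi (Num.max (logM X 0 w) 0))%:E).
  apply/measurable_EFinP; apply: measurableT_comp => //.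
  exact: measurable_maxr.
apply: (@le_trans _ _ (\int[bpP X]_w (((phi h)^-1)%:E * (phi (Num.max (logM X 0 w) 0))%:E)%E)%E).
  apply: ge0_le_integral => //.
  - exact: (measurableT_comp mb ml).
  - exact: emeasurable_funM.
  - move=> w _; rewrite -EFinM lee_fin.
    case: (boolP (h < _)) => hw; last by rewrite mulr_ge0// invr_ge0.
    by rewrite ler_pdivlMl// mulr1 hle.
rewrite ge0_integralZl//; last 2 first.
- by move=> w _; rewrite lee_fin.
- by rewrite lee_fin invr_ge0.
rewrite EFinM; apply: lee_wpmul2l; first by rewrite lee_fin invr_ge0.
by apply: le_trans hE; rewrite unlock.
Qed.

End jump_tail.

Section rate_conclusions.
Context (R : realType).

Lemma natr_powR_gt0 (m : nat) (p : R) : (0 < m)%N -> 0 < (m%:R : R) `^ p.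
Proof. by move=> m0; rewrite powR_gt0// ltr0n. Qed.

Lemma rate_exp_le (C : R) : 0 <= C -> exists2 K : R, 0 <= K &
  forall m : nat, (0 < m)%N -> rate_exp C m <= K * m%:R `^ (- 1 - 4^-1).
Proof.
(* The fourth power of the logarithm costs [m^(4/16)], leaving the exponent
   [- 3/2 + 1/4 = - 1 - 1/4]. *)
move=> C0; have [|K0 K01 hK] := @ln_succ_le_powR R 16^-1; first by rewrite invr_gt0.
exists (C * K0 ^+ 4); first by rewrite mulr_ge0// exprn_ge0//; lra.
move=> m m0; rewrite /rate_exp (maxn_idPr m0).
have p0 := natr_powR_gt0 16^-1 m0.
have l0 : 0 <= ln m.+1%:R :> R by rewrite ln_ge0// ler1n.
have h : (1 + ln m.+1%:R) ^+ 4 <= K0 ^+ 4 * m%:R `^ 4^-1.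
  have -> : m%:R `^ 4^-1 = (m%:R `^ 16^-1) ^+ 4 :> R.
    by rewrite -powR_mulrn ?powR_ge0// -powRrM; congr (_ `^ _); lra.
  by rewrite -exprMn lerXn2r ?nnegrE ?hK// ?addr_ge0// mulr_ge0// ?(ltW p0)//; lra.
have -> : - 1 - 4^-1 = - (3 / 2) + 4^-1 :> R by lra.
rewrite powRD; last by rewrite pnatr_eq0 -lt0n m0 implybT.
by rewrite -mulrA -[leRHS]mulrA ler_wpM2l// [leRHS]mulrCA ler_wpM2l// powR_ge0.
Qed.

Variables (X : bprei R) (C : R).
Hypothesis C_gt0 : 0 < C.
Hypothesis prefix_bound : forall e, e = 1 \/ e = -1 ->
  forall n (x : R), 0 <= x -> (0 < n)%N ->
  (Ppow (step_law X) n (prefix_le e x) <= (C * (1 + x) / Num.sqrt n%:R)%:E)%E.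

Lemma rate_sums (a : nat -> R) (K eta : R) : 0 < eta -> 0 <= K -> (forall m, 0 <= a m) ->
  (forall m : nat, (0 < m)%N -> a m <= K * m%:R `^ (- 1 - eta)) ->
  cvgn (series a) /\
  (dminus X n)^-1 * (\sum_(0 <= k < (n./2).+1) dminus X k * a (n - k)%N)
    @[n --> \oo] --> (0 : R).
Proof.
move=> e0 K0 a0 ha; split; first exact: rate_summable e0 K0 a0 ha.
have [c c0 hc] := dneg_lower C_gt0 prefix_bound.
apply: (rate_ratio_cvg0 e0 K0 a0 ha (C := 1 + 2 * C) c0).
- by move=> n; rewrite dminus_dneg dneg_ge0.
- by move=> n n0; rewrite dminus_dneg hc.
- move=> n n0; under eq_bigr do rewrite dminus_dneg.
  exact: (sum_dneg C_gt0 prefix_bound n0).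
Qed.

End rate_conclusions.

Section proposition.
Context (R : realType) (X : bprei R).
Hypothesis mean0 : ('E_(bpP X)[logM X 0] = 0)%E.
Hypothesis var_pos : (0 < 'V_(bpP X)[logM X 0])%E.
Hypothesis var_fin : ('V_(bpP X)[logM X 0] < +oo)%E.
Hypothesis offspring_var : exists Cbar : R, {ae bpP X, forall w,
  (law_var (bpQ X 0 w) * ((bpM X 0 w ^+ 2)^-1)%:E <= Cbar%:E)%E}.
Hypothesis immigration_ge1 : {ae bpP X, forall w, (1 <= bpeta X 1 w)%N}.
Variable s : R.
Hypothesis s_gt0 : 0 < s.

Lemma finite_expectation (g : bp_space X -> R) : (forall w, 0 <= g w) ->
  ('E_(bpP X)[g] < +oo)%E -> exists2 E : R, 0 <= E & ('E_(bpP X)[g] = E%:E)%E.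
Proof.
move=> g0 hE; have E0 : (0 <= 'E_(bpP X)[g])%E by apply: expectation_ge0.
exists (fine ('E_(bpP X)[g])%E); first exact: fine_ge0.
by rewrite fineK// ge0_fin_numE.
Qed.

Lemma exponential_tail_rate : (exists theta : R, 0 < theta /\
      ('E_(bpP X)[fun w => expR (theta * Num.max (logM X 0 w) 0)%R] < +oo)%E) ->
   exists C : R,
     (forall (Y : bprei R), same_mark_law X Y ->
        forall m : nat, (neg_moment Y s m <= (rate_exp C m)%:E)%E) /\
     cvgn (series (rate_exp C)) /\
     (dminus X n)^-1 *
       (\sum_(0 <= k < (n./2).+1) dminus X k * rate_exp C (n - k)%N)
       @[n --> \oo] --> (0 : R).
Proof.
move=> [theta [t0 hfin]].
have [E E0 hE] := finite_expectation (fun w => expR_ge0 _) hfin.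
have [C C0 [hpre hint]] := step_constants mean0 var_pos var_fin.
have [kappa k1 hgood] := good_mark_ae offspring_var immigration_ge1.
have [C1 C10 hC1] := neg_moment_bound C0 hpre hint k1 hgood s_gt0.
(* The square comes from [1 + h <= (1 + 2 / theta) (1 + l)] with [h = (2 / theta) l], and [E] from
   the tail bound at [h]. *)
pose D := (1 + 2 / theta) ^+ 2 + E.
have tt : 0 < 2 / theta by rewrite divr_gt0.
have D0 : 0 <= D by rewrite addr_ge0// sqr_ge0.
(* The summand 1 covers [m = 0], where the moment is at most 1 and the rate equals [Ct]. *)
pose Ct := 1 + C1 * D.
have CD : 0 <= C1 * D by rewrite mulr_ge0// ltW.
have Ct0 : 0 <= Ct by rewrite addr_ge0.
have l0 m : 0 <= ln m.+1%:R :> R by rewrite ln_ge0// ler1n.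
have rate0 m : 0 <= rate_exp Ct m.
  by rewrite /rate_exp mulr_ge0 ?exprn_ge0 ?addr_ge0// mulr_ge0// powR_ge0.
exists Ct; split.
  move=> Y XY [|m].
    apply: (le_trans (neg_moment_le1 Y 0 s_gt0)); rewrite lee_fin /rate_exp.
    by rewrite powR1 ln1 addr0 expr1n !mulr1 lerDl.
  set l := ln m.+2%:R : R; have l0' : 0 <= l by exact: l0.
  pose h := 2 / theta * l.
  have h0 : 0 <= h by rewrite mulr_ge0// ltW.
  apply: (le_trans (hC1 Y XY m.+1 h isT h0)).
  have [hr1 hr2] := @expR_ln_le R m.+1 isT; rewrite -/l in hr1 hr2 *.
  rewrite sqrt3_powR in hr1 hr2 *; set r := _ `^ _ in hr1 hr2 *.
  have r0 : 0 <= r by exact: powR_ge0.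
  have hJ : (\int[step_law X]_x ((h < x)%R%:R)%:E <= (expR (- 2 * l) * E)%:E)%E.
    have -> : expR (- 2 * l) = (expR (theta * h))^-1.
      by rewrite -expRN; congr expR; rewrite /h; field; rewrite gt_eqF.
    apply: (@jump_tail_moment R X (fun x => expR (theta * x))) => //.
    - by apply: measurableT_comp => //; exact: measurable_funM.
    - exact: expR_gt0.
    - by move=> x hx; rewrite ler_expR ler_pM2l// le_max (ltW hx).
    - by rewrite hE.
  have J0 : (0 <= \int[step_law X]_x ((h < x)%R%:R)%:E)%E.
    by apply: integral_ge0 => x _; rewrite lee_fin.
  apply: (@le_trans _ _ ((C1 * ((1 + h) * (1 + l)) ^+ 2 * r)%:E +
      (C1 * Num.sqrt m.+1%:R)%:E * (expR (- 2 * l) * E)%:E)%E).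
    by apply: leeD => //; apply: lee_wpmul2l => //; rewrite lee_fin mulr_ge0 ?sqrtr_ge0// ltW.
  rewrite -EFinM -EFinD lee_fin /rate_exp (maxn_idPr (isT : (0 < m.+1)%N)) -/l -/r.
  have h1 : 1 + h <= (1 + 2 / theta) * (1 + l).
    rewrite /h; have := mulr_ge0 (ltW tt) l0'; nra.
  have q1 : 1 <= (1 + l) ^+ 4 by rewrite exprn_ege1// lerDl.
  (* Both [1 + h] and [1 + l] are of the order of the logarithm, hence its fourth power in the
     rate. *)
  have h2 : ((1 + h) * (1 + l)) ^+ 2 <= (1 + 2 / theta) ^+ 2 * (1 + l) ^+ 4.
    have -> : (1 + 2 / theta) ^+ 2 * (1 + l) ^+ 4 = ((1 + 2 / theta) * (1 + l) * (1 + l)) ^+ 2 by ring.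
    rewrite lerXn2r ?nnegrE ?mulr_ge0//; try lra.
    by rewrite ler_wpM2r//; lra.
  have h3 : C1 * ((1 + h) * (1 + l)) ^+ 2 * r <= C1 * ((1 + 2 / theta) ^+ 2 * (1 + l) ^+ 4) * r.
    by rewrite ler_wpM2r// ler_pM2l.
  have h4 : C1 * Num.sqrt m.+1%:R * (expR (- 2 * l) * E) <= C1 * (E * (r * (1 + l) ^+ 4)).
    have -> : C1 * Num.sqrt m.+1%:R * (expR (- 2 * l) * E) = C1 * (E * (Num.sqrt m.+1%:R * expR (- 2 * l))) by ring.
    rewrite ler_pM2l// ler_wpM2l//; apply: (le_trans hr2); by rewrite ler_peMr.
  have h5 : 0 <= r * (1 + l) ^+ 4 by rewrite mulr_ge0// exprn_ge0// addr_ge0.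
  apply: (le_trans (lerD h3 h4)).
  have -> : Ct * r * (1 + l) ^+ 4 = r * (1 + l) ^+ 4 + (C1 * ((1 + 2 / theta) ^+ 2 * (1 + l) ^+ 4) * r + C1 * (E * (r * (1 + l) ^+ 4))).
    by rewrite /Ct /D; ring.
  by rewrite lerDr.
have [K K0 hK] := rate_exp_le Ct0.
by apply: (rate_sums C0 hpre _ K0 rate0 hK); rewrite invr_gt0.
Qed.

Lemma polynomial_tail_rate (q : R) : 12 < q ->
      ('E_(bpP X)[fun w => ((Num.max (logM X 0 w) 0) `^ q)%R] < +oo)%E ->
   0 < delta q /\
   exists C : R,
     (forall (Y : bprei R), same_mark_law X Y ->
        forall m : nat, (neg_moment Y s m <= (rate_poly C q m)%:E)%E) /\
     cvgn (series (rate_poly C q)) /\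
     (dminus X n)^-1 *
       (\sum_(0 <= k < (n./2).+1) dminus X k * rate_poly C q (n - k)%N)
       @[n --> \oo] --> (0 : R).
Proof.
move=> q12 hfin.
have q4 : 0 < q + 4 by lra.
have d0 : 0 < delta q by rewrite /delta divr_gt0//; lra.
split=> //.
have [E E0 hE] := finite_expectation (fun w => powR_ge0 _ _) hfin.
have [C C0 [hpre hint]] := step_constants mean0 var_pos var_fin.
have [kappa k1 hgood] := good_mark_ae offspring_var immigration_ge1.
have [C1 C10 hC1] := neg_moment_bound C0 hpre hint k1 hgood s_gt0.
(* 4 * eps - 3 / 2 = 1 / 2 - q * eps = - 1 - delta q *)
pose eps := 2 / (q + 4); have eps0 : 0 < eps by rewrite divr_gt0.
have [K K1 hK] := ln_succ_le_powR eps0.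
have K0 : 0 < K by apply: lt_le_trans K1.
(* From [1 + h <= 2 h] and [1 + l <= K h] with [h = N^eps]: the logarithm is charged the same power
   as [h], whence [N^(4 eps)]. *)
pose D := 4 * K ^+ 2 + E.
have D0 : 0 <= D by rewrite addr_ge0// mulr_ge0// sqr_ge0.
pose Ct := 1 + C1 * D.
have CD : 0 <= C1 * D by rewrite mulr_ge0// ltW.
have Ct0 : 0 <= Ct by rewrite addr_ge0.
have rate0 m : 0 <= rate_poly Ct q m by rewrite mulr_ge0// powR_ge0.
exists Ct; split.
  move=> Y XY [|m].
    apply: (le_trans (neg_moment_le1 Y 0 s_gt0)); rewrite lee_fin /rate_poly.
    by rewrite powR1 mulr1 lerDl.
  set N := m.+1%:R : R; have N0 : 0 < N by [].
  have N1 : 1 <= N by rewrite ler1n.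
  have NX a b : N `^ a * N `^ b = N `^ (a + b) by rewrite powRD// (gt_eqF N0) implybT.
  set l := ln m.+2%:R : R; have l0 : 0 <= l by rewrite ln_ge0// ler1n.
  pose h := N `^ eps.
  have h1 : 1 <= h by rewrite -[leLHS](powRr0 N) ler_powR// ltW.
  have h0 : 0 <= h by lra.
  apply: (le_trans (hC1 Y XY m.+1 h isT h0)).
  rewrite -/l sqrt3_powR -/N.
  have hJ : (\int[step_law X]_x ((h < x)%R%:R)%:E <= (N `^ (- (eps * q)) * E)%:E)%E.
    have -> : N `^ (- (eps * q)) = (h `^ q)^-1 by rewrite /h -powRrM powRN.
    apply: (@jump_tail_moment R X (fun x => x `^ q)) => //.
    - by move=> x; exact: powR_ge0.
    - rewrite powR_gt0//; lra.
    - move=> x hx; rewrite ge0_ler_powR ?nnegrE ?le_max ?(ltW hx) ?lexx ?orbT//; lra.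
    - by rewrite hE.
  apply: (@le_trans _ _ ((C1 * ((1 + h) * (1 + l)) ^+ 2 * N `^ (- (3 / 2)))%:E +
      (C1 * Num.sqrt N)%:E * (N `^ (- (eps * q)) * E)%:E)%E).
    by apply: leeD => //; apply: lee_wpmul2l => //; rewrite lee_fin mulr_ge0 ?sqrtr_ge0// ltW.
  rewrite -EFinM -EFinD lee_fin /rate_poly (maxn_idPr (isT : (0 < m.+1)%N)) -/N.
  have e1 : - 1 - delta q = - (3 / 2) + (eps + eps + (eps + eps)).
    by rewrite /delta /eps; field; rewrite gt_eqF.
  have e2 : - 1 - delta q = 2^-1 + - (eps * q).
    by rewrite /delta /eps; field; rewrite gt_eqF.
  have hsq : ((1 + h) * (1 + l)) ^+ 2 <= 4 * K ^+ 2 * N `^ (eps + eps + (eps + eps)).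
    rewrite -!NX -/h.
    have -> : 4 * K ^+ 2 * (h * h * (h * h)) = ((2 * h) * (K * h)) ^+ 2 by ring.
    have := hK m.+1 isT; rewrite -/l -/N -/h => hl.
    rewrite lerXn2r ?nnegrE ?mulr_ge0//; try lra.
    apply: ler_pM => //; lra.
  have t1 : C1 * ((1 + h) * (1 + l)) ^+ 2 * N `^ (- (3 / 2)) <=
      C1 * (4 * K ^+ 2) * N `^ (- 1 - delta q).
    rewrite e1 -NX.
    have -> : C1 * (4 * K ^+ 2) * (N `^ (- (3 / 2)) * N `^ (eps + eps + (eps + eps))) =
      C1 * (4 * K ^+ 2 * N `^ (eps + eps + (eps + eps))) * N `^ (- (3 / 2)) by ring.
    by rewrite ler_wpM2r ?powR_ge0// ler_pM2l.
  have t2 : C1 * Num.sqrt N * (N `^ (- (eps * q)) * E) = C1 * E * N `^ (- 1 - delta q).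
    rewrite e2 -NX powR12_sqrt ?(ltW N0)//; ring.
  rewrite t2; apply: (le_trans (lerD t1 (lexx _))).
  have -> : Ct * N `^ (- 1 - delta q) = N `^ (- 1 - delta q) +
     (C1 * (4 * K ^+ 2) * N `^ (- 1 - delta q) + C1 * E * N `^ (- 1 - delta q)).
    by rewrite /Ct /D; ring.
  by rewrite lerDr powR_ge0.
apply: (rate_sums C0 hpre d0 Ct0 rate0) => m m0.
by rewrite /rate_poly (maxn_idPr m0).
Qed.

End proposition.

Theorem propositionA4 (R : realType) (X : bprei R)
  (mean0 : ('E_(bpP X)[logM X 0] = 0)%E)
  (var_pos : (0 < 'V_(bpP X)[logM X 0])%E)
  (var_fin : ('V_(bpP X)[logM X 0] < +oo)%E)
  (offspring_var : exists Cbar : R, {ae bpP X, forall w,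
     (law_var (bpQ X 0 w) * ((bpM X 0 w ^+ 2)^-1)%:E <= Cbar%:E)%E})
  (immigration_ge1 : forall n : nat, (1 <= n)%N ->
     {ae bpP X, forall w, (1 <= bpeta X n w)%N})
  (s : R) (s_gt0 : 0 < s) :
  ((exists theta : R, 0 < theta /\
      ('E_(bpP X)[fun w => expR (theta * Num.max (logM X 0 w) 0)%R] < +oo)%E) ->
   exists C : R,
     (forall (nu : probability nat R) (Y : bprei R),
        same_mark_law X Y -> has_init_law Y nu ->
        forall m : nat, (neg_moment Y s m <= (rate_exp C m)%:E)%E) /\
     cvgn (series (rate_exp C)) /\
     (dminus X n)^-1 *
       (\sum_(0 <= k < (n./2).+1) dminus X k * rate_exp C (n - k)%N)
       @[n --> \oo] --> (0 : R))
  /\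
  (forall q : R, 12 < q ->
      ('E_(bpP X)[fun w => ((Num.max (logM X 0 w) 0) `^ q)%R] < +oo)%E ->
   0 < delta q /\
   exists C : R,
     (forall (nu : probability nat R) (Y : bprei R),
        same_mark_law X Y -> has_init_law Y nu ->
        forall m : nat, (neg_moment Y s m <= (rate_poly C q m)%:E)%E) /\
     cvgn (series (rate_poly C q)) /\
     (dminus X n)^-1 *
       (\sum_(0 <= k < (n./2).+1) dminus X k * rate_poly C q (n - k)%N)
       @[n --> \oo] --> (0 : R)).
Proof.
have imm1 := immigration_ge1 1%N isT.
split=> [h|q q12 hq].
  have [C [h1 h2]] := exponential_tail_rate mean0 var_pos var_fin offspring_var imm1 s_gt0 h.
  by exists C; split => // nu Y XY _; exact: h1.
have [d0 [C [h1 h2]]] := polynomial_tail_rate mean0 var_pos var_fin offspring_var imm1 s_gt0 q12 hq.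
by split=> //; exists C; split => // nu Y XY _; exact: h1.
Qed.
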